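(* Let $M>0$ and let $(B_N)_{N\ge 1}$ be a sequence of deterministic real symmetric $N\times N$ matrices with $\sup_N\|B_N\|_\infty<M$. Let $\theta\in\mathbb{R}\setminus\{0\}$ with $|\theta|<\frac{1}{4M^2+10M+1}$. Then for any given $n$, the spherical integral has the asymptotic expansion, as $N\to\infty$, $$e^{-\frac{N}{2}\int_0^{2\theta}R_{B_N}(s)\,ds}\,I_N(\theta,B_N)=m_0+\frac{m_1}{N}+\frac{m_2}{N^2}+\cdots+\frac{m_n}{N^n}+O\Big(\frac{1}{N^{n+1}}\Big),$$ where the coefficients $m_0,\dots,m_n$ depend only on $\theta$, $v$ and the derivatives of the Hilbert transform of the empirical spectral distribution of $B_N$, namely on $A_2,A_3,\dots,A_{2n+2}$ (that is, they are functions of these quantities, with no other dependence on $N$ or $B_N$). In particular $$m_0=\frac{1}{\sqrt{A_2}},\qquad m_1=\frac{1}{\sqrt{A_2}}\left(\frac{3}{2}\frac{A_4}{A_2^2}-\frac{5}{3}\frac{A_3^2}{A_2^3}+\frac16\right).$$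
   Context: $\|B\|_\infty$ denotes the operator norm of $B$, i.e. the maximum of $|\lambda|$ over the eigenvalues $\lambda$ of $B$. The (orthogonal, rank one) spherical integral is $$I_N(\theta,B_N)=\int_{O(N)}\exp\{\theta N\,(e_1^{*}B_Ne_1)\}\,dm_N(U),$$ where $m_N$ is the Haar probability measure on the orthogonal group $O(N)$ and $e_1$ is the first column of $U$. For a real symmetric matrix $B$ of size $N$ with eigenvalues $\lambda_1,\dots,\lambda_N$, let $H_B(z)=\frac1N\sum_{i=1}^N\frac{1}{z-\lambda_i}$ for $z\in\mathbb{R}\setminus[\lambda_{\min}(B),\lambda_{\max}(B)]$ (the Hilbert transform of its empirical spectral distribution). $H_B$ is a bijection from $(-\infty,\lambda_{\min}(B))\cup(\lambda_{\max}(B),\infty)$ onto $\mathbb{R}\setminus\{0\}$; let $H_B^{-1}$ be its inverse and let $R_B(z)=H_B^{-1}(z)-\frac1z$ for $z\in\mathbb{R}\setminus\{0\}$ (the $R$-transform). With $\lambda_1,\dots,\lambda_N$ the eigenvalues of $B_N$, put $v=R_{B_N}(2\theta)$ and, for $k\ge1$, $$A_k=\frac{(-1)^{k-1}}{(k-1)!(2\theta)^k}\frac{d^{k-1}H_{B_N}}{dz^{k-1}}\Big(v+\frac1{2\theta}\Big)=\frac1N\sum_{i=1}^N\frac{1}{(1-2\theta\lambda_i+2\theta v)^k}.$$ The quantities $v$, $A_k$ depend on $N$. $O(N^{-l})$ denotes a quantity bounded in magnitude by $CN^{-l}$ for some constant $C>0$ independent of $N$. *)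

(* Defs.v *)
From HB Require Import structures.
From mathcomp Require Import all_boot all_order all_algebra.
From mathcomp Require Import all_classical all_reals all_analysis.

Set Implicit Arguments.
Unset Strict Implicit.
Unset Printing Implicit Defensive.

Import Order.TTheory GRing.Theory Num.Theory.
Import numFieldNormedType.Exports.

Local Open Scope classical_set_scope.
Local Open Scope ring_scope.

(* The eigenvalues with multiplicity, in an unspecified order: the roots of
   the characteristic polynomial when it splits over R (as it does for every
   symmetric matrix), and a junk value otherwise. *)
Definition eigenvalues (R : realType) (n : nat) (B : 'M[R]_n) : n.-tuple R :=
  xget [tuple 0 | i < n]
    [set s : n.-tuple R | char_poly B = \prod_(x <- s) ('X - x%:P)].

Definition eig_min (R : realType) (n : nat) (B : 'M[R]_n.+1) : R :=
  \big[Num.min/thead (eigenvalues B)]_(x <- eigenvalues B) x.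

Definition eig_max (R : realType) (n : nat) (B : 'M[R]_n.+1) : R :=
  \big[Num.max/thead (eigenvalues B)]_(x <- eigenvalues B) x.

Definition opnorm (R : realType) (n : nat) (B : 'M[R]_n) : R :=
  \big[Num.max/0]_(x <- eigenvalues B) `|x|.

Definition hilbert (R : realType) (n : nat) (B : 'M[R]_n) (z : R) : R :=
  n%:R^-1 * \sum_(x <- eigenvalues B) (z - x)^-1.

Definition hilbert_dom (R : realType) (n : nat) (B : 'M[R]_n.+1) : set R :=
  `]-oo, eig_min B[ `|` `]eig_max B, +oo[.

(* A junk value outside the image of hilbert_dom B, i.e. at 0. *)
Definition hilbert_inv (R : realType) (n : nat) (B : 'M[R]_n.+1) : R -> R :=
  'pinv_(fun=> 0) (hilbert_dom B) (hilbert B).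

Definition Rtransform (R : realType) (n : nat) (B : 'M[R]_n.+1) (z : R) : R :=
  hilbert_inv B z - z^-1.

Definition oriented_integral (R : realType) (f : R -> R) (a b : R) : R :=
  if a <= b then \int[lebesgue_measure]_(x in `[a, b]) f x
  else - \int[lebesgue_measure]_(x in `[b, a]) f x.

Definition vpar (R : realType) (n : nat) (B : 'M[R]_n.+1) (theta : R) : R :=
  Rtransform B (2 * theta).

(* Meaningful for k >= 1. *)
Definition Acoef (R : realType) (n : nat) (B : 'M[R]_n.+1) (theta : R)
    (k : nat) : R :=
  (-1) ^+ k.-1 / ((k.-1)`!%:R * (2 * theta) ^+ k)
  * derive1n k.-1 (hilbert B) (vpar B theta + (2 * theta)^-1).

(* The vector (A_2, ..., A_{2n+2}). *)
Definition Avec (R : realType) (N n : nat) (B : 'M[R]_N.+1) (theta : R) :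
    'rV[R]_(n.*2.+1) :=
  \row_(j < n.*2.+1) Acoef B theta j.+2.

Definition borel_mx (R : realType) (n : nat) :=
  g_sigma_algebraType (@open 'M[R]_n).

Definition orthogonal_group (R : realType) (n : nat) : set 'M[R]_n :=
  [set U | U^T *m U = 1%:M].

(* The Haar probability measure of O(n), seen through the inclusion of O(n) in
   the space of matrices: a Borel probability measure carried by O(n) and
   invariant under left translation by every element of O(n). *)
Definition is_haar (R : realType) (n : nat)
    (mu : probability (borel_mx R n) R) : Prop :=
  mu (@orthogonal_group R n) = 1%E /\
  forall V : 'M[R]_n, orthogonal_group V ->
  forall S : set (borel_mx R n), measurable S ->
    mu ((fun U : 'M[R]_n => V *m U) @^-1` S) = mu S.

Definition spherical_integral (R : realType) (n : nat)
    (mu : probability (borel_mx R n.+1) R) (theta : R) (B : 'M[R]_n.+1) : R :=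
  \int[mu]_(U in @orthogonal_group R n.+1)
    expR (theta * n.+1%:R * ((col ord0 U)^T *m B *m col ord0 U) ord0 ord0).

(* Main.v *)
(** Put s = 2 theta, zeta = 1 + s v, a_i = zeta - s lambda_i and
    y_i = 1 / a_i - 1, so that the y_i sum to 0, |y_i| <= 2/3 and A_k is the mean
    of the (1 + y_i)^k. As the integral of R over [0, s] is
    zeta - 1 - (1/N) sum_i ln a_i, the quantity to expand is Lambda(1), where
      Lambda(tau) = prod_i (1 + tau y_i)^(-1/2) * E exp (N tau Z / 2),
      Z = sum_i D_i e_i^2,   D_i = y_i / (1 + tau y_i),
    and e is the first column of the Haar matrix. Invariance under infinitesimal
    plane rotations gives Schwinger-Dyson equations for the moments of Z under the
    measure tilted by exp (N tau Z / 2). One of them reads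
      d/dtau ln Lambda = - (N tau / 2) E_tau[Z^2];
    a second one, together with 1 + tau sum_i y_i e_i^2 >= 1/3, bounds
    E_tau[Z^(2m)] by C_m N^(-m); iterating them all expands N E_tau[Z^2] in powers
    of 1/N, with coefficients rational in tau and in the means s_l of the y_i^l.
    Integrate over [0, 1] and exponentiate: the coefficient of N^(-k) in
    ln Lambda(1) involves s_2, ..., s_(2k+2) only, which are linear combinations
    of A_2, ..., A_(2k+2) and 1. *)

Require Import Defs.
From HB Require Import structures.
From mathcomp Require Import all_boot all_order all_algebra.
From mathcomp Require Import all_classical all_reals all_analysis.
From mathcomp Require Import measurable_realfun complex ring lra zify.

Set Implicit Arguments.
Unset Strict Implicit.
Unset Printing Implicit Defensive.

Import Order.TTheory GRing.Theory Num.Theory.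
Import numFieldNormedType.Exports.

Local Open Scope classical_set_scope.
Local Open Scope ring_scope.

(** * Expectation over the Haar measure *)

(** The denominators in D_i make 1 - tau D_i = 1 / (1 + tau y_i). A Gaussian vector with independent
    centred coordinates of variance (1 + tau y_i) / N then has mean squared norm 1 for every tau,
    because the y_i sum to 0: along the whole path the saddle point stays in place. For that vector
    Z has mean (1/N) sum_i y_i = 0, which is why Z lives on the scale N^(-1/2) and why the factor N
    in front of E_tau[Z^2] leaves a bounded derivative. The path starts at Lambda(0) = 1, so no
    normalisation has to be computed separately.

    The obstacle is uniformity: B_N changes with N, so each constant must serve all N, all B_N and
    all tau in [0, 1] at once. The moments are therefore reduced to the relations of [sd_system],
    and remainders are estimated over all its instances together. Differentiation under the integral
    sign is replaced by explicit quadratic remainders, and integration of E_tau[Z^2] in tau by a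
    mean value inequality. *)

Lemma cvg_bigsum (R : realType) (T : Type) (F : set_system T) (FF : Filter F)
    (I : Type) (r : seq I) (f : I -> T -> R) (a : I -> R) :
  (forall i, f i x @[x --> F] --> a i) ->
  (\sum_(i <- r) f i x) @[x --> F] --> \sum_(i <- r) a i.
Proof.
move=> fa; elim: r => [|i r IHr].
  by rewrite big_nil; under eq_fun do rewrite big_nil; exact: cvg_cst.
by rewrite big_cons; under eq_fun do rewrite big_cons; exact: cvgD.
Qed.

Section HaarExpectation.
Variables (R : realType) (n : nat).
Notation BM := (borel_mx R n.+1).
Notation On := (@orthogonal_group R n.+1).

Lemma measurable_fun_borel_mx (f : BM -> R) :
  (forall A : set R, open A -> @open 'M[R]_n.+1 (f @^-1` A)) ->
  measurable_fun setT f.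
Proof.
move=> fo.
apply: (measurability _ (RGenOpens.measurableE R)).
move=> _ [_ [a [b ->] <-]]; rewrite setTI.
by apply: sub_sigma_algebra; apply: fo; exact: interval_open.
Qed.

Lemma measurable_entry (i j : 'I_n.+1) :
  measurable_fun setT (fun U : BM => (U : 'M[R]_n.+1) i j).
Proof.
apply: measurable_fun_borel_mx => A oA.
apply: (@open_comp _ _ (fun U : 'M[R]_n.+1 => U i j)) => // U _.
exact: coord_continuous.
Qed.

Lemma continuous_mulmx_left (V : 'M[R]_n.+1) :
  continuous (fun U : 'M[R]_n.+1 => V *m U).
Proof.
move=> U.
have FU : Filter (nbhs U) := nbhs_filter U.
have FF := fmap_filter (fun W : 'M[R]_n.+1 => V *m W) FU.
apply: (iffRL (@cvg_mx_entourageP R _ _ _ FF _)) => A eA.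
apply: filter_forall => i; apply: filter_forall => j.
have cij : (fun U : 'M[R]_n.+1 => (V *m U) i j) @ U --> (V *m U) i j.
  rewrite (_ : (fun U : 'M[R]_n.+1 => _) = fun U => \sum_k V i k * U k j).
    rewrite mxE; apply: cvg_bigsum => k.
    by apply: cvgM; [exact: cvg_cst|exact: coord_continuous].
  by apply/funext => W; rewrite mxE.
have /cvg_entourageP/(_ A eA) := cij.
move=> h; apply: (@filterS _ _ FU _ _ _ h) => W /=; rewrite ?inE; exact.
Qed.

Lemma measurable_mulmx_left (V : 'M[R]_n.+1) :
  measurable_fun setT (fun U : BM => (V *m (U : 'M[R]_n.+1) : BM)).
Proof.
apply: (@measurability _ _ BM BM setT (fun U : BM => (V *m (U : 'M[R]_n.+1) : BM)) (@open 'M[R]_n.+1)) => //.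
move=> _ [A oA <-]; rewrite setTI.
apply: sub_sigma_algebra.
apply: open_comp oA => U _; exact: continuous_mulmx_left.
Qed.

(** All the orthogonality equations are gathered into one sum of squares [F], whose zero set is
    O(n). *)
Lemma measurable_orthogonal_group : measurable (On : set BM).
Proof.
pose F (U : BM) := \sum_i \sum_j ((\sum_k (U : 'M[R]_n.+1) k i * (U : 'M[R]_n.+1) k j) - (i == j)%:R) ^+ 2.
have mF : measurable_fun setT F.
  apply: measurable_sum => i; apply: measurable_sum => j.
  under eq_fun do rewrite expr2.
  suff mh : measurable_fun setT (fun U : BM => \sum_k (U : 'M[R]_n.+1) k i * (U : 'M[R]_n.+1) k j - (i == j)%:R) by exact: measurable_funM.
  apply: measurable_funB; last exact: measurable_cst.
  by apply: measurable_sum => k; apply: measurable_funM; exact: measurable_entry.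
have := mF measurableT [set 0] (measurable_set1 0); rewrite setTI.
congr (measurable _); apply/seteqP; split => U /=.
- move=> /eqP; rewrite psumr_eq0 => [/allP h|i _]; last first.
    by apply: sumr_ge0 => j _; exact: sqr_ge0.
  apply/matrixP => i j; rewrite !mxE.
  have := h i (mem_index_enum _); rewrite /= psumr_eq0 => [/allP/(_ j)|k _]; last first.
    exact: sqr_ge0.
  rewrite mem_index_enum => /(_ isT) /=; rewrite sqrf_eq0 subr_eq0 => /eqP <-.
  by apply: eq_bigr => k _; rewrite mxE.
- move=> /matrixP h; rewrite /F big1// => i _; rewrite big1// => j _.
  have := h i j; rewrite !mxE => <-.
  have -> : \sum_k U^T i k * U k j = \sum_k U k i * U k j by apply: eq_bigr => k _; rewrite mxE.
  by rewrite subrr expr0n.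
Qed.

(** The bound is asked on O(n) only: matrix entries are unbounded elsewhere. *)
Definition bmeas (f : BM -> R) : Prop :=
  measurable_fun setT f /\ exists C, forall U, On U -> `|f U| <= C.

Lemma bmeas_cst (c : R) : bmeas (fun=> c).
Proof. by split; [exact: measurable_cst|exists `|c|]. Qed.

Lemma bmeasD (f g : BM -> R) : bmeas f -> bmeas g -> bmeas (fun U => f U + g U).
Proof.
move=> [mf [C Cf]] [mg [D Dg]]; split; first exact: measurable_funD.
by exists (C + D) => U OU; rewrite (le_trans (ler_normD _ _))// lerD ?Cf ?Dg.
Qed.

Lemma bmeasM (f g : BM -> R) : bmeas f -> bmeas g -> bmeas (fun U => f U * g U).
Proof.
move=> [mf [C Cf]] [mg [D Dg]]; split; first exact: measurable_funM.
by exists (C * D) => U OU; rewrite normrM ler_pM ?Cf ?Dg.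
Qed.

Lemma bmeas_sum (I : Type) (r : seq I) (f : I -> BM -> R) :
  (forall i, bmeas (f i)) -> bmeas (fun U => \sum_(i <- r) f i U).
Proof.
move=> bf; elim: r => [|i r IHr].
  by under eq_fun do rewrite big_nil; exact: bmeas_cst.
by under eq_fun do rewrite big_cons; exact: bmeasD.
Qed.

Lemma bmeasX (f : BM -> R) k : bmeas f -> bmeas (fun U => f U ^+ k).
Proof.
move=> bf; elim: k => [|k IHk].
  by under eq_fun do rewrite expr0; exact: bmeas_cst.
by under eq_fun do rewrite exprS; exact: bmeasM.
Qed.

Lemma bmeas_expR (f : BM -> R) : bmeas f -> bmeas (fun U => expR (f U)).
Proof.
move=> [mf [C Cf]]; split; first exact: (measurableT_comp (@measurable_expR R)).
exists (expR C) => U OU; rewrite ger0_norm ?expR_ge0// ler_expR.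
by rewrite (le_trans (ler_norm _))// Cf.
Qed.

Lemma col_orthogonal (U : 'M[R]_n.+1) (j : 'I_n.+1) :
  On U -> \sum_i U i j ^+ 2 = 1.
Proof.
move=> /matrixP /(_ j j); rewrite !mxE eqxx mulr1n => h.
by rewrite -[RHS]h; apply: eq_bigr => i _; rewrite mxE expr2.
Qed.

Lemma entry_sqr_le1 (U : 'M[R]_n.+1) i j : On U -> U i j ^+ 2 <= 1.
Proof.
move=> OU; rewrite -(col_orthogonal j OU) (bigD1 i)//= lerDl.
by apply: sumr_ge0 => k _; exact: sqr_ge0.
Qed.

Lemma entry_norm_le1 (U : 'M[R]_n.+1) i j : On U -> `|U i j| <= 1.
Proof.
move=> OU; rewrite -(@ler_pXn2r _ 2)// ?nnegrE// real_normK ?num_real//.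
by rewrite expr1n; exact: entry_sqr_le1.
Qed.

Lemma bmeas_entry i j : bmeas (fun U => (U : 'M[R]_n.+1) i j).
Proof.
split; first exact: measurable_entry.
by exists 1 => U; exact: entry_norm_le1.
Qed.

Lemma bmeas_mulmx (V : 'M[R]_n.+1) (f : BM -> R) : On V ->
  bmeas f -> bmeas (fun U : BM => f (V *m (U : 'M[R]_n.+1) : BM)).
Proof.
move=> OV [mf [C Cf]]; split.
  exact: (measurableT_comp mf (measurable_mulmx_left V)).
exists C => U OU; apply: Cf; rewrite /orthogonal_group /=.
rewrite trmx_mul mulmxA -(mulmxA _ V^T) (_ : V^T *m V = 1%:M)//.
by rewrite mulmx1.
Qed.

Variable mu : probability BM R.

Definition Ex (f : BM -> R) : R := \int[mu]_(U in On) f U.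

Lemma eq_Ex f g : (forall U, On U -> f U = g U) -> Ex f = Ex g.
Proof. by move=> fg; apply: eq_Rintegral => U; rewrite inE; exact: fg. Qed.

Lemma bmeas_integrable f : bmeas f -> mu.-integrable On (EFin \o f).
Proof.
move=> [mf [C Cf]]; apply: measurable_bounded_integrable => //.
- exact: measurable_orthogonal_group.
- by rewrite (le_lt_trans (probability_le1 _ measurable_orthogonal_group))// ltry.
- exact: measurable_funTS.
- exists C; split; first exact: num_real.
  by move=> x Cx U OU; exact: le_trans (Cf _ OU) (ltW Cx).
Qed.

Lemma ExD f g : bmeas f -> bmeas g -> Ex (fun U => f U + g U) = Ex f + Ex g.
Proof.
move=> bf bg; apply: RintegralD; last 2 first.
- exact: bmeas_integrable.
- exact: bmeas_integrable.
- exact: measurable_orthogonal_group.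
Qed.

Lemma ExZ c f : bmeas f -> Ex (fun U => c * f U) = c * Ex f.
Proof.
move=> bf; apply: RintegralZl; last exact: bmeas_integrable.
exact: measurable_orthogonal_group.
Qed.

Lemma Ex_sum (I : Type) (r : seq I) (f : I -> BM -> R) :
  (forall i, bmeas (f i)) ->
  Ex (fun U => \sum_(i <- r) f i U) = \sum_(i <- r) Ex (f i).
Proof.
move=> bf; elim: r => [|i r IHr].
  rewrite big_nil; under eq_Ex do rewrite big_nil.
  by rewrite /Ex Rintegral_cst ?mul0r//; exact: measurable_orthogonal_group.
rewrite big_cons -IHr -ExD//; last exact: bmeas_sum.
by apply: eq_Ex => U _; rewrite big_cons.
Qed.

Lemma le_Ex f g : bmeas f -> bmeas g ->
  (forall U, On U -> f U <= g U) -> Ex f <= Ex g.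
Proof.
move=> bf bg fg; apply: le_Rintegral => //.
- exact: measurable_orthogonal_group.
- exact: bmeas_integrable.
- exact: bmeas_integrable.
Qed.

Hypothesis haar : is_haar mu.

Lemma Ex_cst c : Ex (fun=> c) = c.
Proof.
rewrite /Ex Rintegral_cst; last exact: measurable_orthogonal_group.
suff -> : fine (mu On) = 1 by rewrite mulr1.
by rewrite -[RHS]/(fine 1%E); congr fine; exact: haar.1.
Qed.

Lemma Ex_mulmx V f : On V -> bmeas f ->
  Ex (fun U : BM => f (V *m (U : 'M[R]_n.+1) : BM)) = Ex f.
Proof.
move=> OV bf; have mV := measurable_mulmx_left V.
pose phi (U : BM) : BM := V *m (U : 'M[R]_n.+1).
have OVE : phi @^-1` On = On.
  apply/seteqP; split => U /=; rewrite /phi /orthogonal_group /=.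
    by rewrite trmx_mul mulmxA -(mulmxA _ V^T) (_ : V^T *m V = 1%:M)// mulmx1.
  by move=> OU; rewrite trmx_mul mulmxA -(mulmxA _ V^T) (_ : V^T *m V = 1%:M)// mulmx1.
rewrite /Ex /Rintegral; congr fine.
have mf : measurable_fun [set: BM] (EFin \o f) by apply/measurable_EFinP; exact: bf.1.
have intf : mu.-integrable (phi @^-1` On) (EFin \o f \o phi).
  by rewrite OVE; apply: bmeas_integrable; exact: bmeas_mulmx.
(* By invariance the image of [mu] under left multiplication by V is [mu], and by [OVE] the group is
   its own preimage. *)
have := integral_pushforward mV mf intf measurable_orthogonal_group.
rewrite OVE => /esym E1.
apply: etrans E1 _.
by apply: eq_measure_integral => A mA _; exact: haar.2.
Qed.

End HaarExpectation.

(** * Invariance under infinitesimal rotations *)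

(** Only 1 + x <= exp x is used, at h and at - h; the latter, multiplied by exp h, gives exp h - 1
    <= h exp h. *)
Lemma expR_taylor1_le (R : realType) (h : R) :
  `|expR h - 1 - h| <= h ^+ 2 * expR `|h|.
Proof.
have e1 := expR_ge1Dx h; have e2 := expR_ge1Dx (- h).
have e0 := expR_gt0 h; have eN := expR_gt0 (- h).
have ee : expR h * expR (- h) = 1 by rewrite -expRD subrr expR0.
have e3 : expR h - 1 <= h * expR h.
  suff : expR h * (1 + - h) <= 1 by lra.
  by rewrite -[leRHS]ee ler_pM2l.
rewrite ger0_norm; last lra.
have [h0|h0] := lerP 0 h.
  rewrite ger0_norm// expr2.
  have : h * (expR h - 1) <= h * (h * expR h) by rewrite ler_wpM2l.
  lra.
have eh1 : 1 <= expR `|h|.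
  by rewrite -expR0 ler_expR.
have : - h * (1 - expR h) <= - h * (- h) by rewrite ler_pM2l; lra.
have : h ^+ 2 * 1 <= h ^+ 2 * expR `|h| by rewrite ler_wpM2l ?sqr_ge0.
rewrite expr2; lra.
Qed.

(** A chain rule for exp with explicit remainder: [a] is the exponent, [dl] its increment, [h * b]
    the linear part of [dl]. It serves along rotations and again in the variable tau; its constant
    depends on the bounds alone, so the estimate can be integrated over O(n). *)
Lemma expR_perturb_le (R : realType) (a b dl h A B C : R) :
  `|h| <= 1 -> `|a| <= A -> `|b| <= B -> `|dl - h * b| <= C * h ^+ 2 ->
  `|expR (a + dl) - expR a - h * (b * expR a)|
  <= expR A * (C + (B + C) ^+ 2 * expR (B + C)) * h ^+ 2.
Proof.
move=> h1 aA bB; set r := dl - _ => hr.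
have dE : dl = h * b + r by rewrite /r addrC subrK.
have B0 : 0 <= B by exact: le_trans bB.
have hh : h ^+ 2 <= `|h|.
  by rewrite -[h ^+ 2]real_normK ?num_real// expr2 ler_piMl.
(* For h nonzero the bound on r forces C >= 0; at h = 0 it says nothing about the sign of C. *)
have [h0|h0] := eqVneq h 0.
  have r0 : r = 0.
    by apply/eqP; rewrite -normr_le0; move: hr; rewrite h0 expr0n mulr0.
  by rewrite dE r0 h0 mul0r !addr0 subrr mul0r subr0 normr0 expr0n mulr0.
have C0 : 0 <= C.
  by have := le_trans (normr_ge0 _) hr; rewrite pmulr_lge0// exprn_even_gt0.
have db : `|dl| <= (B + C) * `|h|.
  rewrite dE (le_trans (ler_normD _ _))// mulrDl lerD//.
    by rewrite normrM mulrC ler_wpM2r.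
  by rewrite (le_trans hr)// ler_wpM2l.
have db1 : `|dl| <= B + C by rewrite (le_trans db)// ler_piMr// addr_ge0.
have d2 : dl ^+ 2 <= (B + C) ^+ 2 * h ^+ 2.
  rewrite -[dl ^+ 2]real_normK ?num_real// -[h ^+ 2]real_normK ?num_real// -exprMn.
  by rewrite lerXn2r ?nnegrE// mulr_ge0// addr_ge0.
rewrite expRD (_ : _ - _ - _ = expR a * ((expR dl - 1 - dl) + r)); last first.
  by rewrite /r; ring.
rewrite normrM (ger0_norm (expR_ge0 _)) -[leRHS]mulrA.
apply: ler_pM; rewrite ?expR_ge0//.
  by rewrite ler_expR (le_trans (ler_norm _)).
rewrite (le_trans (ler_normD _ _))// [leRHS]mulrDl addrC lerD//.
apply: le_trans (expR_taylor1_le _) _.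
by rewrite [leRHS]mulrAC; apply: ler_pM; rewrite ?sqr_ge0 ?expR_ge0 ?ler_expR.
Qed.

Section Rotation.
Variables (R : realType) (n : nat).
Notation BM := (borel_mx R n.+1).
Notation On := (@orthogonal_group R n.+1).

Section Plane.
Variables (i j : 'I_n.+1).
Hypothesis ij : i != j.

(* Parametrised by the sine of the angle, which avoids trigonometry. *)
Definition rot (e : R) : 'M[R]_n.+1 :=
  1%:M + (Num.sqrt (1 - e ^+ 2) - 1) *: (delta_mx i i + delta_mx j j)
  + e *: (delta_mx i j - delta_mx j i).

(** With P the projection on the plane and K the generator of its rotations, P^2 = P, PK = KP = K
    and K^2 = - P, so the product collapses to 1 + (c^2 - 1 + e^2) P. *)
Lemma rot_orthogonal e : e ^+ 2 <= 1 -> On (rot e).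
Proof.
move=> e1; rewrite /orthogonal_group /=.
set c := Num.sqrt (1 - e ^+ 2).
have c2 : c ^+ 2 = 1 - e ^+ 2 by rewrite sqr_sqrtr// subr_ge0.
have ji : j != i by rewrite eq_sym.
set P : 'M[R]_n.+1 := delta_mx i i + delta_mx j j.
set K : 'M[R]_n.+1 := delta_mx i j - delta_mx j i.
have PP : P *m P = P.
  rewrite /P mulmxDl !mulmxDr !mul_delta_mx_cond !eqxx (negbTE ij) (negbTE ji).
  by rewrite !mulr0n !mulr1n addr0 add0r.
have KK : K *m K = - P.
  rewrite /P /K mulmxBl !mulmxBr !mul_delta_mx_cond !eqxx (negbTE ij) (negbTE ji).
  by rewrite !mulr0n !mulr1n sub0r subr0 opprD.
have PK : P *m K = K.
  rewrite /P /K mulmxDl !mulmxBr !mul_delta_mx_cond !eqxx (negbTE ij) (negbTE ji).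
  by rewrite !mulr0n !mulr1n sub0r subr0.
have KP : K *m P = K.
  rewrite /P /K mulmxBl !mulmxDr !mul_delta_mx_cond !eqxx (negbTE ij) (negbTE ji).
  by rewrite !mulr0n !mulr1n add0r addr0.
have -> : (rot e)^T = 1%:M + (c - 1) *: P - e *: K.
  apply/matrixP => a b; rewrite /rot -/c !mxE [b == a]eq_sym.
  rewrite [(b == i) && (a == i)]andbC [(b == j) && (a == j)]andbC.
  by rewrite [(b == i) && (a == j)]andbC [(b == j) && (a == i)]andbC; ring.
rewrite /rot -/c -/P -/K.
rewrite !mulmxBl !mulmxDl !mulmxDr !mul1mx !mulmx1.
rewrite -!scalemxAl -!scalemxAr PP PK KP KK !scalerA.
have h : (c - 1) ^+ 2 + 2 * (c - 1) + e ^+ 2 = 0.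
  have -> : (c - 1) ^+ 2 + 2 * (c - 1) + e ^+ 2 = c ^+ 2 - 1 + e ^+ 2 by ring.
  by rewrite c2; ring.
move: (P) (K) => P' K'; apply/matrixP => a b; rewrite !mxE.
set o : R := _%:R.
transitivity (o + P' a b * ((c - 1) ^+ 2 + 2 * (c - 1) + e ^+ 2)); last first.
  by rewrite h mulr0 addr0.
ring.
Qed.

Lemma rot_entry e (U : 'M[R]_n.+1) k l : (rot e *m U) k l =
  U k l + (Num.sqrt (1 - e ^+ 2) - 1) * ((k == i)%:R * U i l + (k == j)%:R * U j l)
  + e * ((k == i)%:R * U j l - (k == j)%:R * U i l).
Proof.
have dE (a b : 'I_n.+1) : (delta_mx a b *m U) k l = (k == a)%:R * U b l.
  rewrite mxE (bigD1 b)//= mxE eqxx andbT big1 ?addr0// => m /negbTE mb.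
  by rewrite mxE mb andbF mul0r.
rewrite /rot !mulmxDl mul1mx -!scalemxAl mulmxDl mulmxBl.
rewrite [LHS]mxE [X in X + _]mxE [X in _ + X + _]mxE [X in _ + X]mxE.
rewrite [X in _ + _ * X + _]mxE [X in _ + _ + _ * X]mxE.
by rewrite [X in _ + _ + _ * (_ + X)]mxE !dE.
Qed.

(* g is the derivative of f along the rotations, with a uniform quadratic remainder:
   this makes differentiation under the integral sign unnecessary. *)
Definition flow (f g : BM -> R) : Prop :=
  [/\ bmeas f, bmeas g & exists C, forall e U, 0 <= e -> e <= 1 -> On U ->
    `|f (rot e *m (U : 'M[R]_n.+1) : BM) - f U - e * g U| <= C * e ^+ 2].

Lemma On_rot e (U : 'M[R]_n.+1) : 0 <= e -> e <= 1 -> On U -> On (rot e *m U).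
Proof.
move=> e0 e1 OU; rewrite /orthogonal_group /= trmx_mul mulmxA -(mulmxA _ (rot e)^T).
rewrite (_ : (rot e)^T *m rot e = 1%:M) ?mulmx1//.
by apply: rot_orthogonal; rewrite expr_le1.
Qed.

Lemma flow_cst c : flow (fun=> c) (fun=> 0).
Proof.
split; [exact: bmeas_cst|exact: bmeas_cst|exists 0 => e U _ _ _].
by rewrite subrr mulr0 subr0 normr0 mul0r.
Qed.

Lemma flow_entry k l :
  flow (fun U => (U : 'M[R]_n.+1) k l)
       (fun U => (k == i)%:R * (U : 'M[R]_n.+1) j l - (k == j)%:R * (U : 'M[R]_n.+1) i l).
Proof.
split; first exact: bmeas_entry.
  under eq_fun do rewrite -mulNr.
  by apply: bmeasD; apply: bmeasM; try exact: bmeas_cst; exact: bmeas_entry.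
exists 2 => e U e0 e1 OU; rewrite rot_entry.
set c := Num.sqrt _.
pose y := (k == i)%:R * (U : 'M[R]_n.+1) i l + (k == j)%:R * (U : 'M[R]_n.+1) j l.
rewrite (_ : _ - _ - _ = (c - 1) * y); last by rewrite /y; ring.
rewrite normrM mulrC ler_pM//.
  have nb (b : bool) (u : R) : `|u| <= 1 -> `|b%:R * u| <= 1.
    by case: b; rewrite ?mul1r ?mul0r ?normr0.
  rewrite /y (le_trans (ler_normD _ _))// (_ : 2 = 1 + 1 :> R)//.
  by apply: lerD; apply: nb; exact: entry_norm_le1.
(* The cosine c differs from 1 at second order only: 1 - c <= (1 - c)(1 + c) = e^2. *)
have ee : e ^+ 2 <= 1 by rewrite expr_le1.
have c0 : 0 <= c by exact: sqrtr_ge0.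
have c2 : c ^+ 2 = 1 - e ^+ 2 by rewrite sqr_sqrtr// subr_ge0.
have c1 : c <= 1.
  by rewrite -(@ler_pXn2r _ 2)// ?nnegrE// expr1n c2 gerBl sqr_ge0.
rewrite ler0_norm ?subr_le0// opprB -[leLHS]mulr1.
have -> : e ^+ 2 = (1 - c) * (1 + c) by rewrite -[LHS](subKr 1) -c2; ring.
by rewrite ler_wpM2l ?subr_ge0// lerDl.
Qed.

Lemma flowD f g f' g' : flow f g -> flow f' g' ->
  flow (fun U => f U + f' U) (fun U => g U + g' U).
Proof.
move=> [bf bg [C Cf]] [bf' bg' [C' Cf']]; split; try exact: bmeasD.
exists (C + C') => e U e0 e1 OU; rewrite mulrDl.
apply: le_trans (lerD (Cf e U e0 e1 OU) (Cf' e U e0 e1 OU)).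
rewrite (le_trans _ (ler_normD _ _))// le_eqVlt; apply/orP; left; apply/eqP.
by congr (`|_|); ring.
Qed.

Lemma flowM f g f' g' : flow f g -> flow f' g' ->
  flow (fun U => f U * f' U) (fun U => g U * f' U + f U * g' U).
Proof.
move=> [bf bg [C Cf]] [bf' bg' [C' Cf']].
split; [exact: bmeasM|by apply: bmeasD; exact: bmeasM|].
have [_ [A fA]] := bf; have [_ [B gB]] := bg.
have [_ [A' fA']] := bf'; have [_ [B' gB']] := bg'.
exists (C * A' + (A + B) * C' + B * B') => e U e0 e1 OU.
have OV := On_rot e0 e1 OU.
have := Cf e U e0 e1 OU; have := Cf' e U e0 e1 OU.
set V : BM := (X in f X); set r' := _ - _ - _; set r := f V - _ - _ => hr' hr.
rewrite (_ : _ - _ - _ =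
  r * f' V + (f U + e * g U) * r' + e ^+ 2 * (g U * g' U)); last first.
  by rewrite /r /r'; ring.
rewrite [leRHS]mulrDl [X in _ <= X + _]mulrDl.
rewrite (le_trans (ler_normD _ _))// lerD//.
  rewrite (le_trans (ler_normD _ _))// lerD//.
- by rewrite normrM mulrAC ler_pM// fA'.
- rewrite normrM -mulrA ler_pM//.
  rewrite (le_trans (ler_normD _ _))// lerD ?fA// normrM (ger0_norm e0).
  by rewrite (le_trans (ler_piMl _ e1))// gB.
- rewrite normrM (ger0_norm (sqr_ge0 e)) mulrC ler_wpM2r ?sqr_ge0//.
  by rewrite normrM ler_pM ?gB ?gB'.
Qed.

Lemma eq_flow f g f' g' : f =1 f' -> g =1 g' -> flow f g -> flow f' g'.
Proof. by move=> /funext -> /funext ->. Qed.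

Lemma flowZ c f g : flow f g -> flow (fun U => c * f U) (fun U => c * g U).
Proof.
move=> fl; apply: (eq_flow _ _ (flowM (flow_cst c) fl)) => U //=.
by rewrite mul0r add0r.
Qed.

Lemma flow_sum (I : Type) (r : seq I) (f g : I -> BM -> R) :
  (forall k, flow (f k) (g k)) ->
  flow (fun U => \sum_(k <- r) f k U) (fun U => \sum_(k <- r) g k U).
Proof.
move=> fl; elim: r => [|k r IHr].
  by apply: eq_flow (flow_cst 0) => U; rewrite big_nil.
by apply: eq_flow (flowD (fl k) IHr) => U; rewrite big_cons.
Qed.

Lemma flowX f g k : flow f g ->
  flow (fun U => f U ^+ k) (fun U => k%:R * f U ^+ k.-1 * g U).
Proof.
move=> fl; elim: k => [|k IHk].
  by apply: eq_flow (flow_cst 1) => U; rewrite ?expr0// !mul0r.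
apply: eq_flow (flowM fl IHk) => U /=; first by rewrite exprS.
case: k {IHk} => [|k] /=; first by rewrite expr0 !mul0r mulr0 addr0; ring.
by rewrite exprS [k.+2%:R]mulrSr; ring.
Qed.

Lemma flow_expR f g : flow f g ->
  flow (fun U => expR (f U)) (fun U => g U * expR (f U)).
Proof.
move=> [bf bg [C Cf]]; split; first exact: bmeas_expR.
  by apply: bmeasM => //; exact: bmeas_expR.
have [_ [A fA]] := bf; have [_ [B gB]] := bg.
exists (expR A * (C + (B + C) ^+ 2 * expR (B + C))) => e U e0 e1 OU.
have e1' : `|e| <= 1 by rewrite ger0_norm.
have := expR_perturb_le e1' (fA U OU) (gB U OU) (Cf e U e0 e1 OU).
by rewrite [f U + _]addrC subrK.
Qed.

Variable mu : probability BM R.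
Hypothesis haar : is_haar mu.

Lemma norm_Ex_le f C : bmeas f -> (forall U, On U -> `|f U| <= C) -> `|Ex mu f| <= C.
Proof.
move=> bf fC; rewrite ler_norml; apply/andP; split.
  rewrite -(Ex_cst haar (- C)); apply: le_Ex => //; first exact: bmeas_cst.
  by move=> U OU; have := fC U OU; rewrite ler_norml => /andP[].
rewrite -(Ex_cst haar C); apply: le_Ex => //; first exact: bmeas_cst.
by move=> U OU; have := fC U OU; rewrite ler_norml => /andP[].
Qed.

(** By invariance f and its rotated copy have the same mean, so e |E g| <= C e^2 for every small e >
    0. *)
Lemma flow_Ex0 f g : flow f g -> Ex mu g = 0.
Proof.
move=> [bf bg [C Cf]].
have key e : 0 < e -> e <= 1 -> `|Ex mu g| <= C * e.
  move=> e0 e1.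
  have OV : On (rot e) by apply: rot_orthogonal; rewrite expr_le1// ltW.
  have bfV := bmeas_mulmx OV bf.
  have h : Ex mu (fun U : BM => f (rot e *m (U : 'M[R]_n.+1) : BM) + (-1) * f U + (- e) * g U)
      = - e * Ex mu g.
    rewrite ExD ?ExD ?ExZ ?Ex_mulmx//.
    - by rewrite mulN1r subrr add0r.
    - by apply: bmeasM => //; exact: bmeas_cst.
    - by apply: bmeasD => //; apply: bmeasM => //; exact: bmeas_cst.
    - by apply: bmeasM => //; exact: bmeas_cst.
  have : `|- e * Ex mu g| <= C * e * e.
    rewrite -h; apply: norm_Ex_le.
      apply: bmeasD; last by apply: bmeasM => //; exact: bmeas_cst.
      by apply: bmeasD => //; apply: bmeasM => //; exact: bmeas_cst.
    by move=> U OU; have := Cf e U (ltW e0) e1 OU; rewrite mulN1r mulNr expr2 mulrA.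
  by rewrite normrM normrN (gtr0_norm e0) mulrC ler_pM2r.
apply/eqP; rewrite -normr_eq0; apply/negP => /negP gn0.
have g0 : 0 < `|Ex mu g| by rewrite lt_neqAle eq_sym gn0 normr_ge0.
have C0 : 0 < C.
  by have := key 1 ltr01 (lexx 1); rewrite mulr1; apply: lt_le_trans.
(* For this e, [key] would give |E g| <= |E g| / 2. *)
have := key (Num.min 1 (`|Ex mu g| / (2 * C))).
rewrite lt_min ltr01 divr_gt0 ?mulr_gt0// ge_min lexx => /(_ isT isT).
apply/negP; rewrite -ltNge.
apply: (@le_lt_trans _ _ (C * (`|Ex mu g| / (2 * C)))).
  by rewrite (ler_wpM2l (ltW C0))// ge_min lexx orbT.
set G := `|Ex mu g| in g0 *.
have -> : C * (G / (2 * C)) = G / 2 by field; rewrite gt_eqF.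
by rewrite ltr_pdivrMr// ltr_pMr// ltr1n.
Qed.

End Plane.

End Rotation.

(** * The Schwinger-Dyson equations *)

Lemma sum_delta (R : comRingType) (I : finType) (i : I) (F : I -> R) :
  \sum_k F k * (k == i)%:R = F i.
Proof.
rewrite (bigD1 i)//= eqxx mulr1 big1 ?addr0// => k /negbTE ->.
by rewrite mulr0.
Qed.

Section SchwingerDyson.
Variables (R : realType) (n : nat).
Notation BM := (borel_mx R n.+1).
Notation On := (@orthogonal_group R n.+1).
Implicit Types (c D phi : 'I_n.+1 -> R).

Definition qform c (U : BM) : R := \sum_i c i * (U : 'M[R]_n.+1) i ord0 ^+ 2.

Lemma bmeas_qform c : bmeas (qform c).
Proof.
apply: bmeas_sum => i; apply: bmeasM; first exact: bmeas_cst.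
by apply: bmeasX; exact: bmeas_entry.
Qed.

Lemma qform1 U : On U -> qform (fun=> 1) U = 1.
Proof.
by move=> OU; rewrite -[RHS](col_orthogonal ord0 OU); apply: eq_bigr => i _; rewrite mul1r.
Qed.

Lemma qform_lin a b c D U :
  qform (fun i => a * c i + b * D i) U = a * qform c U + b * qform D U.
Proof.
rewrite /qform !mulr_sumr -big_split /=; apply: eq_bigr => i _; ring.
Qed.

Lemma qform_norm_le c C U : On U -> (forall i, `|c i| <= C) -> `|qform c U| <= C.
Proof.
move=> OU cC; rewrite -[leRHS]mulr1 -[in leRHS](col_orthogonal ord0 OU) mulr_sumr.
rewrite (le_trans (ler_norm_sum _ _ _))// ler_sum// => i _.
by rewrite normrM (ger0_norm (sqr_ge0 _)) ler_wpM2r ?sqr_ge0.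
Qed.

Lemma flow_qform i j (ij : i != j) c : flow i j (qform c)
  (fun U => 2 * (c i - c j) * ((U : 'M[R]_n.+1) i ord0 * (U : 'M[R]_n.+1) j ord0)).
Proof.
apply: eq_flow (flow_sum (index_enum _) (fun k => flowZ ij (c k) (flowX ij 2 (flow_entry R i j k ord0)))) => U //=.
under eq_bigr => k _.
  rewrite (_ : _ * _ = (2 * c k * (U : 'M[R]_n.+1) k ord0 * (U : 'M[R]_n.+1) j ord0) * (k == i)%:R
     + (- 2 * c k * (U : 'M[R]_n.+1) k ord0 * (U : 'M[R]_n.+1) i ord0) * (k == j)%:R); last by ring.
  over.
by rewrite big_split /= !sum_delta; ring.
Qed.

Variable mu : probability BM R.
Hypothesis haar : is_haar mu.

Section Tilt.
Variables (D : 'I_n.+1 -> R) (kappa : R).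

Definition tilt (phi : 'I_n.+1 -> R) (k : nat) (U : BM) : R :=
  qform phi U * qform D U ^+ k * expR (kappa * qform D U).

Definition Tm phi k : R := Ex mu (tilt phi k).

Lemma bmeas_tilt phi k : bmeas (tilt phi k).
Proof.
apply: bmeasM; first by apply: bmeasM; [|apply: bmeasX]; exact: bmeas_qform.
by apply: bmeas_expR; apply: bmeasM; [exact: bmeas_cst|exact: bmeas_qform].
Qed.

Lemma Tm_lin a b c d k :
  Tm (fun i => a * c i + b * d i) k = a * Tm c k + b * Tm d k.
Proof.
rewrite /Tm -!ExZ; try exact: bmeas_tilt.
rewrite -ExD; try by apply: bmeasM; [exact: bmeas_cst|exact: bmeas_tilt].
by apply: eq_Ex => U _; rewrite /tilt qform_lin; ring.
Qed.

Lemma TmD k : Tm D k = Tm (fun=> 1) k.+1.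
Proof. by apply: eq_Ex => U OU; rewrite /tilt qform1// exprS mul1r. Qed.

Let q i (U : BM) := (U : 'M[R]_n.+1) i ord0 ^+ 2.

(** The test function is u_i u_j Z^k exp (kappa Z), with u the first column, differentiated along
    the rotations of the plane (i, j). The trivial case i = j is kept so that double sums run over
    all pairs. *)
Lemma sd_plane i j k : Ex mu (fun U => ((q j U - q i U) * qform D U ^+ k
   + 2 * (D i - D j) * (q i U * q j U) *
     (k%:R * qform D U ^+ k.-1 + kappa * qform D U ^+ k)) * expR (kappa * qform D U)) = 0.
Proof.
have [->|ij] := eqVneq i j.
  under eq_Ex do rewrite !subrr mulr0 !mul0r addr0 mul0r.
  exact: Ex_cst.
have ji : (j == i) = false by rewrite eq_sym; exact: negbTE.
have f1 := flowM ij (flow_entry R i j i ord0) (flow_entry R i j j ord0).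
have fZ := flow_qform ij D.
have f2 := flowM ij (flowX ij k fZ) (flow_expR (flowZ ij kappa fZ)).
rewrite -(flow_Ex0 ij haar (flowM ij f1 f2)).
apply: eq_Ex => U _; rewrite /q !eqxx ji (negbTE ij) /=; ring.
Qed.

(** Weight [sd_plane] by phi i and sum over all i and j; the sum over j closes up because the u_j^2
    sum to 1 and the D_j u_j^2 sum to Z. *)
Lemma schwinger_dyson phi k :
  (\sum_i phi i) * Tm (fun=> 1) k - n.+1%:R * Tm phi k
  + 2 * k%:R * (Tm (fun i => phi i * D i) k.-1 - Tm phi k)
  + 2 * kappa * (Tm (fun i => phi i * D i) k - Tm phi k.+1) = 0.
Proof.
pose g i j U := phi i * (((q j U - q i U) * qform D U ^+ k
   + 2 * (D i - D j) * (q i U * q j U) *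
     (k%:R * qform D U ^+ k.-1 + kappa * qform D U ^+ k)) * expR (kappa * qform D U)).
have bq i : bmeas (q i) by apply: bmeasX; exact: bmeas_entry.
have bZ m : bmeas (fun U => qform D U ^+ m) by apply: bmeasX; exact: bmeas_qform.
have bg i j : bmeas (g i j).
  apply: bmeasM; first exact: bmeas_cst.
  apply: bmeasM; last first.
    by apply: bmeas_expR; apply: bmeasM; [exact: bmeas_cst|exact: bmeas_qform].
  apply: bmeasD; apply: bmeasM => //.
  - under eq_fun do rewrite -mulN1r.
    by apply: bmeasD => //; apply: bmeasM => //; exact: bmeas_cst.
  - by apply: bmeasM; [exact: bmeas_cst|exact: bmeasM].
  - by apply: bmeasD; apply: bmeasM => //; exact: bmeas_cst.
have h0 : Ex mu (fun U => \sum_i \sum_j g i j U) = 0.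
  rewrite Ex_sum; last by move=> i; apply: bmeas_sum.
  rewrite big1// => i _; rewrite Ex_sum// big1// => j _.
  rewrite /g ExZ ?sd_plane ?mulr0//.
  apply: bmeasM; last first.
    by apply: bmeas_expR; apply: bmeasM; [exact: bmeas_cst|exact: bmeas_qform].
  apply: bmeasD; apply: bmeasM => //.
  - under eq_fun do rewrite -mulN1r.
    by apply: bmeasD => //; apply: bmeasM => //; exact: bmeas_cst.
  - by apply: bmeasM; [exact: bmeas_cst|exact: bmeasM].
  - by apply: bmeasD; apply: bmeasM => //; exact: bmeas_cst.
rewrite -[RHS]h0.
pose S := \sum_i phi i; pose pD i := phi i * D i.
transitivity (Ex mu (fun U => S * tilt (fun=> 1) k U + - n.+1%:R * tilt phi k U
   + (2 * k%:R) * tilt pD k.-1 U + (- (2 * k%:R)) * tilt phi k U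
   + (2 * kappa) * tilt pD k U + (- (2 * kappa)) * tilt phi k.+1 U)).
  have bc (a : R) psi m : bmeas (fun U => a * tilt psi m U).
    by apply: bmeasM; [exact: bmeas_cst|exact: bmeas_tilt].
  do 5 (rewrite ExD; [|by do ?[apply: bmeasD => //]|by []]).
  rewrite !ExZ; try exact: bmeas_tilt.
  rewrite /Tm /S /pD; ring.
apply: eq_Ex => U OU; rewrite /tilt.
have qs : \sum_j q j U = 1 by exact: col_orthogonal.
have qD c : \sum_j c j * q j U = qform c U by [].
have innerE i : \sum_j g i j U = phi i * ((1 - n.+1%:R * q i U) * qform D U ^+ k
     + 2 * (D i - qform D U) * q i U *
     (k%:R * qform D U ^+ k.-1 + kappa * qform D U ^+ k)) * expR (kappa * qform D U).
  set A := qform D U ^+ k; set B := k%:R * _ + _ * A; set z := qform D U.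
  set E := expR _.
  transitivity (\sum_j ((phi i * E * A + 2 * D i * q i U * B * phi i * E) * q j U
      + (- (2 * q i U * B * phi i * E)) * (D j * q j U) + - (phi i * E * A * q i U))).
    by apply: eq_bigr => j _; rewrite /g -/E -/A -/B; ring.
  rewrite !big_split /= -!mulr_sumr qs qD -/z sumr_const card_ord -mulr_natl; ring.
under eq_bigr do rewrite innerE.
rewrite -mulr_suml.
have -> : \sum_i phi i * ((1 - n.+1%:R * q i U) * qform D U ^+ k
     + 2 * (D i - qform D U) * q i U *
     (k%:R * qform D U ^+ k.-1 + kappa * qform D U ^+ k)) =
  S * qform D U ^+ k - n.+1%:R * qform phi U * qform D U ^+ k
  + 2 * (qform pD U - qform phi U * qform D U) *
    (k%:R * qform D U ^+ k.-1 + kappa * qform D U ^+ k).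
  set A := qform D U ^+ k; set B := (_ + _ * A); set z := qform D U.
  rewrite /S -!qD /pD !mulr_suml !mulr_sumr mulr_suml -!sumrB mulr_sumr mulr_suml.
  rewrite -big_split /=; apply: eq_bigr => i _; ring.
rewrite qform1//.
(* At k = 0 the truncated predecessor is harmless, its factor k being 0. *)
case: k {g bg h0 innerE bZ} => [|k] /=; first by rewrite !expr0 expr1; ring.
by rewrite !exprS; ring.
Qed.

End Tilt.

End SchwingerDyson.

(** * A priori bounds on the tilted moments *)

(** The product iterates [even_moment_step]. The 4 is 2 * 2: one factor 2 bounds the linear form,
    the other bounds |Z| when an odd power is lowered to an even one. *)
Definition moment_bound (R : realType) (k : nat) : R :=
  4 * \prod_(i < k./2) (16 * (2 * i%:R + 1)).

(* All that the expansion uses about the tilted moments, namely z k = E[Z^k],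
   V l k = E[W_l Z^k] with W_l = sum_i y_i^l D_i e_i^2, and s l = mean of the y_i^l. *)
Record sd_system (R : realType) (eps tau : R) (s : nat -> R)
    (V : nat -> nat -> R) (z : nat -> R) : Prop := SdSystem {
  sd_eps : 0 < eps <= 1;
  sd_tau : 0 <= tau <= 1;
  sd_s2 : 0 <= s 2;
  sd_s_le1 : forall l, `|s l| <= 1;
  sd_s1 : s 1 = 0;
  sd_z0 : z 0 = 1;
  sd_V0 : forall k, V 0 k = z k.+1;
  sd_rec : forall l k, V l k + tau * (V l k.+1 + tau * V l.+1 k.+1)
    + 2 * k%:R * eps * (V l k + tau * V l.+1 k - V l.+1 k.-1) = s l.+1 * z k;
  sd_z_le : forall k, `|z k| <= moment_bound R k * eps ^+ k./2;
  sd_V_le : forall l k, `|V l k| <= moment_bound R k * eps ^+ k./2 }.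

Section TiltedMoments.
Variables (R : realType) (n : nat).
Variable mu : probability (borel_mx R n.+1) R.
Hypothesis haar : is_haar mu.
Variables (y : 'I_n.+1 -> R) (tau : R).
Hypothesis y_le : forall i, `|y i| <= 2 / 3.
Hypothesis y_sum : \sum_i y i = 0.
Hypothesis tau01 : 0 <= tau <= 1.

Let N : R := n.+1%:R.
Let eps : R := N^-1.
Definition hweight i : R := y i / (1 + tau * y i).
Let D := hweight.
Let T := Tm mu D (N * tau / 2).
Definition psum l : R := eps * \sum_i y i ^+ l.
Definition zmom k : R := T (fun=> 1) k / T (fun=> 1) 0.
Definition Vmom l k : R := T (fun i => y i ^+ l * D i) k / T (fun=> 1) 0.

Let N0 : 0 < N. Proof. exact: ltr0Sn. Qed.

Lemma hden_ge i : 1 / 3 <= 1 + tau * y i.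
Proof.
have := y_le i; rewrite ler_norml => /andP[y1 y2]; case/andP: tau01 => t0 t1.
nra.
Qed.

Let b0 i : 1 + tau * y i != 0.
Proof. by rewrite gt_eqF//; apply: lt_le_trans (hden_ge i); lra. Qed.

Lemma norm_hweight_le2 i : `|D i| <= 2.
Proof.
rewrite normrM normfV ler_pdivrMr; last by rewrite normr_gt0 b0.
rewrite (@ger0_norm _ (1 + _)); last by apply: le_trans (hden_ge i); lra.
have := y_le i; have := hden_ge i; lra.
Qed.

(** This is [schwinger_dyson] divided by - N at kappa = N tau / 2, the scale at which phi and tau
    phi D balance. They combine into phi (1 - tau D) = phi / (1 + tau y). *)
Lemma Tm_sd phi k : T (fun i => phi i * (1 - tau * D i)) k + tau * T phi k.+1
  + 2 * k%:R * eps * (T phi k - T (fun i => phi i * D i) k.-1)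
  = eps * (\sum_i phi i) * T (fun=> 1) k.
Proof.
have h := schwinger_dyson haar D (N * tau / 2) phi k.
have -> : T (fun i => phi i * (1 - tau * D i)) k =
    1 * T phi k + (- tau) * T (fun i => phi i * D i) k.
  rewrite -Tm_lin; congr (Tm _ _ _ _ k); apply/funext => i; ring.
have alg (M S t0 a b c d m : R) : M != 0 ->
    S * t0 - M * a + 2 * m * (b - a) + 2 * (M * tau / 2) * (c - d) = 0 ->
    1 * a + (- tau) * c + tau * d + 2 * m * M^-1 * (a - b) = M^-1 * S * t0.
  move=> M0 e; apply/eqP; rewrite -subr_eq0; apply/eqP.
  by rewrite -[RHS](mulr0 (- M^-1)) -{}e; field.
exact: alg (lt0r_neq0 N0) h.
Qed.

Lemma Tm1_gt0 : 0 < T (fun=> 1) 0.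
Proof.
apply: (@lt_le_trans _ _ (expR (- `|N * tau / 2| * 2))); first exact: expR_gt0.
rewrite -(Ex_cst haar (expR _)); apply: le_Ex.
- exact: bmeas_cst.
- exact: bmeas_tilt.
- move=> U OU; rewrite /tilt qform1// expr0 !mul1r ler_expR mulNr lerNl.
  rewrite (le_trans (ler_norm _))// normrN normrM ler_wpM2l//.
  by apply: qform_norm_le => // i; exact: norm_hweight_le2.
Qed.

Let T0 : T (fun=> 1) 0 != 0. Proof. exact: lt0r_neq0 Tm1_gt0. Qed.

(** Since |Z| <= 2, an odd power costs a factor 2 and is replaced by the even power just below,
    whose moment is nonnegative and controlled by [even_moment_step]. *)
Lemma norm_Tm_le phi (C : R) k :
  (forall i, `|phi i| <= C) -> 0 <= C ->
  `|T phi k| <= 2 * C * T (fun=> 1) (k./2).*2.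
Proof.
move=> phiC C0.
have bc (a : R) psi m : bmeas (fun U => a * tilt D (N * tau / 2) psi m U).
  by apply: bmeasM; [exact: bmeas_cst|exact: bmeas_tilt].
have key U : orthogonal_group U ->
    `|tilt D (N * tau / 2) phi k U|
    <= 2 * C * tilt D (N * tau / 2) (fun=> 1) (k./2).*2 U.
  move=> OU; rewrite /tilt qform1// mul1r !normrM (ger0_norm (expR_ge0 _)) mulrA.
  rewrite ler_wpM2r ?expR_ge0//.
  have Z2 : `|qform D U| <= 2.
    by apply: qform_norm_le => // i; exact: norm_hweight_le2.
  have -> : qform D U ^+ (k./2).*2 = `|qform D U| ^+ (k./2).*2.
    by rewrite -normrX ger0_norm// -mul2n exprM exprn_ge0// sqr_ge0.
  have W : `|qform phi U| <= C by exact: qform_norm_le.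
  rewrite normrX -[k in leLHS]odd_double_half exprD (mulrC 2) -mulrA.
  apply: ler_pM => //.
  apply: ler_wpM2r; first exact: exprn_ge0.
  by case: (odd k); rewrite ?expr1// expr0 ler1n.
rewrite ler_norml -mulNr -!ExZ; try exact: bmeas_tilt.
apply/andP; split; apply: le_Ex; try exact: bmeas_tilt; try exact: bc.
  by move=> U OU; have := key U OU; rewrite ler_norml -mulNr => /andP[].
by move=> U OU; have := key U OU; rewrite ler_norml -mulNr => /andP[].
Qed.

Lemma T1_even_ge0 m : 0 <= T (fun=> 1) m.*2.
Proof.
rewrite -(Ex_cst haar 0); apply: le_Ex; [exact: bmeas_cst|exact: bmeas_tilt|].
move=> U OU; rewrite /tilt qform1// mul1r mulr_ge0 ?expR_ge0//.
by rewrite -mul2n exprM exprn_ge0// sqr_ge0.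
Qed.

(* In the equation for phi = y the source term vanishes, and the left-hand side is
   coercive because 1 + tau * sum_i y_i e_i^2 >= 1/3. *)
Lemma even_moment_step m :
  T (fun=> 1) m.+1.*2 <= 16 * (2 * m%:R + 1) * eps * T (fun=> 1) m.*2.
Proof.
have := Tm_sd y (m.*2.+1); rewrite y_sum mulr0 mul0r /=.
have -> : (fun i => y i * (1 - tau * D i)) = D.
  by apply/funext => i; rewrite /D /hweight; field; exact: b0.
rewrite /T TmD -/T => h.
have k0 : 0 <= 2 * (m.*2.+1)%:R * eps :> R by rewrite !mulr_ge0// invr_ge0 ltW.
have bt psi k : bmeas (tilt D (N * tau / 2) psi k) by exact: bmeas_tilt.
have bc (a : R) psi k : bmeas (fun U => a * tilt D (N * tau / 2) psi k U).
  by apply: bmeasM; [exact: bmeas_cst|exact: bmeas_tilt].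
have lo : 1 / 3 * T (fun=> 1) m.+1.*2 <= T (fun=> 1) m.*2.+2 + tau * T y m.*2.+2.
  rewrite -doubleS /T /Tm -!ExZ// -ExD//; apply: le_Ex => //.
    exact: bmeasD.
  move=> U OU; rewrite /tilt qform1// !mul1r.
  have z0 : 0 <= qform D U ^+ m.+1.*2 by rewrite -mul2n exprM exprn_ge0// sqr_ge0.
  move: z0 (expR_ge0 (N * tau / 2 * qform D U)).
  move: (qform D U ^+ _) (expR _) => z E z0 E0.
  rewrite -subr_ge0 (_ : _ - _ = z * E * (2 / 3 + tau * qform y U)); last by field.
  rewrite mulr_ge0 ?mulr_ge0//.
  have : `|qform y U| <= 2 / 3 by exact: qform_norm_le.
  by rewrite ler_norml; case/andP: tau01 => t0 t1 /andP[]; nra.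
have hi : - (T y m.*2.+1 - T (fun i => y i * D i) m.*2) <= 8 / 3 * T (fun=> 1) m.*2.
  rewrite opprB -[- T y _]mulN1r /T /Tm -!ExZ// -ExD//; apply: le_Ex => //.
    exact: bmeasD.
  move=> U OU; rewrite /tilt qform1// mul1r exprS.
  have z0 : 0 <= qform D U ^+ m.*2 by rewrite -mul2n exprM exprn_ge0// sqr_ge0.
  move: z0 (expR_ge0 (N * tau / 2 * qform D U)).
  move: (qform D U ^+ _) (expR _) => z E z0 E0.
  rewrite -subr_ge0 (_ : _ - _ = z * E *
    (8 / 3 - (qform (fun i => y i * D i) U - qform y U * qform D U))); last by ring.
  rewrite mulr_ge0 ?mulr_ge0//.
  have a1 : `|qform y U| <= 2 / 3 by exact: qform_norm_le.
  have a2 : `|qform D U| <= 2.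
    by apply: qform_norm_le => // i; exact: norm_hweight_le2.
  have a3 : `|qform (fun i => y i * D i) U| <= 4 / 3.
    apply: qform_norm_le => // i; rewrite normrM.
    have -> : 4 / 3 = 2 / 3 * 2 :> R by field.
    by rewrite ler_pM// norm_hweight_le2.
  have a4 : `|qform y U * qform D U| <= 4 / 3.
    rewrite normrM; have -> : 4 / 3 = 2 / 3 * 2 :> R by field.
    by rewrite ler_pM.
  move: a3 a4; rewrite !ler_norml => /andP[_ a3] /andP[a4 _].
  lra.
(* The constant 16 is 3 * 2 * (8/3): coercivity 1/3, the coefficient 2 (2 m + 1) eps, and the bound
   8/3 on the bracket. *)
have l2 := ler_wpM2l k0 hi.
have -> : 16 * (2 * m%:R + 1) * eps = 8 * (2 * (m.*2.+1)%:R * eps).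
  by rewrite -[(m.*2.+1)%:R]natr1 -mul2n natrM; ring.
rewrite -doubleS in h; move: h lo l2.
move: (T (fun=> 1) _) (T y m.+1.*2) (_ - _) (T _ _) (_ * eps) => X Y Q A B.
nra.
Qed.

Lemma T1_even_le m :
  T (fun=> 1) m.*2 <= \prod_(i < m) (16 * (2 * i%:R + 1)) * eps ^+ m * T (fun=> 1) 0.
Proof.
elim: m => [|m IHm]; first by rewrite big_ord0 expr0 !mul1r.
apply: le_trans (even_moment_step m) _.
rewrite big_ord_recr /= exprS.
have c0 : 0 <= 16 * (2 * m%:R + 1) * eps :> R.
  by rewrite !mulr_ge0 ?addr_ge0 ?mulr_ge0// invr_ge0 ltW.
apply: le_trans (ler_wpM2l c0 IHm) _.
by rewrite le_eqVlt; apply/orP; left; apply/eqP; ring.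
Qed.

Lemma norm_ratio_le phi (C : R) k : (forall i, `|phi i| <= C) -> 0 <= C -> C <= 2 ->
  `|T phi k / T (fun=> 1) 0| <= moment_bound R k * eps ^+ k./2.
Proof.
move=> phiC C0 C2; rewrite normrM normfV (gtr0_norm Tm1_gt0).
rewrite ler_pdivrMr ?Tm1_gt0//.
apply: le_trans (norm_Tm_le k phiC C0) _.
rewrite /moment_bound -!(mulrA 4).
apply: ler_pM; rewrite ?mulr_ge0 ?T1_even_ge0 ?T1_even_le//; lra.
Qed.

(** The choice phi = y^(l+1) keeps the equations within the forms W_l: y^(l+1) (1 - tau D) = y^l D,
    and y = D + tau y D gives y^(l+1) = y^l D + tau y^(l+1) D. *)
Lemma tilted_sd_system : sd_system eps tau psum Vmom zmom.
Proof.
have eps0 : 0 < eps by rewrite invr_gt0.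
have avg1 (f : 'I_n.+1 -> R) : (forall i, `|f i| <= 1) -> `|eps * \sum_i f i| <= 1.
  move=> f1; rewrite normrM (gtr0_norm eps0) mulrC ler_pdivrMr// mul1r.
  rewrite (le_trans (ler_norm_sum _ _ _))//.
  apply: (@le_trans _ _ (\sum_(i < n.+1) 1)); first exact: ler_sum.
  by rewrite sumr_const card_ord.
have y1 i : `|y i| <= 1 by apply: le_trans (y_le i) _; lra.
split.
- by rewrite eps0 /= invf_le1// ler1n.
- exact: tau01.
- apply: mulr_ge0; [exact: ltW|apply: sumr_ge0 => i _; exact: sqr_ge0].
- by move=> l; apply: avg1 => i; rewrite normrX exprn_ile1.
- by rewrite /psum; under eq_bigr do rewrite expr1; rewrite y_sum mulr0.
- by rewrite /zmom divff.
- move=> k; rewrite /Vmom /zmom; congr (_ / _); rewrite -[RHS]TmD.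
  by congr (Tm _ _ _ _ k); apply/funext => i; rewrite expr0 mul1r.
- move=> l k.
  have := Tm_sd (fun i => y i ^+ l.+1) k.
  have -> : (fun i => y i ^+ l.+1 * (1 - tau * D i)) = (fun i => y i ^+ l * D i).
    by apply/funext => i; rewrite /D /hweight exprS; field; exact: b0.
  have E m : T (fun i => y i ^+ l.+1) m =
      1 * T (fun i => y i ^+ l * D i) m + tau * T (fun i => y i ^+ l.+1 * D i) m.
    rewrite /T -Tm_lin; congr (Tm _ _ _ _ m); apply/funext => i.
    by rewrite /D /hweight exprS; field; exact: b0.
  rewrite !E /Vmom /zmom /psum => h.
  rewrite [RHS]mulrA -h; field; exact: T0.
- move=> k; apply: (@norm_ratio_le _ 1) => //; [by move=> i; rewrite normr1|by rewrite ler1n].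
- move=> l k; apply: (@norm_ratio_le _ 2) => // i.
  rewrite normrM normrX -[leRHS]mul1r ler_pM ?exprn_ge0// ?exprn_ile1//.
  exact: norm_hweight_le2.
Qed.

End TiltedMoments.

(** * The expansion of the tilted moments *)

Section Coefficients.
Variable R : realType.

(* Coefficient of eps^j in z k (w = true, l ignored) or in V l k (w = false, l >= 1),
   found by solving the equations [sd_rec] order by order. Recursive calls decrease
   6 j - 2 k + [w = false], and the value is junk unless the fuel f exceeds it. *)
Fixpoint mcoef (tau : R) (s : nat -> R) (f : nat) (w : bool) (l k j : nat) : R :=
  if f isn't f'.+1 then 0 else
  if (2 * j < k)%N then 0 else
  if w then
    if k isn't k'.+1 then (j == 0)%:R else
    (1 + tau ^+ 2 * s 2)^-1 *
      (- tau * mcoef tau s f' true 0 k'.+2 j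
       + tau ^+ 3 * mcoef tau s f' false 1 k'.+2 j
       + tau ^+ 4 * mcoef tau s f' false 2 k'.+2 j
       + (if j isn't j'.+1 then 0 else
          2 * k'.+1%:R * tau ^+ 2 * (mcoef tau s f' false 1 k'.+1 j'
            + tau * mcoef tau s f' false 2 k'.+1 j' - mcoef tau s f' false 2 k' j')
          - 2 * k'%:R * (mcoef tau s f' true 0 k'.+1 j'
            + tau * mcoef tau s f' false 1 k' j' - mcoef tau s f' false 1 k'.-1 j')))
  else
    s l.+1 * mcoef tau s f' true 0 k j
    - tau * (mcoef tau s f' false l k.+1 j + tau * mcoef tau s f' false l.+1 k.+1 j)
    - (if j isn't j'.+1 then 0 else
       2 * k%:R * (mcoef tau s f' false l k j'
         + tau * mcoef tau s f' false l.+1 k j' - mcoef tau s f' false l.+1 k.-1 j')).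

Lemma mcoefS tau s f w l k j : mcoef tau s f.+1 w l k j =
  if (2 * j < k)%N then 0 else
  if w then
    if k isn't k'.+1 then (j == 0)%:R else
    (1 + tau ^+ 2 * s 2)^-1 *
      (- tau * mcoef tau s f true 0 k'.+2 j
       + tau ^+ 3 * mcoef tau s f false 1 k'.+2 j
       + tau ^+ 4 * mcoef tau s f false 2 k'.+2 j
       + (if j isn't j'.+1 then 0 else
          2 * k'.+1%:R * tau ^+ 2 * (mcoef tau s f false 1 k'.+1 j'
            + tau * mcoef tau s f false 2 k'.+1 j' - mcoef tau s f false 2 k' j')
          - 2 * k'%:R * (mcoef tau s f true 0 k'.+1 j'
            + tau * mcoef tau s f false 1 k' j' - mcoef tau s f false 1 k'.-1 j')))
  else
    s l.+1 * mcoef tau s f true 0 k j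
    - tau * (mcoef tau s f false l k.+1 j + tau * mcoef tau s f false l.+1 k.+1 j)
    - (if j isn't j'.+1 then 0 else
       2 * k%:R * (mcoef tau s f false l k j'
         + tau * mcoef tau s f false l.+1 k j' - mcoef tau s f false l.+1 k.-1 j')).
Proof. by []. Qed.

(** The fuel 6 j + 2 exceeds the measure 6 j - 2 k + 1 for every k. *)
Definition zcoef tau s k j := mcoef tau s (6 * j + 2) true 0 k j.
Definition vcoef tau s l k j := mcoef tau s (6 * j + 2) false l k j.

(** The weight 6 on j pays for the steepest call, from z at (k + 1, j + 1) to V at (k - 1, j): it
    changes the measure by - 6 + 4 + 1 = - 1. When k > 2 j the value is 0 whatever the fuel. *)
Lemma mcoef_stable tau s f g w l k j :
  ((k <= 2 * j) -> 6 * j + ~~ w < f + 2 * k)%N ->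
  ((k <= 2 * j) -> 6 * j + ~~ w < g + 2 * k)%N ->
  mcoef tau s f w l k j = mcoef tau s g w l k j.
Proof.
elim: f g w l k j => [|f IHf] [|g] w l k j hf hg //=.
- by case: ifP => // jk; move: hf; lia.
- by case: ifP => // jk; move: hg; lia.
case: ifP => // /negbT; rewrite -leqNgt => jk.
case: w hf hg => hf hg.
  case: k jk hf hg => [//|k] jk hf hg.
  rewrite !(IHf g)//; try by move: (hf jk) (hg jk) => /= ? ?; lia.
  case: j jk hf hg => [//|j] jk hf hg.
  by rewrite !(IHf g)//; move: (hf jk) (hg jk) => /= ? ?; lia.
rewrite !(IHf g)//; try by move: (hf jk) (hg jk) => /= ? ?; lia.
case: j jk hf hg => [//|j] jk hf hg.
by rewrite !(IHf g)//; move: (hf jk) (hg jk) => /= ? ?; lia.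
Qed.

(** The quantity 2 j - k plus 2 (for z) or max (l, 1) + 1 (for V) never grows along recursive calls:
    l rises by one only with k + 1 or with j - 1 and k - 1. For z at k = 2 and order j + 1 it equals
    2 j + 2, which is the source of the last index in A_2, ..., A_(2n+2). *)
Lemma mcoef_local tau s s' B f w l k j :
  (forall i, (i <= B)%N -> s i = s' i) ->
  ((k <= 2 * j) -> (if w then 2 else (maxn l 1).+1) + 2 * j <= B + k)%N ->
  mcoef tau s f w l k j = mcoef tau s' f w l k j.
Proof.
move=> ss; elim: f w l k j => [//|f IHf] w l k j h /=.
case: ifP => // /negbT; rewrite -leqNgt => jk.
case: w h => h.
  case: k jk h => [//|k] jk h.
  rewrite ss; last by move: (h jk); lia.
  rewrite !IHf//; try by move: (h jk) => /= ?; lia.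
  case: j jk h => [//|j] jk h.
  by rewrite !IHf//; move: (h jk) => /= ?; lia.
rewrite ss; last by move: (h jk); lia.
rewrite !IHf//; try by move: (h jk) => /= ?; lia.
case: j jk h => [//|j] jk h.
by rewrite !IHf//; move: (h jk) => /= ?; lia.
Qed.

Lemma zcoef_local tau s s' k j : (k <= 2 * j)%N ->
  (forall i, (i + k <= 2 * j + 2)%N -> s i = s' i) ->
  zcoef tau s k j = zcoef tau s' k j.
Proof.
by move=> kj ss; apply: (@mcoef_local _ _ _ (2 * j + 2 - k)) => [i ij|_];
  [apply: ss; lia|lia].
Qed.

Lemma zcoef_vanish tau s k j : (2 * j < k)%N -> zcoef tau s k j = 0.
Proof. by move=> jk; rewrite /zcoef addn2 /= jk. Qed.

Lemma vcoef_vanish tau s l k j : (2 * j < k)%N -> vcoef tau s l k j = 0.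
Proof. by move=> jk; rewrite /vcoef addn2 /= jk. Qed.

Lemma zcoef0 tau s j : zcoef tau s 0 j = (j == 0)%:R.
Proof. by rewrite /zcoef addn2. Qed.

Lemma vcoef_rec tau s l k j : vcoef tau s l k j =
  s l.+1 * zcoef tau s k j
  - tau * (vcoef tau s l k.+1 j + tau * vcoef tau s l.+1 k.+1 j)
  - (if j isn't j'.+1 then 0 else
       2 * k%:R * (vcoef tau s l k j'
         + tau * vcoef tau s l.+1 k j' - vcoef tau s l.+1 k.-1 j')).
Proof.
have [jk|jk] := ltnP (2 * j) k.
  rewrite !vcoef_vanish ?zcoef_vanish//; try lia.
  case: j jk => [|j] jk; first by ring.
  by rewrite !vcoef_vanish//; [ring|lia..].
rewrite {1}/vcoef addn2 mcoefS ltnNge jk.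
congr (_ * _ - _ * (_ + _ * _) - _); try by apply: mcoef_stable => /=; lia.
case: j jk => [//|j] jk.
by congr (_ * (_ + _ * _ - _)); apply: mcoef_stable => /=; lia.
Qed.

Lemma zcoefS_rec tau s k j : 1 + tau ^+ 2 * s 2 != 0 ->
  (1 + tau ^+ 2 * s 2) * zcoef tau s k.+1 j =
  - tau * zcoef tau s k.+2 j
  + tau ^+ 3 * vcoef tau s 1 k.+2 j + tau ^+ 4 * vcoef tau s 2 k.+2 j
  + (if j isn't j'.+1 then 0 else
      2 * k.+1%:R * tau ^+ 2 * (vcoef tau s 1 k.+1 j'
        + tau * vcoef tau s 2 k.+1 j' - vcoef tau s 2 k j')
      - 2 * k%:R * (zcoef tau s k.+1 j'
        + tau * vcoef tau s 1 k j' - vcoef tau s 1 k.-1 j')).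
Proof.
move=> c0; have [jk|jk] := ltnP (2 * j) k.+1.
  rewrite !zcoef_vanish ?vcoef_vanish//; try lia.
  case: j jk => [|j] jk; first by ring.
  by rewrite zcoef_vanish ?vcoef_vanish//; [ring|lia..].
rewrite {1}/zcoef addn2 mcoefS ltnNge jk mulrA divff// mul1r.
congr (_ * _ + _ * _ + _ * _ + _); try by apply: mcoef_stable => /=; lia.
case: j jk => [//|j] jk.
by congr (_ * (_ + _ * _ - _) - _ * (_ + _ * _ - _)); apply: mcoef_stable => /=; lia.
Qed.

(* The regularity in tau needed to integrate a coefficient, uniformly in s. *)
Definition nice (F : R -> (nat -> R) -> R) : Prop :=
  (forall s, 0 <= s 2 -> continuous (F ^~ s)) /\
  exists C, forall tau s, 0 <= tau <= 1 -> 0 <= s 2 -> (forall l, `|s l| <= 1) ->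
    `|F tau s| <= C.

Lemma nice_cst c : nice (fun _ _ => c).
Proof. by split=> [s _ x|]; [exact: cvg_cst|exists `|c|]. Qed.

Lemma nice_tau : nice (fun tau _ => tau).
Proof.
split=> [s _ x|]; first exact: cvg_id.
by exists 1 => tau s /andP[t0 t1] _ _; rewrite ger0_norm.
Qed.

Lemma nice_s l : nice (fun _ s => s l).
Proof. by split=> [s _ x|]; [exact: cvg_cst|exists 1 => tau s _ _; exact]. Qed.

Lemma niceD F G : nice F -> nice G -> nice (fun tau s => F tau s + G tau s).
Proof.
move=> [cF [C FC]] [cG [D GD]]; split=> [s s2 x|].
  by apply: cvgD; [exact: cF|exact: cG].
exists (C + D) => tau s t01 s2 sl.
by rewrite (le_trans (ler_normD _ _))// lerD// ?FC ?GD.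
Qed.

Lemma niceM F G : nice F -> nice G -> nice (fun tau s => F tau s * G tau s).
Proof.
move=> [cF [C FC]] [cG [D GD]]; split=> [s s2 x|].
  by apply: cvgM; [exact: cF|exact: cG].
exists (C * D) => tau s t01 s2 sl.
by rewrite normrM ler_pM// ?FC ?GD.
Qed.

Lemma niceN F : nice F -> nice (fun tau s => - F tau s).
Proof.
move=> [cF [C FC]]; split=> [s s2 x|]; first by apply: cvgN; exact: cF.
by exists C => tau s t01 s2 sl; rewrite normrN FC.
Qed.

Lemma niceX F k : nice F -> nice (fun tau s => F tau s ^+ k).
Proof.
move=> nF; elim: k => [|k IHk].
  by under eq_fun do under eq_fun do rewrite expr0; exact: nice_cst.
by under eq_fun do under eq_fun do rewrite exprS; exact: niceM.
Qed.

Lemma A2_ge1 (tau : R) (s : nat -> R) : 0 <= s 2 -> 1 <= 1 + tau ^+ 2 * s 2.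
Proof. by move=> s2; rewrite lerDl mulr_ge0// sqr_ge0. Qed.

Lemma A2_neq0 (tau : R) (s : nat -> R) : 0 <= s 2 -> 1 + tau ^+ 2 * s 2 != 0.
Proof. by move=> s2; rewrite gt_eqF// (lt_le_trans ltr01)// A2_ge1. Qed.

Lemma nice_invA2 : nice (fun tau s => (1 + tau ^+ 2 * s 2)^-1).
Proof.
split=> [s s2 x|].
  apply: cvgV; first exact: A2_neq0.
  have [+ _] := niceD (nice_cst 1) (niceM (niceX 2 nice_tau) (nice_s 2)).
  by move=> /(_ s s2); exact.
exists 1 => tau s _ s2 _.
have h := A2_ge1 tau s2.
by rewrite normfV ger0_norm ?(le_trans ler01)// invf_le1// (lt_le_trans ltr01).
Qed.

Lemma nice_mcoef f w l k j : nice (fun tau s => mcoef tau s f w l k j).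
Proof.
elim: f w l k j => [|f IHf] w l k j; first exact: nice_cst.
rewrite /=; case: (2 * j < k)%N; first exact: nice_cst.
case: w.
  case: k => [|k]; first exact: nice_cst.
  apply: niceM; first exact: nice_invA2.
  apply: niceD; first apply: niceD; first apply: niceD.
  - by apply: niceM => //; apply: niceN; exact: nice_tau.
  - by apply: niceM => //; apply: niceX; exact: nice_tau.
  - by apply: niceM => //; apply: niceX; exact: nice_tau.
  case: j => [|j]; first exact: nice_cst.
  apply: niceD.
    apply: niceM.
      by apply: niceM; [exact: nice_cst|apply: niceX; exact: nice_tau].
    apply: niceD; last exact: niceN.
    by apply: niceD => //; apply: niceM => //; exact: nice_tau.
  apply/niceN/niceM; first exact: nice_cst.
  apply: niceD; last exact: niceN.
  by apply: niceD => //; apply: niceM => //; exact: nice_tau.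
apply: niceD; first apply: niceD.
- by apply: niceM => //; exact: nice_s.
- apply/niceN/niceM; first exact: nice_tau.
  by apply: niceD => //; apply: niceM => //; exact: nice_tau.
- apply: niceN; case: j => [|j]; first exact: nice_cst.
  apply: niceM; first exact: nice_cst.
  apply: niceD; last exact: niceN.
  by apply: niceD => //; apply: niceM => //; exact: nice_tau.
Qed.

Lemma nice_zcoef k j : nice (fun tau s => zcoef tau s k j).
Proof. exact: nice_mcoef. Qed.

End Coefficients.

(** * Remainder estimates, uniform over all Schwinger-Dyson systems *)

Section Remainder.
Variable R : realType.

(** Packing the data makes one constant in [bigO] valid for all dimensions, matrices and tau. *)
Record sd_instance := SdInstance {
  ieps : R; itau : R; ipsum : nat -> R; iV : nat -> nat -> R; iz : nat -> R;
  iP : sd_system ieps itau ipsum iV iz }.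

Definition bigO (J : nat) (F : sd_instance -> R) : Prop :=
  exists C, forall x, `|F x| <= C * ieps x ^+ J.

Lemma ieps_ge0 x : 0 <= ieps x.
Proof. by case/andP: (sd_eps (iP x)) => /ltW. Qed.

Lemma ieps_le1 x : ieps x <= 1.
Proof. by case/andP: (sd_eps (iP x)). Qed.

Lemma bigOD J F G : bigO J F -> bigO J G -> bigO J (fun x => F x + G x).
Proof.
move=> [C FC] [D GD]; exists (C + D) => x.
by rewrite mulrDl (le_trans (ler_normD _ _))// lerD.
Qed.

Lemma bigON J F : bigO J F -> bigO J (fun x => - F x).
Proof. by move=> [C FC]; exists C => x; rewrite normrN. Qed.

Lemma bigOM J K F G : bigO J F -> bigO K G -> bigO (J + K) (fun x => F x * G x).
Proof.
move=> [C FC] [D GD]; exists (C * D) => x.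
by rewrite normrM exprD mulrACA ler_pM.
Qed.

Lemma bigO_cst c : bigO 0 (fun=> c).
Proof. by exists `|c| => x; rewrite expr0 mulr1. Qed.

Lemma bigO_eps : bigO 1 ieps.
Proof. by exists 1 => x; rewrite mul1r expr1 ger0_norm ?ieps_ge0. Qed.

Lemma bigO_tau : bigO 0 itau.
Proof.
exists 1 => x; rewrite expr0 mulr1.
by case/andP: (sd_tau (iP x)) => t0 t1; rewrite ger0_norm.
Qed.

Lemma bigO_s l : bigO 0 (fun x => ipsum x l).
Proof. by exists 1 => x; rewrite expr0 mulr1 (sd_s_le1 (iP x)). Qed.

Lemma bigOX0 F k : bigO 0 F -> bigO 0 (fun x => F x ^+ k).
Proof.
move=> OF; elim: k => [|k IHk].
  by under eq_fun do rewrite expr0; exact: bigO_cst.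
by under eq_fun do rewrite exprS; exact: (bigOM OF IHk).
Qed.

Lemma bigOM0 J F G : bigO 0 F -> bigO J G -> bigO J (fun x => F x * G x).
Proof. exact: bigOM. Qed.

Lemma eq_bigO J F G : F =1 G -> bigO J F -> bigO J G.
Proof. by move=> /funext ->. Qed.

Lemma bigO_invA2 : bigO 0 (fun x => (1 + itau x ^+ 2 * ipsum x 2)^-1).
Proof.
exists 1 => x; rewrite expr0 mulr1.
have h := A2_ge1 (itau x) (sd_s2 (iP x)).
by rewrite normfV ger0_norm ?(le_trans ler01)// invf_le1// (lt_le_trans ltr01).
Qed.

Definition zrem k J x := iz x k -
  \sum_(j < J) zcoef (itau x) (ipsum x) k j * ieps x ^+ j.
Definition vrem l k J x := iV x l k -
  \sum_(j < J) vcoef (itau x) (ipsum x) l k j * ieps x ^+ j.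

Lemma sum_shift (e : R) (G : nat -> R) J :
  \sum_(j < J.+1) (if (j : nat) isn't j'.+1 then 0 else G j') * e ^+ j =
  e * \sum_(j < J) G j * e ^+ j.
Proof.
rewrite big_ord_recl /= mul0r add0r mulr_sumr; apply: eq_bigr => j _.
by rewrite exprS mulrCA.
Qed.

(** The equations are linear and the formal series solves them order by order, so the remainders
    obey them too; a factor eps lowers the truncation order needed to J. *)
Lemma vrem_rec l k J x : vrem l k J.+1 x =
  ipsum x l.+1 * zrem k J.+1 x
  - itau x * (vrem l k.+1 J.+1 x + itau x * vrem l.+1 k.+1 J.+1 x)
  - 2 * k%:R * (ieps x * (vrem l k J x + itau x * vrem l.+1 k J x - vrem l.+1 k.-1 J x)).
Proof.
rewrite /vrem /zrem; set e := ieps x; set t := itau x; set s := ipsum x.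
have h := sd_rec (iP x) l k; rewrite -/e -/t -/s in h.
have {}h : iV x l k = s l.+1 * iz x k - t * (iV x l k.+1 + t * iV x l.+1 k.+1)
   - 2 * k%:R * e * (iV x l k + t * iV x l.+1 k - iV x l.+1 k.-1).
  by rewrite -h; ring.
rewrite [in LHS]h.
pose G j := 2 * k%:R * (vcoef t s l k j + t * vcoef t s l.+1 k j - vcoef t s l.+1 k.-1 j).
have -> : \sum_(j < J.+1) vcoef t s l k j * e ^+ j =
    s l.+1 * (\sum_(j < J.+1) zcoef t s k j * e ^+ j)
    + (- t) * (\sum_(j < J.+1) vcoef t s l k.+1 j * e ^+ j)
    + (- (t * t)) * (\sum_(j < J.+1) vcoef t s l.+1 k.+1 j * e ^+ j)
    - \sum_(j < J.+1) (if (j : nat) isn't j'.+1 then 0 else G j') * e ^+ j.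
  rewrite !mulr_sumr -!big_split /= -sumrB; apply: eq_bigr => j _.
  by rewrite vcoef_rec /G; case: (j : nat) => [|j'] /=; ring.
rewrite sum_shift.
have -> : \sum_(j < J) G j * e ^+ j = 2 * k%:R *
    (\sum_(j < J) vcoef t s l k j * e ^+ j
     + t * (\sum_(j < J) vcoef t s l.+1 k j * e ^+ j)
     - \sum_(j < J) vcoef t s l.+1 k.-1 j * e ^+ j).
  rewrite mulr_sumr -big_split -sumrB mulr_sumr.
  by apply: eq_bigr => j _; rewrite /G /=; ring.
ring.
Qed.

(* Combines [sd_rec] for (0, k) with [sd_rec] for (1, k + 1). *)
Lemma zremS_rec k J x : (1 + itau x ^+ 2 * ipsum x 2) * zrem k.+1 J.+1 x =
  - itau x * zrem k.+2 J.+1 x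
  + itau x ^+ 3 * vrem 1 k.+2 J.+1 x + itau x ^+ 4 * vrem 2 k.+2 J.+1 x
  + ieps x * (2 * k.+1%:R * itau x ^+ 2 * (vrem 1 k.+1 J x
        + itau x * vrem 2 k.+1 J x - vrem 2 k J x)
      - 2 * k%:R * (zrem k.+1 J x + itau x * vrem 1 k J x - vrem 1 k.-1 J x)).
Proof.
rewrite /vrem /zrem; set e := ieps x; set t := itau x; set s := ipsum x.
have h0 := sd_rec (iP x) 0 k; have h1 := sd_rec (iP x) 1 k.+1.
rewrite !(sd_V0 (iP x)) (sd_s1 (iP x)) mul0r -/e -/t -/s in h0.
rewrite -/e -/t -/s /= in h1.
have c0 : 1 + t ^+ 2 * s 2 != 0 by exact: A2_neq0 (sd_s2 (iP x)).
have hz : (1 + t ^+ 2 * s 2) * iz x k.+1 =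
  - t * iz x k.+2 + t ^+ 3 * iV x 1 k.+2 + t ^+ 4 * iV x 2 k.+2
  + e * (2 * k.+1%:R * t ^+ 2 * (iV x 1 k.+1 + t * iV x 2 k.+1 - iV x 2 k)
      - 2 * k%:R * (iz x k.+1 + t * iV x 1 k - iV x 1 k.-1)).
  rewrite mulrDl mul1r -mulrA -h1.
  rewrite -[LHS]subr0 -{1}h0; ring.
pose G j := 2 * k.+1%:R * t ^+ 2 * (vcoef t s 1 k.+1 j
        + t * vcoef t s 2 k.+1 j - vcoef t s 2 k j)
      - 2 * k%:R * (zcoef t s k.+1 j + t * vcoef t s 1 k j - vcoef t s 1 k.-1 j).
have hc : (1 + t ^+ 2 * s 2) * (\sum_(j < J.+1) zcoef t s k.+1 j * e ^+ j) =
    - t * (\sum_(j < J.+1) zcoef t s k.+2 j * e ^+ j)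
    + t ^+ 3 * (\sum_(j < J.+1) vcoef t s 1 k.+2 j * e ^+ j)
    + t ^+ 4 * (\sum_(j < J.+1) vcoef t s 2 k.+2 j * e ^+ j)
    + \sum_(j < J.+1) (if (j : nat) isn't j'.+1 then 0 else G j') * e ^+ j.
  rewrite !mulr_sumr -!big_split /=; apply: eq_bigr => j _.
  rewrite mulrA zcoefS_rec//.
  by rewrite /G; case: (j : nat) => [|j'] /=; ring.
rewrite mulrBr hz hc sum_shift.
have -> : \sum_(j < J) G j * e ^+ j =
    2 * k.+1%:R * t ^+ 2 * (\sum_(j < J) vcoef t s 1 k.+1 j * e ^+ j
     + t * (\sum_(j < J) vcoef t s 2 k.+1 j * e ^+ j)
     - \sum_(j < J) vcoef t s 2 k j * e ^+ j)
    - 2 * k%:R * (\sum_(j < J) zcoef t s k.+1 j * e ^+ j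
     + t * (\sum_(j < J) vcoef t s 1 k j * e ^+ j)
     - \sum_(j < J) vcoef t s 1 k.-1 j * e ^+ j).
  rewrite !mulr_sumr -!big_split -!sumrB !mulr_sumr -sumrB.
  by apply: eq_bigr => j _; rewrite /G /=; ring.
ring.
Qed.

Lemma moment_bigO k J (F : sd_instance -> R) : (2 * J <= k)%N ->
  (forall x, `|F x| <= moment_bound R k * ieps x ^+ k./2) -> bigO J F.
Proof.
move=> Jk FK; exists (moment_bound R k) => x; apply: le_trans (FK x) _.
apply: ler_wpM2l; first by rewrite mulr_ge0// prodr_ge0// => i _.
by apply: ler_wiXn2l; [exact: ieps_ge0|exact: ieps_le1|lia].
Qed.

(** Induction on J and, for fixed J, downward on k. From k = 2 J on, the truncated sum is empty of
    nonzero terms and the a priori moment bound suffices. Below, the terms in k + 1 and k + 2 come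
    from the inner induction, those carrying eps from the outer one; at each k, z is treated before
    V, whose equation involves it. *)
Lemma remainder_bigO J k : bigO J (zrem k J) /\ forall l, bigO J (vrem l.+1 k J).
Proof.
elim: J k => [|J IHJ].
  move=> k; split=> [|l]; apply: (@moment_bigO k) => // x.
    by rewrite /zrem big_ord0 subr0; exact: sd_z_le (iP x) k.
  by rewrite /vrem big_ord0 subr0; exact: sd_V_le (iP x) _ _.
have base k : (2 * J.+1 <= k)%N ->
    bigO J.+1 (zrem k J.+1) /\ forall l, bigO J.+1 (vrem l.+1 k J.+1).
  move=> kJ; split=> [|l]; apply: (@moment_bigO k) => // x.
    rewrite /zrem big1 ?subr0 => [|j _]; first exact: sd_z_le (iP x) k.
    by rewrite zcoef_vanish ?mul0r//; have := ltn_ord j; lia.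
  rewrite /vrem big1 ?subr0 => [|j _]; first exact: sd_V_le (iP x) _ _.
  by rewrite vcoef_vanish ?mul0r//; have := ltn_ord j; lia.
suff H d k : (2 * J.+1 <= k + d)%N ->
    bigO J.+1 (zrem k J.+1) /\ forall l, bigO J.+1 (vrem l.+1 k J.+1).
  by move=> k; apply: (H (2 * J.+1)%N); lia.
elim: d k => [|d IHd] k hk; first by apply: base; lia.
have IHv l m : bigO J (vrem l.+1 m J) by exact: (IHJ m).2.
have IHz m : bigO J (zrem m J) by exact: (IHJ m).1.
have Bv l : bigO J.+1 (vrem l.+1 k.+1 J.+1) by apply: (IHd k.+1 _).2; lia.
have Bz : bigO J.+1 (zrem k.+1 J.+1) by apply: (IHd k.+1 _).1; lia.
have Oz : bigO J.+1 (zrem k J.+1).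
  case: k hk Bv Bz => [|k] hk Bv Bz.
    exists 0 => x; rewrite /zrem (sd_z0 (iP x)) big_ord_recl zcoef0 mulr1 big1 => [|j _].
      by rewrite addr0 subrr normr0 mul0r.
    by rewrite zcoef0 mul0r.
  apply: (eq_bigO (F := fun x => (1 + itau x ^+ 2 * ipsum x 2)^-1 *
    ((1 + itau x ^+ 2 * ipsum x 2) * zrem k.+1 J.+1 x))).
    by move=> x; rewrite mulrA mulVf ?mul1r//; exact: A2_neq0 (sd_s2 (iP x)).
  under eq_fun do rewrite zremS_rec.
  apply: bigOM0; first exact: bigO_invA2.
  apply: bigOD; first apply: bigOD; first apply: bigOD.
  - by apply: bigOM0 => //; apply: bigON; exact: bigO_tau.
  - by apply: bigOM0 => //; apply: bigOX0; exact: bigO_tau.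
  - by apply: bigOM0 => //; apply: bigOX0; exact: bigO_tau.
  apply: (bigOM bigO_eps); apply: bigOD.
    apply: bigOM0.
      by apply: bigOM0; [exact: bigO_cst|apply: bigOX0; exact: bigO_tau].
    apply: bigOD; last exact: bigON.
    by apply: bigOD => //; apply: bigOM0 => //; exact: bigO_tau.
  apply/bigON/bigOM0; first exact: bigO_cst.
  apply: bigOD; last exact: bigON.
  by apply: bigOD => //; apply: bigOM0 => //; exact: bigO_tau.
split=> // l.
apply: eq_bigO (fun x => esym (vrem_rec l.+1 k J x)) _.
apply: bigOD; first apply: bigOD.
- by apply: bigOM0 => //; exact: bigO_s.
- apply/bigON/bigOM0; first exact: bigO_tau.
  by apply: bigOD => //; apply: bigOM0 => //; exact: bigO_tau.
- apply/bigON/bigOM0; first exact: bigO_cst.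
  apply: (bigOM bigO_eps); apply: bigOD; last exact: bigON.
  by apply: bigOD => //; apply: bigOM0 => //; exact: bigO_tau.
Qed.

End Remainder.

(** * Real analysis *)

Section RealDerivatives.
Variable R : realType.
Implicit Types (f g : R -> R) (x a b : R).

Lemma is_derive_pointD f g x a b : is_derive x (1 : R) f a -> is_derive x (1 : R) g b ->
  is_derive x (1 : R) (fun t => f t + g t) (a + b).
Proof. exact: is_deriveD. Qed.

Lemma is_derive_pointM f g x a b : is_derive x (1 : R) f a -> is_derive x (1 : R) g b ->
  is_derive x (1 : R) (fun t => f t * g t) (a * g x + f x * b).
Proof.
move=> df dg; apply: (@is_derive_eq _ _ _ (f * g)).
by rewrite /GRing.scale /= addrC (mulrC a).
Qed.

Lemma is_derive_pointV f x a : f x != 0 -> is_derive x (1 : R) f a ->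
  is_derive x (1 : R) (fun t => (f t)^-1) (- a / f x ^+ 2).
Proof.
move=> fx [df <-]; apply: DeriveDef; first exact: derivableV.
by rewrite deriveV// /GRing.scale /= mulNr mulrC mulNr.
Qed.

Lemma is_derive_point_ln f x a : 0 < f x -> is_derive x (1 : R) f a ->
  is_derive x (1 : R) (fun t => ln (f t)) (a / f x).
Proof.
move=> fx df; apply: is_derive_eq; first exact: (@is_derive1_comp _ (@ln R) f x _ _ (is_derive1_ln fx) df).
by rewrite /GRing.scale /= mulrC.
Qed.

Lemma is_derive_sumr (I : Type) (r : seq I) (f : I -> R -> R) (a : I -> R) x :
  (forall i, is_derive x (1 : R) (f i) (a i)) ->
  is_derive x (1 : R) (fun t => \sum_(i <- r) f i t) (\sum_(i <- r) a i).
Proof.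
move=> df; elim: r => [|i r IHr].
  by rewrite big_nil; under eq_fun do rewrite big_nil; exact: is_derive_cst.
by rewrite big_cons; under eq_fun do rewrite big_cons; exact: is_derive_pointD.
Qed.

Lemma is_derive_continuous f x a : is_derive x (1 : R) f a -> {for x, continuous f}.
Proof. by move=> df; exact/differentiable_continuous/derivable1_diffP. Qed.

Lemma is_derive_ext (f f' : R -> R) (x a a' : R) :
  is_derive x (1 : R) f a -> f =1 f' -> a = a' -> is_derive x (1 : R) f' a'.
Proof. by move=> + /funext <- <-. Qed.

Lemma is_derive_monomial (k : nat) (b t : R) :
  is_derive t (1 : R) (fun t => b * t ^+ k.+1) (b * (k.+1%:R * t ^+ k)).
Proof.
have h : is_derive t (1 : R) (fun t => t ^+ k.+1) (k.+1%:R * t ^+ k).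
  elim: k => [|k IHk].
    refine (is_derive_ext (is_derive_id t (1 : R)) _ _); last by rewrite mulr1.
    by move=> u; rewrite expr1.
  refine (is_derive_ext (is_derive_pointM (is_derive_id t (1 : R)) IHk) _ _).
    by move=> u /=; rewrite [RHS]exprS.
  by rewrite [k.+2%:R]mulrSr exprS; ring.
refine (is_derive_ext (is_derive_pointM (is_derive_cst b t 1) h) _ _) => //.
by rewrite mul0r add0r.
Qed.

(** The hypothesis is an estimate that survives averaging, so it yields derivatives of integrals
    over O(n) without a dominated convergence argument. *)
Lemma quadratic_is_derive f x (a C d : R) : 0 < d ->
  (forall h, `|h| <= d -> `|f (x + h) - f x - h * a| <= C * h ^+ 2) ->
  is_derive x (1 : R) f a.
Proof.
move=> d0 hf.
have C0 : 0 <= C.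
  have := hf d; rewrite gtr0_norm// lexx => /(_ isT) h.
  by have := le_trans (normr_ge0 _) h; rewrite pmulr_lge0// exprn_gt0.
have cv : h^-1 *: ((f \o shift x) (h *: (1 : R)) - f x) @[h --> 0^'] --> a.
  apply/cvgrPdist_le => e e0; near=> h.
  have h0 : h != 0 by near: h; exact: nbhs_dnbhs_neq.
  have hd : `|h| <= d.
    by near: h; apply: dnbhs0_le.
  have he : `|h| <= e / (C + 1).
    by near: h; apply: dnbhs0_le; rewrite divr_gt0// ltr_wpDl.
  rewrite /= /GRing.scale /= mulr1 (addrC h).
  have -> : a - h^-1 * (f (x + h) - f x) = - h^-1 * (f (x + h) - f x - h * a).
    by field.
  rewrite normrM normrN normfV mulrC ler_pdivrMr ?normr_gt0//.
  apply: le_trans (hf h hd) _.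
  rewrite -[h ^+ 2]real_normK ?num_real// expr2 mulrA ler_wpM2r//.
  apply: le_trans (ler_wpM2l C0 he) _.
  rewrite mulrA ler_pdivrMr; last by rewrite ltr_wpDl.
  by rewrite mulrC ler_pM2l// lerDl.
by apply: DeriveDef; [apply/cvg_ex; exists a|exact/cvg_lim].
Unshelve. all: by end_near. Qed.

(** The open interval (-1, 2) surrounds [0, 1], so that two-sided derivatives exist at both
    endpoints. *)
Lemma primitive_exists (g : R -> R) : continuous g ->
  exists G : R -> R, forall x, -1 < x < 2 -> is_derive x (1 : R) G (g x).
Proof.
move=> cg.
exists (fun x => \int[lebesgue_measure]_(t in `[-1, x]) g t) => x /andP[x1 x2].
have int : lebesgue_measure.-integrable `[-1, 2] (EFin \o g).
  apply: continuous_compact_integrable; first exact: segment_compact.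
  exact: continuous_subspaceT.
have [d e] := continuous_FTC1_closed x2 int x1 (cg x).
apply: (DeriveDef d); rewrite -derive1E; exact: e.
Qed.

Lemma Rintegral_primitive (g G : R -> R) a b : a < b ->
  {within `[a, b], continuous g} ->
  (forall x, a <= x <= b -> is_derive x (1 : R) G (g x)) ->
  \int[lebesgue_measure]_(x in `[a, b]) g x = G b - G a.
Proof.
move=> ab cg dG.
have dF : derivable_oo_LRcontinuous G a b.
  split=> [x /[!in_itv]/= /andP[/ltW ax /ltW xb]||].
  - by have axb : a <= x <= b; [rewrite ax|have [] := dG x axb].
  - apply: cvg_at_right_filter; apply: (@is_derive_continuous _ _ (g a)).
    by apply: dG; rewrite lexx ltW.
  - apply: cvg_at_left_filter; apply: (@is_derive_continuous _ _ (g b)).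
    by apply: dG; rewrite lexx ltW.
have eG : {in `]a, b[, derive1 G =1 g}.
  move=> x /[!in_itv]/= /andP[/ltW ax /ltW xb].
  have axb : a <= x <= b by rewrite ax.
  by rewrite derive1E; have [_ ->] := dG x axb.
by rewrite /Rintegral (continuous_FTC2 ab cg dF eG).
Qed.

Lemma mvt_bound (f df : R -> R) a b C : a <= b ->
  (forall x, a <= x <= b -> is_derive x (1 : R) f (df x)) ->
  (forall x, a <= x <= b -> `|df x| <= C) ->
  `|f b - f a| <= C * (b - a).
Proof.
move=> ab dfx dC.
have d1 x : x \in `]a, b[ -> is_derive x 1 f (df x).
  by move=> /[!in_itv]/= /andP[/ltW ax /ltW xb]; apply: dfx; rewrite ax.
have c1 : {within `[a, b], continuous f}.
  apply: continuous_in_subspaceT => x /[!inE]/= /[!in_itv]/= xab.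
  exact: is_derive_continuous (dfx x xab).
have [c /[!in_itv]/= cab ->] := MVT_segment ab d1 c1.
by rewrite normrM (ger0_norm (_ : 0 <= b - a)) ?subr_ge0// ler_wpM2r ?subr_ge0// dC.
Qed.

End RealDerivatives.

(** * The first two coefficients *)

Section ExplicitCoefficients.
Variables (R : realType) (s : nat -> R).
Hypothesis s2 : 0 <= s 2.
Implicit Types t : R.

Lemma vcoef_00 t l : vcoef t s l 0 0 = s l.+1.
Proof. by rewrite vcoef_rec zcoef0 eqxx /= !vcoef_vanish//; ring. Qed.

Lemma zcoef_2_1 t : zcoef t s 2 1 = 2 * s 2 / (1 + t ^+ 2 * s 2).
Proof.
have c0 : 1 + t ^+ 2 * s 2 != 0 by exact: A2_neq0.
apply: (mulfI c0); rewrite zcoefS_rec// /= vcoef_00.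
by rewrite !vcoef_vanish// !zcoef_vanish//; field.
Qed.

(** The local names follow the order in which the recursion closes: (k, j) = (2, 1), (1, 1), (4, 2),
    (3, 2), then (2, 2). *)
Lemma zcoef_2_2 t :
  let c := 1 + t ^+ 2 * s 2 in
  let z21 := zcoef t s 2 1 in
  let z11 := (- t * z21 + t ^+ 3 * (s 2 * z21) + t ^+ 4 * (s 3 * z21)
     - 2 * t ^+ 2 * s 3) / c in
  let v1 := fun l => s l.+1 * z11 - t * (s l.+1 * z21 + t * (s l.+2 * z21)) + 2 * s l.+2 in
  let z42 := 6 * (s 2 * z21) / c in
  let z32 := (- t * z42 + t ^+ 3 * (s 2 * z42) + t ^+ 4 * (s 3 * z42)
     - 6 * t ^+ 2 * (s 3 * z21) - 4 * (t * (s 2 * z21) - v1 1)) / c in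
  let v32 := fun l => s l.+1 * z32 - t * (s l.+1 * z42 + t * (s l.+2 * z42))
     + 6 * (s l.+2 * z21) in
  zcoef t s 2 2 = (- t * z32 + t ^+ 3 * v32 1 + t ^+ 4 * v32 2
     + 4 * t ^+ 2 * (s 2 * z21 + t * (s 3 * z21) - v1 2)
     - 2 * (z21 + t * v1 1 + t * (v1 1 + t * v1 2))) / c.
Proof.
move=> c z21 z11 v1 z42 z32 v32.
have c0 : c != 0 by exact: A2_neq0.
have V21 l : vcoef t s l 2 1 = s l.+1 * z21.
  by rewrite vcoef_rec !vcoef_vanish// /z21; ring.
have Z11 : zcoef t s 1 1 = z11.
  apply: (mulfI c0); rewrite zcoefS_rec// /= !V21 !vcoef_00 -/z21 !vcoef_vanish// !zcoef_vanish//.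
  by rewrite /z11; field.
have V11 l : vcoef t s l 1 1 = v1 l.
  by rewrite vcoef_rec Z11 !V21 /= vcoef_00 !vcoef_vanish// /v1; ring.
have V01 l : vcoef t s l 0 1 = - t * (v1 l + t * v1 l.+1).
  by rewrite vcoef_rec zcoef0 !V11 /=; ring.
have Z42 : zcoef t s 4 2 = z42.
  apply: (mulfI c0); rewrite zcoefS_rec// /= !V21 !zcoef_vanish//.
  by rewrite !vcoef_vanish// /z42; field.
have V42 l : vcoef t s l 4 2 = s l.+1 * z42.
  by rewrite vcoef_rec Z42 !vcoef_vanish//; ring.
have Z32 : zcoef t s 3 2 = z32.
  apply: (mulfI c0); rewrite zcoefS_rec// /= Z42 !V42 !V21 V11.
  rewrite !zcoef_vanish//.
  by rewrite !vcoef_vanish// /z32; field.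
have V32 l : vcoef t s l 3 2 = v32 l.
  rewrite vcoef_rec Z32 !V42 /= V21 !vcoef_vanish// /v32; ring.
apply: (mulfI c0); rewrite zcoefS_rec// /= Z32 !V32 !V21 !V11 V01 -/z21.
by rewrite [RHS]mulrC divfK//; ring.
Qed.

(* Means of the (1 + t y_i)^k for k = 2, 3, 4, when s 1 = 0. *)
Definition A2s t := 1 + t ^+ 2 * s 2.
Definition A3s t := 1 + 3 * t ^+ 2 * s 2 + t ^+ 3 * s 3.
Definition A4s t := 1 + 6 * t ^+ 2 * s 2 + 4 * t ^+ 3 * s 3 + t ^+ 4 * s 4.

Lemma is_derive_A2s t : is_derive t (1 : R) A2s (2 * t * s 2).
Proof.
refine (is_derive_ext (is_derive_pointD (is_derive_cst (1 : R) t 1)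
  (is_derive_monomial 1 (s 2) t)) _ _); last by rewrite expr1; ring.
by move=> u; rewrite /A2s /cst; ring.
Qed.

Lemma is_derive_A3s t : is_derive t (1 : R) A3s (6 * t * s 2 + 3 * t ^+ 2 * s 3).
Proof.
refine (is_derive_ext (is_derive_pointD (is_derive_pointD (is_derive_cst (1 : R) t 1)
  (is_derive_monomial 1 (3 * s 2) t)) (is_derive_monomial 2 (s 3) t)) _ _).
  by move=> u; rewrite /A3s /cst; ring.
by rewrite expr1; ring.
Qed.

Lemma is_derive_A4s t : is_derive t (1 : R) A4s
  (12 * t * s 2 + 12 * t ^+ 2 * s 3 + 4 * t ^+ 3 * s 4).
Proof.
refine (is_derive_ext (is_derive_pointD (is_derive_pointD (is_derive_pointD
  (is_derive_cst (1 : R) t 1) (is_derive_monomial 1 (6 * s 2) t))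
  (is_derive_monomial 2 (4 * s 3) t)) (is_derive_monomial 3 (s 4) t)) _ _).
  by move=> u; rewrite /A4s /cst; ring.
by rewrite expr1; ring.
Qed.

Lemma is_derive_coef0 t :
  is_derive t (1 : R) (fun t => ln (A2s t) / 2) (t / 2 * zcoef t s 2 1).
Proof.
have c0 : 0 < A2s t by rewrite (lt_le_trans ltr01)// A2_ge1.
refine (is_derive_ext (is_derive_pointM (is_derive_point_ln c0 (is_derive_A2s t))
  (is_derive_cst (2^-1 : R) t 1)) _ _) => //.
by rewrite zcoef_2_1 -/(A2s t) mulr0 addr0 /cst; field; exact: lt0r_neq0.
Qed.

(* The coefficient of 1/N in ln Lambda(t). *)
Definition log_coef1 t : R :=
  3 / 2 * (A4s t / A2s t ^+ 2) - 5 / 3 * (A3s t ^+ 2 / A2s t ^+ 3) + 6^-1.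

(** No integral is computed: the bracket announced for m_1, with each y_i scaled by t, is checked to
    be a primitive up to sign. It vanishes at t = 0 because 3/2 - 5/3 + 1/6 = 0. *)
Lemma is_derive_coef1 t :
  is_derive t (1 : R) (fun t => - log_coef1 t) (t / 2 * zcoef t s 2 2).
Proof.
have c0 : A2s t != 0 by exact: A2_neq0.
have d2 := is_derive_A2s t; have d3 := is_derive_A3s t; have d4 := is_derive_A4s t.
have dV := is_derive_pointV c0 d2.
have dVV := is_derive_pointM dV dV.
have dVVV := is_derive_pointM dV dVV.
have d1 := is_derive_pointM (is_derive_cst (- (3 / 2) : R) t 1) (is_derive_pointM d4 dVV).
have d0 := is_derive_pointM (is_derive_cst (5 / 3 : R) t 1)
  (is_derive_pointM (is_derive_pointM d3 d3) dVVV).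
refine (is_derive_ext (is_derive_pointD (is_derive_pointD d1 d0)
  (is_derive_cst (- 6^-1 : R) t 1)) _ _).
  by move=> u; rewrite /log_coef1 /cst -!exprVn; ring.
rewrite zcoef_2_2 /cst zcoef_2_1 -/(A2s t) !mul0r !add0r addr0.
rewrite /A3s /A4s; move: c0; rewrite /A2s => c0.
by field.
Qed.

End ExplicitCoefficients.

(** * Exponentiation of an expansion *)

Section ExpExpansion.
Variable R : realType.

(** The derivative of the remainder of order n + 1 is the remainder of order n, so the mean value
    inequality carries the induction. *)
Lemma expR_taylor_le n (x : R) :
  `|expR x - \sum_(i < n) x ^+ i / i`!%:R| <= `|x| ^+ n * expR `|x|.
Proof.
elim: n x => [|n IHn] x.
  by rewrite big_ord0 subr0 expr0 mul1r ger0_norm ?expR_ge0// ler_expR ler_norm.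
pose f (t : R) := expR t - \sum_(i < n.+1) t ^+ i / i`!%:R.
pose df (t : R) := expR t - \sum_(i < n) t ^+ i / i`!%:R.
have dfE t : is_derive t (1 : R) f (df t).
  have dS : is_derive t (1 : R) (fun t => \sum_(i < n.+1) (- t ^+ i / i`!%:R))
      (\sum_(i < n.+1) (if (i : nat) isn't j.+1 then 0 else - (t ^+ j / j`!%:R))).
    apply: is_derive_sumr => i; case: (i : nat) => [|j].
      refine (is_derive_ext (is_derive_cst (-1 : R) t 1) _ _) => //.
      by move=> u; rewrite expr0 fact0 divr1.
    refine (is_derive_ext (is_derive_monomial j (- (j.+1`!%:R)^-1) t) _ _).
      by move=> u; rewrite mulNr mulNr mulrC.
    rewrite factS natrM; field.
    by rewrite nat1r !pnatr_eq0 -lt0n fact_gt0.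
  refine (is_derive_ext (is_derive_pointD (is_derive_expR t) dS) _ _).
    by move=> u; rewrite /f -sumrN; congr (_ + _); apply: eq_bigr => i _; rewrite mulNr.
  by rewrite /df big_ord_recl add0r -sumrN.
have f0 : f 0 = 0.
  rewrite /f big_ord_recl expR0 expr0 fact0 divr1 big1 ?addr0 ?subrr// => i _.
  by rewrite expr0n mul0r.
have bd t : `|t| <= `|x| -> `|df t| <= `|x| ^+ n * expR `|x|.
  move=> tx; apply: le_trans (IHn t) _.
  by apply: ler_pM; rewrite ?exprn_ge0 ?expR_ge0 ?ler_expR// lerXn2r.
rewrite -/(f x) exprSr mulrAC.
have [x0|x0] := leP 0 x.
  have bt t : 0 <= t <= x -> `|df t| <= `|x| ^+ n * expR `|x|.
    by move=> /andP[t0 tx]; apply: bd; rewrite !ger0_norm// (le_trans t0).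
  have := mvt_bound x0 (fun t _ => dfE t) bt.
  by rewrite f0 !subr0 (ger0_norm x0).
have bt t : x <= t <= 0 -> `|df t| <= `|x| ^+ n * expR `|x|.
  by move=> /andP[t0 tx]; apply: bd; rewrite (ltr0_norm x0) ler0_norm// lerN2.
have := mvt_bound (ltW x0) (fun t _ => dfE t) bt.
by rewrite f0 !sub0r normrN (ltr0_norm x0).
Qed.

(* [exp_poly n b] has the coefficients of exp (- sum_(1 <= j <= n) b_j X^j) up to
   degree n, and unwanted ones above. *)
Definition tail_poly (n : nat) (b : nat -> R) : {poly R} := \poly_(j < n) (- b j.+1).

Definition exp_poly (n : nat) (b : nat -> R) : {poly R} :=
  \sum_(i < n.+1) (i`!%:R)^-1 *: (tail_poly n b ^+ i * 'X^i).

Lemma exp_poly_coef0 n b : (exp_poly n b)`_0 = 1.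
Proof.
rewrite coef_sum big_ord_recl big1 => [|i _].
  by rewrite coefZ coefMXn /= subn0 expr0 coef1 fact0 invr1 mulr1 addr0.
by rewrite coefZ coefMXn /= mulr0.
Qed.

Lemma exp_poly_coef1 n b : (0 < n)%N -> (exp_poly n b)`_1 = - b 1.
Proof.
case: n => // n _; rewrite coef_sum !big_ord_recl big1 => [|i _].
  rewrite !coefZ !coefMXn /= expr0 coef1 mulr0 add0r addr0 expr1 coef_poly /=.
  by rewrite invr1 mul1r.
by rewrite coefZ coefMXn /= mulr0.
Qed.

Lemma tail_polyX_bounded n K i : exists D C, forall b : nat -> R,
  (forall j, (j <= n)%N -> `|b j| <= K) ->
  (size (tail_poly n b ^+ i)%R <= D)%N /\ forall k, `|(tail_poly n b ^+ i)`_k| <= C.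
Proof.
elim: i => [|i [D [C IHi]]].
  exists 1, 1 => b _; rewrite expr0 size_poly1; split=> // k.
  by rewrite coef1; case: (k == 0); rewrite ?normr1 ?normr0.
exists (n + D)%N, ((n + D)%:R * (`|K| * `|C|)) => b bK.
have [sD hC] := IHi b bK.
have sz : (size (tail_poly n b ^+ i.+1)%R <= n + D)%N.
  rewrite exprS (leq_trans (size_polyMleq _ _))//.
  by rewrite (leq_trans (leq_pred _))// leq_add// size_poly.
split=> // k.
have [kD|kD] := ltnP k (n + D); last first.
  by rewrite nth_default ?normr0 ?mulr_ge0// (leq_trans sz).
rewrite exprS coefM (le_trans (ler_norm_sum _ _ _))//.
apply: (@le_trans _ _ (\sum_(j < k.+1) `|K| * `|C|)).
  apply: ler_sum => j _; rewrite normrM ler_pM//; last exact: le_trans (hC _) (ler_norm _).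
  rewrite coef_poly; case: ifP => jn; last by rewrite normr0.
  by rewrite normrN (le_trans (bK _ jn))// ler_norm.
rewrite sumr_const card_ord -[leLHS]mulr_natl; apply: ler_wpM2r; first exact: mulr_ge0.
by rewrite ler_nat.
Qed.

(** The bounds precede [b], since the log-coefficients to which this is applied vary with N. *)
Lemma exp_poly_bounded n K : exists D C, forall b : nat -> R,
  (forall j, (j <= n)%N -> `|b j| <= K) ->
  (size (exp_poly n b) <= D)%N /\ forall k, `|(exp_poly n b)`_k| <= C.
Proof.
rewrite /exp_poly; elim: n.+1 => [|m [D [C IHm]]].
  exists 0%N, 0 => b _; rewrite big_ord0 size_poly0; split=> // k.
  by rewrite coef0 normr0.
have [D' [C' hm]] := tail_polyX_bounded n K m.
exists (maxn D (D' + m)), (C + `|(m`!%:R)^-1| * `|C'|) => b bK.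
have [sD hC] := IHm b bK; have [sD' hC'] := hm b bK.
rewrite big_ord_recr /=; split=> [|k].
  apply: leq_trans (size_polyD _ _) _; rewrite geq_max !leq_max sD /=.
  apply/orP; right; apply: leq_trans (size_scale_leq _ _) _.
  apply: leq_trans (size_polyMleq _ _) _.
  by rewrite size_polyXn addnS /= leq_add2r.
rewrite coefD (le_trans (ler_normD _ _))// lerD// coefZ normrM ler_wpM2l//.
rewrite coefMXn; case: ifP => _; first by rewrite normr0.
exact: le_trans (hC' _) (ler_norm _).
Qed.

Lemma poly_truncation_le (q : {poly R}) n D (C e : R) : 0 <= e -> e <= 1 -> 0 <= C ->
  (size q <= D)%N -> (forall k, `|q`_k| <= C) ->
  `|q.[e] - \sum_(k < n) q`_k * e ^+ k| <= D%:R * C * e ^+ n.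
Proof.
move=> e0 e1 C0 sD qC.
rewrite (horner_coef_wide _ (leq_trans sD (leq_addl n D))) big_split_ord /=.
rewrite [X in X - _]addrC addrK.
rewrite (le_trans (ler_norm_sum _ _ _))//.
apply: (@le_trans _ _ (\sum_(j < D) C * e ^+ n)).
  apply: ler_sum => j _; rewrite normrM (ger0_norm (exprn_ge0 _ e0)).
  apply: ler_pM => //; first exact: exprn_ge0.
  by apply: ler_wiXn2l => //; rewrite leq_addr.
by rewrite sumr_const card_ord -[leLHS]mulr_natl mulrA.
Qed.

(** Write L = - b 0 + P + r, with P the polynomial part and r the given error. Three errors remain:
    exp r - 1, the Taylor remainder of exp P, and the terms of [exp_poly n b] of degree above n. *)
Lemma exp_expansion n (K C : R) : exists C', forall (e L : R) (b : nat -> R),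
  0 <= e -> e <= 1 -> (forall j, (j <= n)%N -> `|b j| <= K) ->
  `|L + \sum_(j < n.+1) b j * e ^+ j| <= C * e ^+ n.+1 ->
  `|expR L - \sum_(k < n.+1) expR (- b 0) * (exp_poly n b)`_k * e ^+ k| <= C' * e ^+ n.+1.
Proof.
have [D [Cq hq]] := exp_poly_bounded n K.
pose K1 := n%:R * `|K|.
exists (expR K * (expR K1 * (C * expR C) + K1 ^+ n.+1 * expR K1 + D%:R * `|Cq|)).
move=> e L b e0 e1 bK hL.
have [sD hC] := hq b bK.
set r := L + _ in hL; set P := (tail_poly n b).[e] * e.
have K0 : 0 <= K by apply: le_trans (bK 0 _).
have K10 : 0 <= K1 by rewrite mulr_ge0.
have LE : L = - b 0 + (P + r).
  rewrite /r big_ord_recl expr0 mulr1 /P horner_poly mulr_suml.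
  have -> : \sum_(i < n) - b i.+1 * e ^+ i * e = - \sum_(i < n) b (lift ord0 i) * e ^+ lift ord0 i.
    by rewrite -sumrN; apply: eq_bigr => i _; rewrite lift0 exprSr mulNr mulNr mulrA.
  ring.
have Pe : `|P| <= K1 * e.
  rewrite normrM (ger0_norm e0) ler_wpM2r// horner_poly (le_trans (ler_norm_sum _ _ _))//.
  apply: (@le_trans _ _ (\sum_(i < n) `|K|)).
    apply: ler_sum => i _; rewrite normrM normrN (ger0_norm (exprn_ge0 _ e0)) -[leRHS]mulr1.
    by rewrite ler_pM ?exprn_ge0// ?exprn_ile1// (le_trans (bK _ _))// ler_norm.
  by rewrite sumr_const card_ord -mulr_natl.
have PK : `|P| <= K1 by rewrite (le_trans Pe)// ler_piMr.
(* The sign of C is recovered from [hL], except when the power of e vanishes. *)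
have C0 : 0 <= C \/ e ^+ n.+1 = 0.
  have := le_trans (normr_ge0 _) hL.
  have := exprn_ge0 n.+1 e0; rewrite le_eqVlt => /predU1P[<-|en]; first by right.
  by rewrite pmulr_lge0//; left.
have rC : `|r| <= C * e ^+ n.+1 by [].
have er : `|expR r - 1| <= C * expR C * e ^+ n.+1.
  have := expR_taylor_le 1 r; rewrite big_ord1 expr0 fact0 divr1 expr1 => h.
  apply: le_trans h _; case: C0 => [C0|en]; last first.
    by move: rC; rewrite en !mulr0 normr_le0 => /eqP ->; rewrite normr0 mul0r.
  rewrite mulrAC ler_pM ?expR_ge0// ler_expR (le_trans rC)//.
  by rewrite ler_piMr// exprn_ile1.
have qE : (exp_poly n b).[e] = \sum_(i < n.+1) P ^+ i / i`!%:R.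
  rewrite /exp_poly horner_sum; apply: eq_bigr => i _.
  by rewrite hornerZ hornerM horner_exp hornerXn -exprMn mulrC.
have eb : expR (- b 0) <= expR K.
  by rewrite ler_expR (le_trans (ler_norm _))// normrN bK.
have -> : expR L - \sum_(k < n.+1) expR (- b 0) * (exp_poly n b)`_k * e ^+ k =
  expR (- b 0) * (expR P * (expR r - 1) + (expR P - \sum_(i < n.+1) P ^+ i / i`!%:R)
    + ((exp_poly n b).[e] - \sum_(k < n.+1) (exp_poly n b)`_k * e ^+ k)).
  rewrite {1}LE !expRD qE.
  have -> : \sum_(k < n.+1) expR (- b 0) * (exp_poly n b)`_k * e ^+ k =
      expR (- b 0) * \sum_(k < n.+1) (exp_poly n b)`_k * e ^+ k.
    by rewrite mulr_sumr; apply: eq_bigr => k _; rewrite mulrA.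
  ring.
rewrite normrM (ger0_norm (expR_ge0 _)) -[leRHS]mulrA.
apply: ler_pM; rewrite ?expR_ge0//.
rewrite [leRHS]mulrDl [X in _ <= X + _]mulrDl.
rewrite (le_trans (ler_normD _ _))// lerD//.
  rewrite (le_trans (ler_normD _ _))// lerD//.
    rewrite normrM (ger0_norm (expR_ge0 _)) -[leRHS]mulrA.
    apply: ler_pM; rewrite ?expR_ge0//.
    by rewrite ler_expR (le_trans (ler_norm _)).
  apply: le_trans (expR_taylor_le _ _) _.
  rewrite [leRHS]mulrAC; apply: ler_pM; rewrite ?exprn_ge0 ?expR_ge0 ?ler_expR//.
  by rewrite -exprMn lerXn2r ?nnegrE// mulr_ge0.
apply: poly_truncation_le => // k.
exact: le_trans (hC _) (ler_norm _).
Qed.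

End ExpExpansion.

(** * The flow in tau *)

Section Core.
Variable R : realType.

(** The coefficient of N^(-j) in - ln Lambda(1): the factor N t / 2 brings order j + 1 of E[Z^2]
    down to order j. *)
Definition beta (s : nat -> R) j : R :=
  \int[lebesgue_measure]_(t in `[0, 1]) (t / 2 * zcoef t s 2 j.+1).

Definition expansion_coef (s : nat -> R) n k : R :=
  expR (- beta s 0) * (exp_poly n (beta s))`_k.

Lemma beta_primitive (s : nat -> R) (G : R -> R) j : 0 <= s 2 ->
  (forall t : R, 0 <= t <= 1 -> is_derive t (1 : R) G (t / 2 * zcoef t s 2 j.+1)) ->
  beta s j = G 1 - G 0.
Proof.
move=> s2 dG; apply: Rintegral_primitive => //.
apply: continuous_subspaceT => t.
have [c _] := niceM (niceM (@nice_tau R) (nice_cst (2^-1 : R))) (nice_zcoef R 2 j.+1).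
exact: c s s2 t.
Qed.

Lemma beta_exists_primitive (s : nat -> R) j : 0 <= s 2 ->
  exists G : R -> R, forall t : R, 0 <= t <= 1 ->
    is_derive t (1 : R) G (t / 2 * zcoef t s 2 j.+1).
Proof.
move=> s2.
have [c _] := niceM (niceM (@nice_tau R) (nice_cst (2^-1 : R))) (nice_zcoef R 2 j.+1).
have [G dG] := primitive_exists (c s s2).
by exists G => t /andP[t0 t1]; apply: dG; rewrite (lt_le_trans _ t0) ?ltrN10// (le_lt_trans t1)// ltr1n.
Qed.

Lemma beta_bounded j : exists K, forall s : nat -> R, 0 <= s 2 ->
  (forall l, `|s l| <= 1) -> `|beta s j| <= K.
Proof.
have [_ [K hK]] := niceM (niceM (@nice_tau R) (nice_cst (2^-1 : R))) (nice_zcoef R 2 j.+1).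
exists K => s s2 sl; have [G dG] := beta_exists_primitive j s2.
rewrite (beta_primitive s2 dG).
have := @mvt_bound R G _ 0 1 K ler01 dG.
rewrite subr0 mulr1; apply=> t t01; exact: hK t s t01 s2 sl.
Qed.

Lemma beta0E (s : nat -> R) : 0 <= s 2 -> beta s 0 = ln (1 + s 2) / 2.
Proof.
move=> s2; rewrite (beta_primitive s2 (fun t _ => is_derive_coef0 s2 t)).
by rewrite /A2s expr1n mul1r expr0n mul0r addr0 ln1 mul0r subr0.
Qed.

Lemma beta1E (s : nat -> R) : 0 <= s 2 -> beta s 1 = - log_coef1 s 1.
Proof.
move=> s2; rewrite (beta_primitive s2 (fun t _ => is_derive_coef1 s2 t)).
suff -> : log_coef1 s 0 = 0 by rewrite oppr0 subr0.
by rewrite /log_coef1 /A2s /A3s /A4s !expr0n /= !(mul0r, mulr0) !addr0 !expr1n; field.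
Qed.

Section Sphere.
Variables (n : nat) (mu : probability (borel_mx R n.+1) R).
Hypothesis haar : is_haar mu.
Variable y : 'I_n.+1 -> R.
Hypothesis y_le : forall i, `|y i| <= 2 / 3.
Hypothesis y_sum : \sum_i y i = 0.

Let N : R := n.+1%:R.
Let T t := Tm mu (hweight y t) (N * t / 2).

Lemma is_derive_tilt_mass (t : R) : 0 <= t <= 1 ->
  is_derive t (1 : R) (fun u => T u (fun=> 1) 0)
    (N / 2 * Ex mu (fun U => qform (fun i => hweight y t i * (1 - t * hweight y t i)) U
                       * expR (N * t / 2 * qform (hweight y t) U))).
Proof.
move=> t01.
pose c u i := N / 2 * (u * hweight y u i).
have cE u U : N * u / 2 * qform (hweight y u) U = qform (c u) U.
  by rewrite /qform mulr_sumr; apply: eq_bigr => i _; rewrite /c; field.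
pose c' i := N / 2 * (hweight y t i * (1 - t * hweight y t i)).
have b0 i : 1 / 3 <= 1 + t * y i by exact: hden_ge.
(* For |h| <= 1/4 the shifted denominators stay above 1/3 - (1/4)(2/3) = 1/6, whence (N/2)(4/9) /
   ((1/6)(1/9)) = 12 N. It only serves differentiability, so it may depend on N. *)
pose C := 12 * N.
have cc h i : `|h| <= 1 / 4 -> `|c (t + h) i - c t i - h * c' i| <= C * h ^+ 2.
  move=> h4; have := b0 i; have := y_le i; rewrite ler_norml => /andP[y1 y2] b1.
  have b2 : 1 / 6 <= 1 + (t + h) * y i.
    have : `|h * y i| <= 1 / 4 * (2 / 3) by rewrite normrM ler_pM.
    rewrite ler_norml => /andP[? ?]; lra.
  have -> : c (t + h) i - c t i - h * c' i =
      - (N / 2 * y i ^+ 2) / ((1 + (t + h) * y i) * (1 + t * y i) ^+ 2) * h ^+ 2.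
    by rewrite /c /c' /hweight; field; rewrite !gt_eqF//; lra.
  rewrite normrM (ger0_norm (sqr_ge0 h)) ler_wpM2r ?sqr_ge0//.
  have d0 : 1 / 54 <= (1 + (t + h) * y i) * (1 + t * y i) ^+ 2.
    have q2 : 1 / 9 <= (1 + t * y i) ^+ 2 by rewrite expr2; nra.
    by apply: (@le_trans _ _ (1 / 6 * (1 / 9))); [lra|apply: ler_pM => //; lra].
  rewrite normrM normfV normrN [X in _ / X]ger0_norm; last lra.
  rewrite ler_pdivrMr; last lra.
  have N0 : 0 < N by exact: ltr0Sn.
  have N2 : 0 <= N / 2 by rewrite divr_ge0 ?ltW.
  have y4 : y i ^+ 2 <= 4 / 9 by rewrite expr2; nra.
  rewrite ger0_norm; last by rewrite mulr_ge0 ?sqr_ge0.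
  apply: (@le_trans _ _ (N / 2 * (4 / 9))); first by rewrite ler_wpM2l.
  by rewrite /C; nra.
have bq k : bmeas (qform (R := R) (n := n) k) by exact: bmeas_qform.
have [_ [A hA]] := bq (c t); have [_ [B hB]] := bq c'.
have TE u : T u (fun=> 1) 0 = Ex mu (fun U => expR (qform (c u) U)).
  by apply: eq_Ex => U OU; rewrite /tilt qform1// expr0 !mul1r cE.
have DE : N / 2 * Ex mu (fun U => qform (fun i => hweight y t i * (1 - t * hweight y t i)) U
                       * expR (N * t / 2 * qform (hweight y t) U)) =
    Ex mu (fun U => qform c' U * expR (qform (c t) U)).
  rewrite -ExZ; last by apply: bmeasM => //; apply: bmeas_expR; under eq_fun do rewrite cE.
  apply: eq_Ex => U _; rewrite cE mulrA; congr (_ * _).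
  by rewrite /qform mulr_sumr; apply: eq_bigr => i _; rewrite /c'; ring.
rewrite DE.
apply: (@quadratic_is_derive _ _ _ _ (expR A * (C + (B + C) ^+ 2 * expR (B + C))) (1 / 4)).
  lra.
move=> h h4; rewrite !TE.
have be u : bmeas (fun U => expR (qform (c u) U)) by exact: bmeas_expR.
have -> : Ex mu (fun U => expR (qform (c (t + h)) U)) - Ex mu (fun U => expR (qform (c t) U))
    - h * Ex mu (fun U => qform c' U * expR (qform (c t) U)) =
  Ex mu (fun U => expR (qform (c (t + h)) U) + (-1) * expR (qform (c t) U)
     + (- h) * (qform c' U * expR (qform (c t) U))).
  rewrite ExD ?ExD ?ExZ//; first by rewrite mulN1r mulNr.
  - exact: bmeasM.
  - by apply: bmeasM; [exact: bmeas_cst|].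
  - by apply: bmeasD => //; apply: bmeasM; [exact: bmeas_cst|].
  - by apply: bmeasM; [exact: bmeas_cst|exact: bmeasM].
apply: norm_Ex_le => //.
  apply: bmeasD; first by apply: bmeasD => //; apply: bmeasM; [exact: bmeas_cst|].
  by apply: bmeasM; [exact: bmeas_cst|exact: bmeasM].
move=> U OU.
have hcl : `|qform (c (t + h)) U - qform (c t) U - h * qform c' U| <= C * h ^+ 2.
  have -> : qform (c (t + h)) U - qform (c t) U - h * qform c' U =
     qform (fun i => c (t + h) i - c t i - h * c' i) U.
    by rewrite /qform mulr_sumr -!sumrB; apply: eq_bigr => i _; ring.
  by apply: qform_norm_le => // i; exact: cc.
have h1 : `|h| <= 1 by apply: le_trans h4 _; lra.
have := expR_perturb_le h1 (hA U OU) (hB U OU) hcl.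
by rewrite [_ + (_ - _)]addrC subrK mulN1r mulNr.
Qed.

(* ln Lambda(t) *)
Definition log_ratio t : R := ln (T t (fun=> 1) 0) - (\sum_i ln (1 + t * y i)) / 2.

Lemma is_derive_log_ratio (t : R) : 0 <= t <= 1 ->
  is_derive t (1 : R) log_ratio (- (N * t / 2) * zmom mu y t 2).
Proof.
move=> t01.
have b0 i : 0 < 1 + t * y i by apply: lt_le_trans (hden_ge y_le t01 i); lra.
have T0 : 0 < T t (fun=> 1) 0 by exact: Tm1_gt0.
have d1 := @is_derive_point_ln R (fun u => T u (fun=> 1) 0) t _ T0 (is_derive_tilt_mass t01).
have d2 : is_derive t (1 : R) (fun u => \sum_i ln (1 + u * y i)) (\sum_i hweight y t i).
  apply: is_derive_sumr => i.
  have dl : is_derive t (1 : R) (fun u => 1 + u * y i) (y i).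
    refine (is_derive_ext (is_derive_pointD (is_derive_cst (1 : R) t 1)
      (is_derive_monomial 0 (y i) t)) _ _); last by rewrite expr0; ring.
    by move=> u; rewrite /cst expr1 mulrC.
  exact: (@is_derive_point_ln R (fun u => 1 + u * y i) t (y i) (b0 i) dl).
have d3 := is_derive_pointM (is_derive_cst (- 2^-1 : R) t 1) d2.
refine (is_derive_ext (is_derive_pointD d1 d3) _ _).
  by move=> u; rewrite /log_ratio /cst mulNr mulrC.
(* The derivative of t D_i is D_i (1 - t D_i), so the equation for phi = D and k = 0 applies; its
   source sum_i D_i cancels the derivative of the logarithms. *)
have h := Tm_sd haar y t (hweight y t) 0.
have E : Ex mu (fun U => qform (fun i => hweight y t i * (1 - t * hweight y t i)) U
                       * expR (N * t / 2 * qform (hweight y t) U)) =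
    N^-1 * (\sum_i hweight y t i) * T t (fun=> 1) 0 - t * T t (fun=> 1) 2.
  rewrite /T -h mulr0 !mul0r addr0 -TmD addrK.
  by apply: eq_Ex => U _; rewrite /tilt expr0 mulr1.
rewrite E /zmom -/N -/(T t) /cst mul0r add0r.
have N0 : N != 0 by rewrite pnatr_eq0.
move: T0 N0; rewrite -/(T t); move: (T t _ 0) (T t _ 2) (\sum_i _) (N) => a b c d a0 d0.
by field; rewrite d0 lt0r_neq0.
Qed.

End Sphere.

(** The mean value inequality is applied to ln Lambda plus primitives of the truncated coefficients,
    a function of tau with uniformly small derivative. Thus only the explicit coefficients are ever
    integrated in tau. *)
Lemma core_expansion n : exists C, forall m (mu : probability (borel_mx R m.+1) R)
    (y : 'I_m.+1 -> R),
  is_haar mu -> (forall i, `|y i| <= 2 / 3) -> \sum_i y i = 0 ->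
  `|Ex mu (fun U => expR (m.+1%:R / 2 * qform (fun i => y i / (1 + y i)) U))
    * expR (- (\sum_i ln (1 + y i)) / 2)
    - \sum_(k < n.+1) expansion_coef (psum y) n k / m.+1%:R ^+ k|
  <= C / m.+1%:R ^+ n.+1.
Proof.
(* Order n + 2, because the factor N t / 2 loses one. *)
have [C hC] := (remainder_bigO R n.+2 2).1.
have [K hK] : exists K, forall s : nat -> R, 0 <= s 2 -> (forall l, `|s l| <= 1) ->
    forall j, (j <= n)%N -> `|beta s j| <= K.
  elim: {hC} n => [|p [K hK]].
    have [K hK] := beta_bounded 0; exists K => s s2 sl j.
    by rewrite leqn0 => /eqP ->; exact: hK.
  have [K' hK'] := beta_bounded p.+1; exists (Num.max K K') => s s2 sl j.
  rewrite leq_eqVlt ltnS le_max => /predU1P[->|jp].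
    by rewrite hK' ?orbT.
  by rewrite hK.
have [C' hC'] := exp_expansion n K (C / 2).
exists C' => m mu y haar y_le y_sum.
set N : R := m.+1%:R; set s := psum y.
have N0 : 0 < N by exact: ltr0Sn.
have sys (t : R) (t01 : 0 <= t <= 1) : sd_system N^-1 t s (Vmom mu y t) (zmom mu y t).
  exact: tilted_sd_system.
have s01 : 0 <= (0 : R) <= 1 by rewrite lexx ler01.
have s2 : 0 <= s 2 by exact: sd_s2 (sys 0 s01).
have sl l : `|s l| <= 1 by exact: sd_s_le1 (sys 0 s01) l.
have [G dG] : exists G : nat -> R -> R, forall j (t : R), 0 <= t <= 1 ->
    is_derive t (1 : R) (G j) (t / 2 * zcoef t s 2 j.+1).
  have [G dG] := @boolp.choice nat (R -> R) (fun j G => forall t : R, 0 <= t <= 1 ->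
    is_derive t (1 : R) G (t / 2 * zcoef t s 2 j.+1)) (fun j => beta_exists_primitive j s2).
  by exists G.
pose F t := log_ratio mu y t + \sum_(j < n.+1) N^-1 ^+ j * G j t.
have dF (t : R) : 0 <= t <= 1 -> is_derive t (1 : R) F
    (- (N * t / 2) * zmom mu y t 2
     + \sum_(j < n.+1) N^-1 ^+ j * (t / 2 * zcoef t s 2 j.+1)).
  move=> t01; apply: is_derive_pointD; first exact: is_derive_log_ratio.
  apply: is_derive_sumr => j.
  refine (is_derive_ext (is_derive_pointM (is_derive_cst (N^-1 ^+ j : R) t 1) (dG j t t01)) _ _) => //.
  by rewrite mul0r add0r.
have dFb (t : R) : 0 <= t <= 1 -> `|- (N * t / 2) * zmom mu y t 2
     + \sum_(j < n.+1) N^-1 ^+ j * (t / 2 * zcoef t s 2 j.+1)| <= C / 2 * N^-1 ^+ n.+1.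
  move=> t01; have := hC (SdInstance (sys t t01)).
  (* E[Z^2] has no term of order 0, so multiplication by N creates no positive power of N. *)
  rewrite /zrem /= big_ord_recl zcoef_vanish// mul0r add0r => h.
  have -> : - (N * t / 2) * zmom mu y t 2
     + \sum_(j < n.+1) N^-1 ^+ j * (t / 2 * zcoef t s 2 j.+1) =
     - (t / 2) * (N * (zmom mu y t 2 - \sum_(i < n.+1) zcoef t s 2 (bump 0 i) * N^-1 ^+ bump 0 i)).
    rewrite !mulrBr mulr_sumr mulr_sumr -sumrN; congr (_ + _); first by ring.
    apply: eq_bigr => j _; rewrite /bump add1n exprS; field.
    exact: lt0r_neq0.
  have C0 : 0 <= C.
    have := le_trans (normr_ge0 _) h.
    by rewrite pmulr_lge0// exprn_gt0// invr_gt0.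
  rewrite normrM normrM (gtr0_norm N0).
  have t2 : `|- (t / 2)| <= 1 / 2.
    by case/andP: t01 => t0 t1; rewrite normrN ger0_norm; lra.
  have -> : C / 2 * N^-1 ^+ n.+1 = 1 / 2 * (N * (C * N^-1 ^+ n.+2)).
    by rewrite [N^-1 ^+ n.+2]exprS; field; exact: lt0r_neq0.
  by apply: ler_pM => //; [rewrite mulr_ge0// ltW|rewrite ler_wpM2l// ltW].
have := mvt_bound ler01 dF dFb.
rewrite subr0 mulr1 /F.
have -> : log_ratio mu y 0 = 0.
  rewrite /log_ratio big1 => [|i _]; last by rewrite mul0r addr0 ln1.
  rewrite mul0r subr0 (_ : Tm _ _ _ _ _ = 1) ?ln1//.
  rewrite -[RHS](Ex_cst haar 1); apply: eq_Ex => U OU.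
  by rewrite /tilt qform1// mulr0 !mul0r expR0 expr0 !mulr1.
rewrite add0r -addrA -sumrB.
have -> : \sum_(j < n.+1) (N^-1 ^+ j * G j 1 - N^-1 ^+ j * G j 0) =
    \sum_(j < n.+1) beta s j * N^-1 ^+ j.
  by apply: eq_bigr => j _; rewrite (beta_primitive s2 (dG j)); ring.
move=> hL.
have Ninv1 : N^-1 <= 1 by rewrite invf_le1// ler1n.
have Ninv0 : 0 <= N^-1 by rewrite invr_ge0 ltW.
have := hC' N^-1 _ (beta s) Ninv0 Ninv1 (fun j => hK s s2 sl j) hL.
rewrite exprVn -/(expansion_coef s n _).
under eq_bigr do rewrite exprVn.
have -> : expR (log_ratio mu y 1) =
  Ex mu (fun U => expR (N / 2 * qform (fun i => y i / (1 + y i)) U))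
    * expR (- (\sum_i ln (1 + y i)) / 2).
  rewrite /log_ratio expRD lnK; last by rewrite posrE; apply: Tm1_gt0; rewrite // lexx ler01.
  congr (_ * expR _); last by rewrite -mulNr; under eq_bigr do rewrite mul1r.
  have <- : hweight y 1 = (fun i => y i / (1 + y i)).
    by apply/funext => i; rewrite /hweight mul1r.
  by apply: eq_Ex => U OU; rewrite /tilt qform1// expr0 !mul1r mulr1.
exact.
Qed.

End Core.

(** * Real symmetric matrices *)

Section SpectralTheorem.
Variable R : realType.

(** Over the complex numbers B is Hermitian, so its spectral diagonal is real; the root of the
    characteristic polynomial descends to R. *)
Lemma symmetric_real_eigenvalue n (B : 'M[R]_n.+1) : B^T = B ->
  exists a, eigenvalue B a.
Proof.
move=> Bsym.
pose C : numClosedFieldType := complex.complex R.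
pose f : {rmorphism R -> C} := complex.real_complex R.
have fr x : f x \is Num.real by apply/complex.complex_realP; exists x.
pose A : 'M[C]_n.+1 := map_mx f B.
have Areal : A \is a mxOver Num.real.
  by apply/mxOverP => i j; rewrite mxE.
have Asym : A \is symmetricmx.
  by apply/is_hermitianmxP; rewrite expr0 scale1r map_mx_id// map_trmx Bsym.
have Aherm := realsym_hermsym Asym Areal.
have /mxOverP/(_ ord0 ord0)/complex.complex_realP[a ha] := hermitian_spectral_diag_real Aherm.
have /orthomx_spectralP AE := hermitian_normalmx Aherm.
exists a; rewrite eigenvalue_root_char -(fmorph_root f) map_char_poly -/A.
rewrite -eigenvalue_root_char; apply/eigenvalueP.
exists (row ord0 (spectralmx A)).
  rewrite -row_mul {2}AE -mulmxA mulKVmx ?spectral_unit// mul_diag_mx.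
  by apply/rowP => j; rewrite !mxE ha.
by apply/negP => /eqP r0; have := row_free_unit (spectralmx A);
  rewrite spectral_unit => /row_freeP[X hX]; have := congr1 (row ord0) hX;
  rewrite row_mul r0 mul0mx => /rowP/(_ ord0); rewrite !mxE => /eqP;
  rewrite eq_sym oner_eq0.
Qed.

Lemma row_dotE n (w : 'rV[R]_n) : (w *m w^T) ord0 ord0 = \sum_k w ord0 k ^+ 2.
Proof. by rewrite mxE; apply: eq_bigr => k _; rewrite [in LHS]mxE expr2. Qed.

Lemma row_dot_eq0 n (w : 'rV[R]_n) : (w *m w^T) ord0 ord0 = 0 -> w = 0.
Proof.
rewrite row_dotE => /eqP; rewrite psumr_eq0 => [/allP h|k _]; last exact: sqr_ge0.
apply/rowP => k; have := h k (mem_index_enum k).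
by rewrite /= sqrf_eq0 mxE => /eqP.
Qed.

(* The Householder reflection exchanging v and the first basis vector. *)
Lemma unit_row_reflection n (v : 'rV[R]_n.+1) : v *m v^T = 1%:M ->
  exists H : 'M[R]_n.+1, [/\ H^T = H, H *m H = 1%:M & row ord0 H = v].
Proof.
move=> v1; pose e : 'rV[R]_n.+1 := delta_mx ord0 ord0.
have [ev|ev] := eqVneq v e.
  by exists 1%:M; rewrite trmx1 mul1mx; split=> //; rewrite ev row1.
pose w := e - v; pose d := (w *m w^T) ord0 ord0.
have e1 : e *m e^T = 1%:M.
  by apply/matrixP => i j; rewrite !ord1 trmx_delta mul_delta_mx !mxE !eqxx.
have wd : w *m w^T = d%:M by rewrite [LHS]mx11_scalar.
have d0 : d != 0.
  apply: contra ev => /eqP d0; rewrite eq_sym -subr_eq0.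
  by apply/eqP/row_dot_eq0.
have ew : e *m w^T = (d / 2)%:M.
  have vT : v *m e^T = e *m v^T.
    by rewrite -[LHS]trmxK trmx_mul trmxK [LHS]mx11_scalar [RHS]mx11_scalar !mxE.
  have : w *m w^T = 2 *: (e *m w^T).
    rewrite /w linearB /= mulmxBl !mulmxBr e1 v1 vT.
    by move: (e *m v^T) => X; apply/matrixP => i j; rewrite !mxE; ring.
  rewrite wd => h; apply/matrixP => i j; rewrite !ord1.
  have := congr1 (fun X : 'M[R]_1 => X ord0 ord0) h.
  by rewrite !mxE eqxx mulr1n => ->; rewrite mulrC mulKf ?pnatr_eq0.
exists (1%:M - (2 / d) *: (w^T *m w)).
split.
- by rewrite linearB /= linearZ /= trmx1 trmx_mul trmxK.
- have PP : (w^T *m w) *m (w^T *m w) = d *: (w^T *m w).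
    by rewrite -mulmxA (mulmxA w) wd mul_scalar_mx -scalemxAr.
  move: (w^T *m w) PP => P PP; set c := 2 / d.
  have cP : (c *: P) *m (c *: P) = (c * c * d) *: P.
    by rewrite -scalemxAl -scalemxAr PP !scalerA mulrA.
  rewrite mulmxBl !mulmxBr !mul1mx !mulmx1 cP.
  apply/matrixP => i j; rewrite !mxE; move: (P i j) => p.
  by rewrite /c; field.
- rewrite rowE mulmxBr mulmx1 -scalemxAr mulmxA ew mul_scalar_mx scalerA.
  have -> : 2 / d * (d / 2) = 1 by field.
  by rewrite scale1r /w subKr.
Qed.

(** Deflation: conjugation by the reflection taking a unit eigenvector to the first basis vector
    splits off a block of size 1, and the other block is again symmetric. This keeps the change of
    basis real, where complex diagonalisation gives a unitary one. *)
Lemma real_spectral n (B : 'M[R]_n) : B^T = B ->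
  exists (O : 'M[R]_n) (d : 'rV[R]_n), O^T *m O = 1%:M /\ B = O^T *m diag_mx d *m O.
Proof.
elim: n B => [|n IHn] B Bsym.
  by exists 1%:M, 0; split; apply/matrixP => -[].
have [a /eigenvalueP[u uB u0]] := symmetric_real_eigenvalue Bsym.
pose q := (u *m u^T) ord0 ord0.
have q0 : 0 < q.
  rewrite lt_neqAle /q; apply/andP; split.
    by apply: contra u0 => /eqP/esym/row_dot_eq0 ->.
  by rewrite row_dotE sumr_ge0// => k _; exact: sqr_ge0.
pose v := (Num.sqrt q)^-1 *: u.
have v1 : v *m v^T = 1%:M.
  rewrite /v linearZ /= -scalemxAl -scalemxAr scalerA [u *m _]mx11_scalar -/q.
  by rewrite scale_scalar_mx -expr2 exprVn sqr_sqrtr ?ltW// mulVf ?gt_eqF.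
have vB : v *m B = a *: v by rewrite /v -scalemxAl uB !scalerA mulrC.
have [H [HT HH Hv]] := unit_row_reflection v1.
pose C : 'M[R]_(1 + n) := H *m B *m H.
have CT : C^T = C by rewrite /C !trmx_mul HT Bsym mulmxA.
have C0 : row ord0 C = a *: delta_mx ord0 ord0.
  rewrite /C !row_mul Hv vB -scalemxAl -{1}Hv -row_mul HH row1.
  by [].
have Cur : ursubmx C = 0.
  apply/matrixP => i j; rewrite !mxE ord1.
  have := congr1 (fun X : 'rV[R]_(1 + n) => X ord0 (rshift 1 j)) C0.
  by rewrite !mxE /= (_ : lshift n 0 = ord0) ?mulr0//; exact: val_inj.
have Cul : ulsubmx C = a%:M.
  apply/matrixP => i j; rewrite !mxE !ord1.
  have := congr1 (fun X : 'rV[R]_(1 + n) => X ord0 (lshift n 0)) C0.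
  rewrite !mxE (_ : lshift n 0 = ord0); last exact: val_inj.
  by rewrite !eqxx mulr1 mulr1n.
have Cdl : dlsubmx C = 0.
  by rewrite -[C]CT -trmx_ursub Cur trmx0.
have Cdr : (drsubmx C)^T = drsubmx C by rewrite trmx_drsub CT.
have [Q [dq [QQ hd]]] := IHn _ Cdr.
pose K : 'M[R]_(1 + n) := block_mx 1%:M 0 0 Q.
exists (K *m H), (row_mx a%:M dq).
have KK : K^T *m K = 1%:M.
  rewrite /K tr_block_mx mulmx_block !trmx0 !trmx1 !(mul0mx, mulmx0, mul1mx, addr0, add0r) QQ.
  by rewrite -scalar_mx_block.
split.
  by rewrite trmx_mul HT mulmxA -(mulmxA H) KK mulmx1 HH.
have CE : C = K^T *m diag_mx (row_mx a%:M dq) *m K.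
  rewrite -[LHS]submxK Cul Cur Cdl hd /K tr_block_mx !trmx0 trmx1 diag_mx_row.
  rewrite !mulmx_block !(mul0mx, mulmx0, mul1mx, mulmx1, addr0, add0r).
  by congr block_mx; apply/matrixP => i j; rewrite !ord1 !mxE eqxx.
by rewrite trmx_mul HT -!mulmxA (mulmxA K^T) (mulmxA _ K) -CE /C !mulmxA HH mul1mx -mulmxA HH mulmx1.
Qed.

End SpectralTheorem.

(** * The multiset of eigenvalues *)

Section Eigenvalues.
Variable R : realType.

Lemma lt_bigmin_seq (x0 z : R) (r : seq R) :
  (z < \big[Num.min/x0]_(x <- r) x) = (z < x0) && all (fun x => z < x) r.
Proof.
elim: r => [|x r IHr]; first by rewrite big_nil andbT.
by rewrite big_cons lt_min IHr /= andbCA.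
Qed.

Lemma bigmax_lt_seq (x0 z : R) (r : seq R) :
  (\big[Num.max/x0]_(x <- r) x < z) = (x0 < z) && all (fun x => x < z) r.
Proof.
elim: r => [|x r IHr]; first by rewrite big_nil andbT.
by rewrite big_cons gt_max IHr /= andbCA.
Qed.

(** Only the multiset is determined, by unique factorisation of the characteristic polynomial. *)
Lemma perm_eigenvalues n (B O : 'M[R]_n) (d : 'rV[R]_n) :
  O^T *m O = 1%:M -> B = O^T *m diag_mx d *m O ->
  perm_eq (eigenvalues B) [seq d ord0 i | i <- enum 'I_n].
Proof.
move=> OO BE.
have cB : char_poly B = \prod_(i < n) ('X - (d ord0 i)%:P).
  transitivity (char_poly (diag_mx d)); last first.
    rewrite char_poly_trig; last exact: diag_mx_is_trig.
    by apply: eq_bigr => i _; rewrite !mxE eqxx mulr1n.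
  have PP : map_mx polyC O^T *m map_mx polyC O = 1%:M.
    by rewrite -map_mxM OO map_mx1.
  have -> : char_poly B = \det (map_mx polyC O^T *m char_poly_mx (diag_mx d) *m map_mx polyC O).
    rewrite /char_poly /char_poly_mx; congr (\det _).
    rewrite mulmxBr mulmxBl BE !map_mxM /=; congr (_ - _).
    by rewrite mul_mx_scalar -scalemxAl PP scalemx1.
  by rewrite !det_mulmx mulrC mulrA -det_mulmx (mulmx1C PP) det1 mul1r.
apply: prod_XsubC_eq; rewrite big_map big_enum -cB.
(* An explicit splitting rules out the default value of [eigenvalues]. *)
have [t ht] : exists t : n.-tuple R, char_poly B = \prod_(x <- t) ('X - x%:P).
  by exists [tuple d ord0 i | i < n]; rewrite cB big_tuple; apply: eq_bigr => i _; rewrite tnth_mktuple.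
by rewrite /eigenvalues; case: xgetP => [s _ //|/(_ t)].
Qed.

Lemma opnorm_ge n (B : 'M[R]_n) x : x \in (eigenvalues B : seq R) -> `|x| <= opnorm B.
Proof.
by move=> xB; rewrite /opnorm (unstable.le_bigmax_seq _ x).
Qed.

Lemma hilbert_domP n (B : 'M[R]_n.+1) (z : R) : hilbert_dom B z <->
  (forall x, x \in (eigenvalues B : seq R) -> z < x) \/
  (forall x, x \in (eigenvalues B : seq R) -> x < z).
Proof.
have th : thead (eigenvalues B) \in (eigenvalues B : seq R).
  by rewrite /thead mem_tnth.
rewrite /hilbert_dom /= /setU /= !in_itv /= andbT /eig_min /eig_max lt_bigmin_seq bigmax_lt_seq.
split=> [[/andP[_ /allP h]|/andP[_ /allP h]]|[h|h]]; [left|right|left|right] => //.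
  by rewrite h//; apply/allP.
by rewrite h//; apply/allP.
Qed.

End Eigenvalues.

(** * The R-transform *)

(** The inequality ln (1 + x) <= x, used in both directions, gives (b - a)^2 / (a b), and 1 / (a b)
    <= 25/9 <= 3. *)
Lemma ln_taylor_le (R : realType) (a b : R) : 3 / 5 <= a -> 3 / 5 <= b ->
  `|ln b - ln a - (b - a) / a| <= 3 * (b - a) ^+ 2.
Proof.
move=> a35 b35.
have a0 : 0 < a by lra.
have b0 : 0 < b by lra.
have ub (x y : R) : 0 < x -> 0 < y -> ln y - ln x <= (y - x) / x.
  move=> x0 y0; rewrite -ln_div ?posrE//.
  have -> : y / x = 1 + (y - x) / x by field; rewrite gt_eqF.
  by apply: le_ln1Dx; rewrite ltr_pdivlMr//; lra.
have u1 := ub a b a0 b0; have u2 := ub b a b0 a0.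
rewrite ler0_norm ?subr_le0// opprB.
apply: (@le_trans _ _ ((b - a) / a - (b - a) / b)).
  have -> : (b - a) / b = - ((a - b) / b) by rewrite -mulNr opprB.
  lra.
have -> : (b - a) / a - (b - a) / b = (b - a) ^+ 2 / (a * b).
  by field; rewrite !gt_eqF.
rewrite ler_pdivrMr ?mulr_gt0// mulrAC ler_peMl ?sqr_ge0//.
have : 3 / 5 * (3 / 5) <= a * b by apply: ler_pM => //; lra.
lra.
Qed.

Lemma lipschitz_continuous (R : realType) (f : R -> R) (x C dl : R) : 0 < dl ->
  (forall h, `|h| <= dl -> `|f (x + h) - f x| <= C * `|h|) -> {for x, continuous f}.
Proof.
move=> dl0 fC.
have C0 : 0 <= C.
  have := fC dl; rewrite gtr0_norm// lexx => /(_ isT) h.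
  by have := le_trans (normr_ge0 _) h; rewrite pmulr_lge0.
apply/cvgrPdist_le => e e0; near=> t.
have td : `|t - x| <= dl.
  by rewrite distrC; near: t; apply: cvgr_dist_le => //; exact: cvg_id.
have te : `|t - x| <= e / (C + 1).
  by rewrite distrC; near: t; apply: cvgr_dist_le; [exact: cvg_id|rewrite divr_gt0// ltr_wpDl].
have := fC _ td; rewrite [x + _]addrC subrK distrC => h; apply: le_trans h _.
apply: le_trans (ler_wpM2l C0 te) _.
rewrite mulrA ler_pdivrMr; last by rewrite ltr_wpDl.
by rewrite mulrC ler_pM2l// lerDl.
Unshelve. all: by end_near. Qed.

Section RTransform.
Variables (R : realType) (n : nat) (B : 'M[R]_n.+1) (d : 'I_n.+1 -> R) (M : R).
Hypothesis d_perm : perm_eq (eigenvalues B) [seq d i | i <- enum 'I_n.+1].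
Hypothesis M0 : 0 < M.
Hypothesis d_le : forall i, `|d i| <= M.

Let N : R := n.+1%:R.
Let N0 : 0 < N. Proof. exact: ltr0Sn. Qed.

Lemma hilbertE z : hilbert B z = N^-1 * \sum_i (z - d i)^-1.
Proof. by rewrite /hilbert (perm_big _ d_perm) /= big_map big_enum. Qed.

Lemma hilbert_domE z : hilbert_dom B z <->
  (forall i, z < d i) \/ (forall i, d i < z).
Proof.
have mem x : (x \in (eigenvalues B : seq R)) = (x \in [seq d i | i <- enum 'I_n.+1]).
  exact: perm_mem.
have di i : d i \in [seq d i | i <- enum 'I_n.+1] by apply/map_f; rewrite mem_enum.
rewrite hilbert_domP; split=> -[h|h]; [left|right|left|right].
- by move=> i; apply: h; rewrite mem.
- by move=> i; apply: h; rewrite mem.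
- by move=> x; rewrite mem => /mapP[i _ ->].
- by move=> x; rewrite mem => /mapP[i _ ->].
Qed.

(* At s = 0, where hilbert_inv is junk, zeta extends continuously by 1. *)
Definition zeta (s : R) : R := if s == 0 then 1 else s * hilbert_inv B s.

Lemma avg_cst (c : R) : N^-1 * \sum_(i < n.+1) c = c.
Proof. by rewrite sumr_const card_ord -[c *+ _]mulr_natl mulKf// lt0r_neq0. Qed.

(** Intermediate values: as |s d_i| <= 1/5, all denominators are at most 1 at z = 4/5 and at least 1
    at z = 6/5. *)
Lemma exists_zeta s : `|s| * M <= 1 / 5 ->
  exists z, [/\ 4 / 5 <= z, z <= 6 / 5 & N^-1 * \sum_i (z - s * d i)^-1 = 1].
Proof.
move=> sM; have mu i : `|s * d i| <= 1 / 5.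
  by rewrite normrM (le_trans _ sM)// ler_wpM2l.
pose f z := N^-1 * \sum_i (z - s * d i)^-1.
have cf : {within `[4 / 5, 6 / 5], continuous f}.
  apply: continuous_in_subspaceT => z /[!inE]/= /[!in_itv]/= /andP[z1 _].
  apply: cvgM; first exact: cvg_cst.
  apply: cvg_bigsum => i; apply: cvgV.
    by have := mu i; rewrite ler_norml => /andP[? ?]; rewrite gt_eqF//; lra.
  by apply: cvgB; [exact: cvg_id|exact: cvg_cst].
have f1 : 1 <= f (4 / 5).
  rewrite -[leLHS]avg_cst ler_pM2l ?invr_gt0// ler_sum// => i _.
  have := mu i; rewrite ler_norml => /andP[m1 m2].
  by rewrite -[leLHS]invr1 lef_pV2 ?posrE; lra.
have f2 : f (6 / 5) <= 1.
  rewrite -[leRHS]avg_cst ler_pM2l ?invr_gt0// ler_sum// => i _.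
  have := mu i; rewrite ler_norml => /andP[m1 m2].
  by rewrite -[leRHS]invr1 lef_pV2 ?posrE; lra.
have ab : 4 / 5 <= 6 / 5 :> R by lra.
have [|z /[!in_itv]/= /andP[z1 z2] fz] := IVT (v := 1) ab cf.
  by rewrite ge_min f2 orbT /= le_max f1.
by exists z.
Qed.

(** [exists_zeta] places s in the image of [hilbert B], so [hilbert_inv B s] is a genuine preimage
    in [hilbert_dom B]. The side of the spectrum on which it lies is read off from the sign of s,
    making every denominator positive. *)
Lemma zeta_root s : `|s| * M <= 1 / 5 ->
  (forall i, 0 < zeta s - s * d i) /\ N^-1 * \sum_i (zeta s - s * d i)^-1 = 1.
Proof.
move=> sM; rewrite /zeta; have [->|s0] := eqVneq s 0.
  split=> [i|]; first by rewrite mul0r subr0.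
  by under eq_bigr do rewrite mul0r subr0 invr1; exact: avg_cst.
have mu i : `|s * d i| <= 1 / 5.
  by rewrite normrM (le_trans _ sM)// ler_wpM2l.
have [z [z1 z2 zE]] := exists_zeta sM.
have im : (hilbert B @` hilbert_dom B) s.
  exists (z / s).
    apply/hilbert_domE; have [sp|sn] := ltP 0 s; [right|left] => i.
      rewrite ltr_pdivlMr// mulrC.
      by have := mu i; rewrite ler_norml => /andP[? ?]; lra.
    have {}sn : s < 0 by rewrite lt_neqAle s0.
    rewrite ltr_ndivrMr// mulrC.
    by have := mu i; rewrite ler_norml => /andP[? ?]; lra.
  have sE : \sum_i (z / s - d i)^-1 = s * \sum_i (z - s * d i)^-1.
    rewrite mulr_sumr; apply: eq_bigr => i _.
    have -> : z / s - d i = (z - s * d i) / s by field.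
    by rewrite invf_div.
  by rewrite hilbertE sE mulrCA zE mulr1.
have hs : hilbert B (hilbert_inv B s) = s by apply: pinvK; rewrite inE.
have hd : hilbert_dom B (hilbert_inv B s).
  have := @surjpinv_image_sub _ _ (fun=> 0) (hilbert_dom B) (hilbert B @` hilbert_dom B) (hilbert B).
  by apply=> //; exists s.
set w := hilbert_inv B s in hs hd *.
have pos i : 0 < s * w - s * d i.
  rewrite -mulrBr; move: hd => /hilbert_domE[h|h].
    have sn : s < 0.
      rewrite -hs hilbertE pmulr_rlt0 ?invr_gt0//.
      rewrite (bigD1 ord0)//= ltr_wnDr ?invr_lt0 ?subr_lt0//.
      by apply: sumr_le0 => j _; rewrite invr_le0 subr_le0 ltW.
    by rewrite nmulr_rgt0// subr_lt0.
  have sp : 0 < s.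
    rewrite -hs hilbertE pmulr_rgt0 ?invr_gt0//.
    rewrite (bigD1 ord0)//= ltr_wpDr ?invr_gt0 ?subr_gt0//.
    by apply: sumr_ge0 => j _; rewrite invr_ge0 subr_ge0 ltW.
  by rewrite pmulr_rgt0// subr_gt0.
split=> //.
have : s^-1 * (hilbert B w) = 1 by rewrite hs mulVf.
rewrite hilbertE mulrCA mulr_sumr => h; rewrite -[RHS]h; congr (_ * _).
by apply: eq_bigr => i _; rewrite -mulrBr invfM.
Qed.

Lemma zeta_bounds s : `|s| * M <= 1 / 5 ->
  forall i, 3 / 5 <= zeta s - s * d i <= 7 / 5.
Proof.
move=> sM; have [pos avg] := zeta_root sM.
have mu i : `|s * d i| <= 1 / 5.
  by rewrite normrM (le_trans _ sM)// ler_wpM2l.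
have lo : 4 / 5 <= zeta s.
  rewrite leNgt; apply/negP => lt.
  suff : 1 < N^-1 * \sum_i (zeta s - s * d i)^-1 by rewrite avg ltxx.
  rewrite -[ltLHS]avg_cst ltr_pM2l ?invr_gt0//.
  apply: ltr_sum => [|i _]; first by apply/hasP; exists ord0; rewrite ?mem_index_enum.
  have := pos i; have := mu i; rewrite ler_norml => /andP[m1 m2] p.
  by rewrite -[ltLHS]invr1 ltf_pV2 ?posrE//; lra.
have hi : zeta s <= 6 / 5.
  rewrite leNgt; apply/negP => lt.
  suff : N^-1 * \sum_i (zeta s - s * d i)^-1 < 1 by rewrite avg ltxx.
  rewrite -[ltRHS]avg_cst ltr_pM2l ?invr_gt0//.
  apply: ltr_sum => [|i _]; first by apply/hasP; exists ord0; rewrite ?mem_index_enum.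
  have := pos i; have := mu i; rewrite ler_norml => /andP[m1 m2] p.
  by rewrite -[ltRHS]invr1 ltf_pV2 ?posrE//; lra.
by move=> i; have := mu i; rewrite ler_norml => /andP[m1 m2]; apply/andP; lra.
Qed.

(** Subtracting the two mean equations exhibits the increment of zeta as a weighted mean, with
    positive weights, of the (t - s) d_i. *)
Lemma zeta_lipschitz s t : `|s| * M <= 1 / 5 -> `|t| * M <= 1 / 5 ->
  `|zeta t - zeta s| <= M * `|t - s|.
Proof.
move=> sM tM; have [ps as_] := zeta_root sM; have [pt at_] := zeta_root tM.
pose g i := ((zeta t - t * d i) * (zeta s - s * d i))^-1.
have g0 i : 0 < g i by rewrite invr_gt0 mulr_gt0.
have key : \sum_i g i * ((zeta t - zeta s) - (t - s) * d i) = 0.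
  have : N^-1 * \sum_i (zeta s - s * d i)^-1 - N^-1 * \sum_i (zeta t - t * d i)^-1 = 0.
    by rewrite as_ at_ subrr.
  rewrite -mulrBr => /eqP; rewrite mulf_eq0 invr_eq0 (gt_eqF N0) /= => /eqP h.
  rewrite -[RHS]h -sumrB; apply: eq_bigr => i _.
  by rewrite /g; field; rewrite !gt_eqF.
have db i : `|(t - s) * d i| <= M * `|t - s| by rewrite normrM mulrC ler_wpM2r.
rewrite ler_norml; apply/andP; split; rewrite leNgt; apply/negP => lt.
- suff : \sum_i g i * ((zeta t - zeta s) - (t - s) * d i) < 0 by rewrite key ltxx.
  rewrite -oppr_gt0 -sumrN (bigD1 ord0)//= ltr_wpDr//.
    apply: sumr_ge0 => i _; rewrite -mulrN mulr_ge0 ?ltW// oppr_gt0 subr_lt0.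
    by apply: lt_le_trans lt _; have := db i; rewrite ler_norml => /andP[].
  rewrite -mulrN mulr_gt0// oppr_gt0 subr_lt0.
  by apply: lt_le_trans lt _; have := db ord0; rewrite ler_norml => /andP[].
- suff : 0 < \sum_i g i * ((zeta t - zeta s) - (t - s) * d i) by rewrite key ltxx.
  rewrite (bigD1 ord0)//= ltr_wpDr//.
    apply: sumr_ge0 => i _; rewrite mulr_ge0 ?ltW// subr_gt0.
    by apply: le_lt_trans _ lt; have := db i; rewrite ler_norml => /andP[].
  rewrite mulr_gt0// subr_gt0.
  by apply: le_lt_trans _ lt; have := db ord0; rewrite ler_norml => /andP[].
Qed.

Definition Phi s := zeta s - 1 - N^-1 * \sum_i ln (zeta s - s * d i).
(** The R-transform with its singularity at 0 removed. *)
Definition rho s := N^-1 * \sum_i d i / (zeta s - s * d i).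

Lemma radius_exists s : `|s| * M < 1 / 5 ->
  exists2 dl : R, 0 < dl & forall h : R, `|h| <= dl -> `|s + h| * M <= 1 / 5.
Proof.
move=> sM; exists ((1 / 5 - `|s| * M) / M).
  by rewrite divr_gt0// subr_gt0.
move=> h; rewrite ler_pdivlMr// => hM.
apply: le_trans (ler_wpM2r (ltW M0) (ler_normD s h)) _; lra.
Qed.

Lemma den_shift_le s h i : `|s| * M <= 1 / 5 -> `|s + h| * M <= 1 / 5 ->
  `|(zeta (s + h) - (s + h) * d i) - (zeta s - s * d i)| <= 2 * M * `|h|.
Proof.
move=> sM shM; have := zeta_lipschitz sM shM; rewrite [s + h - s]addrC addKr => zl.
have -> : zeta (s + h) - (s + h) * d i - (zeta s - s * d i) =
  (zeta (s + h) - zeta s) - h * d i by ring.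
rewrite (le_trans (ler_normB _ _))// -mulrA [2 * _]mulr_natl mulr2n lerD//.
by rewrite normrM mulrC ler_wpM2r.
Qed.

Lemma avg_norm_le (f : 'I_n.+1 -> R) C : (forall i, `|f i| <= C) ->
  `|N^-1 * \sum_i f i| <= C.
Proof.
move=> fC; rewrite normrM gtr0_norm ?invr_gt0// -[leRHS]avg_cst ler_pM2l ?invr_gt0//.
by rewrite (le_trans (ler_norm_sum _ _ _))// ler_sum.
Qed.

Lemma rho_continuous s : `|s| * M < 1 / 5 -> {for s, continuous rho}.
Proof.
move=> sM; have [dl dl0 hdl] := radius_exists sM.
apply: (@lipschitz_continuous _ _ _ (6 * M ^+ 2) dl) => // h hd.
have shM := hdl h hd; have sM' := ltW sM.
rewrite /rho -mulrBr -sumrB; apply: avg_norm_le => i.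
have /andP[a1 _] := zeta_bounds sM' i; have /andP[b1 _] := zeta_bounds shM i.
have := den_shift_le i sM' shM.
move: (zeta s - s * d i) (zeta (s + h) - (s + h) * d i) a1 b1 => a b a1 b1 ab.
have a0 : 0 < a by lra.
have b0 : 0 < b by lra.
have -> : d i / b - d i / a = d i * (a - b) / (a * b) by field; rewrite !gt_eqF.
rewrite normrM normfV (gtr0_norm (mulr_gt0 a0 b0)) ler_pdivrMr ?mulr_gt0//.
rewrite normrM distrC.
apply: (@le_trans _ _ (M * (2 * M * `|h|))); first exact: ler_pM.
have ab1 : 3 / 5 * (3 / 5) <= a * b by apply: ler_pM => //; lra.
have -> : M * (2 * M * `|h|) = 6 * M ^+ 2 * `|h| * 3^-1 by field.
have q0 : 0 <= 6 * M ^+ 2 * `|h| by apply: mulr_ge0 => //; apply: mulr_ge0 => //; exact: sqr_ge0.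
by apply: ler_wpM2l => //; lra.
Qed.

(* As a function of zeta and s separately, Phi is stationary in zeta; hence the
   Lipschitz bound on zeta suffices and zeta need not be differentiated. *)
Lemma is_derive_Phi s : `|s| * M < 1 / 5 -> is_derive s (1 : R) Phi (rho s).
Proof.
move=> sM; have [dl dl0 hdl] := radius_exists sM.
apply: (@quadratic_is_derive _ _ _ _ (12 * M ^+ 2) dl) => // h hd.
have shM := hdl h hd; have sM' := ltW sM.
have [ps as_] := zeta_root sM'.
pose a i := zeta s - s * d i; pose b i := zeta (s + h) - (s + h) * d i.
have -> : Phi (s + h) - Phi s - h * rho s =
    - (N^-1 * \sum_i (ln (b i) - ln (a i) - (b i - a i) / a i)).
  have e1 : N^-1 * \sum_i (b i - a i) / a i = (zeta (s + h) - zeta s) - h * rho s.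
    transitivity (N^-1 * \sum_i ((zeta (s + h) - zeta s) * (a i)^-1 - h * (d i / a i))).
      congr (_ * _); apply: eq_bigr => i _.
      have -> : b i - a i = (zeta (s + h) - zeta s) - h * d i by rewrite /a /b; ring.
      by rewrite mulrBl mulrA.
    rewrite sumrB -!mulr_sumr mulrBr [N^-1 * (_ * _)]mulrCA [N^-1 * (h * _)]mulrCA.
    by rewrite as_ mulr1.
  rewrite !sumrB !mulrBr e1 /Phi -/(a _); ring.
rewrite normrN; apply: avg_norm_le => i.
have /andP[a1 _] := zeta_bounds sM' i; have /andP[b1 _] := zeta_bounds shM i.
apply: le_trans (ln_taylor_le a1 b1) _.
have := den_shift_le i sM' shM; rewrite -/(a i) -/(b i) => ab.
rewrite -[(b i - a i) ^+ 2]real_normK ?num_real//.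
have -> : 12 * M ^+ 2 * h ^+ 2 = 3 * (2 * M * `|h|) ^+ 2.
  by rewrite exprMn real_normK ?num_real//; ring.
by rewrite ler_wpM2l// lerXn2r ?nnegrE// mulr_ge0// mulr_ge0// ltW.
Qed.

Lemma Phi0 : Phi 0 = 0.
Proof.
rewrite /Phi /zeta eqxx subrr sub0r big1 ?mulr0 ?oppr0// => i _.
by rewrite mul0r subr0 ln1.
Qed.

Lemma RtransformE s : s != 0 -> Rtransform B s = (zeta s - 1) / s.
Proof. by move=> s0; rewrite /Rtransform /zeta (negbTE s0); field. Qed.

Lemma Rtransform_rho s : s != 0 -> `|s| * M <= 1 / 5 -> Rtransform B s = rho s.
Proof.
move=> s0 sM; rewrite RtransformE//; apply: (canLR (mulfK s0)).
have [pos avg] := zeta_root sM.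
have : N^-1 * \sum_i (zeta s - s * d i) / (zeta s - s * d i) = 1.
  by under eq_bigr do rewrite divff ?gt_eqF//; exact: avg_cst.
under eq_bigr do rewrite mulrBl.
rewrite sumrB mulrBr -mulr_sumr mulrCA avg mulr1 => h.
rewrite -[X in _ - X]h opprB addrC subrK /rho -mulrA mulr_suml; congr (_ * _).
by apply: eq_bigr => i _; rewrite -mulrA mulrC.
Qed.

(** At 0 [Rtransform] has a junk value: the endpoint is dropped before passing to [rho] and restored
    afterwards, on either side of 0. *)
Lemma oriented_integral_Rtransform s : s != 0 -> `|s| * M < 1 / 5 ->
  oriented_integral (Rtransform B) 0 s = Phi s.
Proof.
move=> s0 sM.
have tM (t : R) : `|t| <= `|s| -> `|t| * M < 1 / 5.
  by move=> ts; apply: le_lt_trans sM; rewrite ler_wpM2r// ltW.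
have cont a b : (forall t, a <= t <= b -> `|t| <= `|s|) ->
    {within `[a, b], continuous rho}.
  move=> h; apply: continuous_in_subspaceT => t /[!inE]/= /[!in_itv]/= tab.
  exact/rho_continuous/tM/h.
have int a b : (forall t, a <= t <= b -> `|t| <= `|s|) ->
    lebesgue_measure.-integrable `[a, b] (EFin \o rho).
  move=> h; apply: continuous_compact_integrable; first exact: segment_compact.
  exact: cont.
rewrite /oriented_integral; case: ifPn => [s_ge0|]; last rewrite -ltNge => s_lt0.
  have sp : 0 < s by rewrite lt_neqAle eq_sym s0.
  have h (t : R) : 0 <= t <= s -> `|t| <= `|s|.
    by move=> /andP[t0 ts]; rewrite !ger0_norm.
  have i0 : lebesgue_measure.-integrable `]0, s] (EFin \o rho).
    apply: integrableS (int _ _ h) => //.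
    by apply: subset_itvr; rewrite bnd_simp.
  have e0 : {in `]0, s], rho =1 Rtransform B}.
    move=> t /[!in_itv]/= /andP[t0 ts]; rewrite Rtransform_rho ?gt_eqF//.
    by rewrite ltW// tM// h// ltW.
  have i1 : lebesgue_measure.-integrable `]0, s] (EFin \o Rtransform B).
    by apply: eq_integrable i0 => // t /[!inE]/= ht; rewrite /= e0.
  rewrite -(Rintegral_itv_obnd_cbnd i1).
  have -> : \int[lebesgue_measure]_(x in `]0, s]) Rtransform B x =
      \int[lebesgue_measure]_(x in `]0, s]) rho x.
    by apply: eq_Rintegral => t; rewrite inE /= => ht; rewrite e0.
  have := Rintegral_primitive sp (cont _ _ h) (fun (t : R) ht => is_derive_Phi (tM t (h t ht))).
  by rewrite (Rintegral_itv_obnd_cbnd i0) => ->; rewrite Phi0 subr0.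
have h (t : R) : s <= t <= 0 -> `|t| <= `|s|.
  by move=> /andP[t0 ts]; rewrite !ler0_norm// ?lerN2// ltW.
have i0 : lebesgue_measure.-integrable `[s, 0[ (EFin \o rho).
  apply: integrableS (int _ _ h) => //.
  by apply: subset_itvl; rewrite bnd_simp.
have e0 : {in `[s, 0[, rho =1 Rtransform B}.
  move=> t /[!in_itv]/= /andP[t0 ts]; rewrite Rtransform_rho ?lt_eqF//.
  by rewrite ltW// tM// h// t0 ltW.
have i1 : lebesgue_measure.-integrable `[s, 0[ (EFin \o Rtransform B).
  by apply: eq_integrable i0 => // t /[!inE]/= ht; rewrite /= e0.
rewrite -(Rintegral_itv_bndo_bndc i1).
have -> : \int[lebesgue_measure]_(x in `[s, 0[) Rtransform B x =
    \int[lebesgue_measure]_(x in `[s, 0[) rho x.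
  by apply: eq_Rintegral => t; rewrite inE /= => ht; rewrite e0.
have := Rintegral_primitive s_lt0 (cont _ _ h) (fun (t : R) ht => is_derive_Phi (tM t (h t ht))).
by rewrite (Rintegral_itv_bndo_bndc i0) => ->; rewrite Phi0 sub0r opprK.
Qed.

Lemma derive1n_hilbert m z : (forall i, z != d i) ->
  derive1n m (hilbert B) z =
  N^-1 * \sum_i (-1) ^+ m * m`!%:R * (z - d i)^-1 ^+ m.+1.
Proof.
elim: m z => [|m IHm] z zd.
  by rewrite derive1n0 hilbertE; congr (_ * _); apply: eq_bigr => i _; rewrite expr0 mul1r mul1r expr1.
rewrite derive1nS derive1E.
(* The next derivative needs the formula near z, and avoiding the d i is an open condition. *)
have near_eq : \forall w \near z, derive1n m (hilbert B) w =
    N^-1 * \sum_i (-1) ^+ m * m`!%:R * (w - d i)^-1 ^+ m.+1.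
  have : \forall w \near z, forall i, w != d i.
    apply: (@filter_forall R _ (fun i w => w != d i) (nbhs z) (nbhs_filter z)) => i.
    by apply: open_nbhs_nbhs; split; [exact: open_neq|exact: zd].
  by move=> nh; apply: (@filterS _ (nbhs z) (nbhs_filter z) _ _ _ nh) => w; exact: IHm.
rewrite (near_eq_derive _ near_eq).
have dinv i : is_derive z (1 : R) (fun w => (w - d i)^-1) (- 1 / (z - d i) ^+ 2).
  apply: (@is_derive_pointV _ (fun w => w - d i)); first by rewrite subr_eq0.
  refine (is_derive_ext (is_derive_pointD (is_derive_id z (1 : R))
    (is_derive_cst (- d i) z (1 : R))) _ _) => //.
  by rewrite addr0.
have dpow i k : is_derive z (1 : R) (fun w => (w - d i)^-1 ^+ k)
    (- k%:R * (z - d i)^-1 ^+ k.+1).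
  elim: k => [|k IHk].
    refine (is_derive_ext (is_derive_cst (1 : R) z (1 : R)) _ _).
      by move=> w; rewrite expr0.
    by rewrite oppr0 mul0r.
  refine (is_derive_ext (is_derive_pointM (dinv i) IHk) _ _).
    by move=> w; rewrite exprS.
  rewrite -exprVn -[k.+1%:R]natr1 !exprS; ring.
have dall : is_derive z (1 : R)
    (fun w => N^-1 * \sum_i (-1) ^+ m * m`!%:R * (w - d i)^-1 ^+ m.+1)
    (N^-1 * \sum_i (-1) ^+ m.+1 * m.+1`!%:R * (z - d i)^-1 ^+ m.+2).
  have ds : is_derive z (1 : R) (fun w => \sum_i (-1) ^+ m * m`!%:R * (w - d i)^-1 ^+ m.+1)
     (\sum_i (-1) ^+ m.+1 * m.+1`!%:R * (z - d i)^-1 ^+ m.+2).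
    apply: is_derive_sumr => i.
    refine (is_derive_ext (is_derive_pointM
      (is_derive_cst ((-1) ^+ m * m`!%:R : R) z (1 : R)) (dpow i m.+1)) _ _) => //.
    by rewrite mul0r add0r /cst factS natrM [(-1) ^+ m.+1]exprS; ring.
  refine (is_derive_ext (is_derive_pointM (is_derive_cst (N^-1 : R) z (1 : R)) ds) _ _) => //.
  by rewrite mul0r add0r.
by have [_ ->] := dall.
Qed.

Lemma AcoefE theta k : theta != 0 -> `|2 * theta| * M <= 1 / 5 -> (0 < k)%N ->
  Acoef B theta k = N^-1 * \sum_i (zeta (2 * theta) - 2 * theta * d i)^-1 ^+ k.
Proof.
case: k => // k th0 sM _; set s := 2 * theta.
have s0 : s != 0 by rewrite mulf_neq0.
have [pos avg] := zeta_root sM.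
have vE : vpar B theta + s^-1 = zeta s / s.
  by rewrite /vpar RtransformE// -/s; field.
rewrite /Acoef /= -/s vE derive1n_hilbert => [|i]; last first.
  rewrite -subr_eq0 (_ : _ - _ = (zeta s - s * d i) / s); last by field.
  by rewrite mulf_neq0 ?invr_eq0// gt_eqF.
rewrite mulrCA mulr_sumr; congr (_ * _); apply: eq_bigr => i _.
have -> : (zeta s / s - d i)^-1 = s * (zeta s - s * d i)^-1.
  by rewrite -[RHS]invf_div; congr (_^-1); field.
rewrite [(s * _) ^+ _]exprMn.
have f0 : k`!%:R != 0 :> R by rewrite pnatr_eq0 -lt0n fact_gt0.
have sk : s ^+ k.+1 != 0 by rewrite expf_neq0.
rewrite [(k`!%:R * _)^-1]invfM.
transitivity ((-1) ^+ k * (-1) ^+ k * (k`!%:R / k`!%:R) * (s ^+ k.+1 / s ^+ k.+1)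
  * (zeta s - s * d i)^-1 ^+ k.+1); first by ring.
by rewrite -exprMn mulrNN mulr1 expr1n !divff// !mul1r.
Qed.

End RTransform.

(** * The theorem *)

Section Reduction.
Variable R : realType.

(** Left invariance absorbs the change of basis. *)
Lemma spherical_integralE n (mu : probability (borel_mx R n.+1) R) theta
    (B O : 'M[R]_n.+1) (d : 'rV[R]_n.+1) :
  is_haar mu -> O^T *m O = 1%:M -> B = O^T *m diag_mx d *m O ->
  spherical_integral mu theta B =
  Ex mu (fun U => expR (theta * n.+1%:R * qform (d ord0) U)).
Proof.
move=> haar OO BE.
pose g (U : borel_mx R n.+1) := expR (theta * n.+1%:R * qform (d ord0) U).
have bg : bmeas g.
  by apply: bmeas_expR; apply: bmeasM; [exact: bmeas_cst|exact: bmeas_qform].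
rewrite -[RHS](Ex_mulmx haar OO bg); apply: eq_Ex => U _.
rewrite /g; congr (expR (_ * _)).
have -> : (col ord0 U)^T *m B *m col ord0 U =
    (col ord0 (O *m U))^T *m diag_mx d *m col ord0 (O *m U).
  by rewrite BE !colE !trmx_mul !mulmxA.
rewrite mxE /qform; apply: eq_bigr => i _.
by rewrite mul_mx_diag !mxE; ring.
Qed.

(** Since y_i / (1 + y_i) = 1 - a_i = s lambda_i + 1 - zeta and the column has norm 1, the two
    exponents differ by the constant N (zeta - 1) / 2, which cancels the term zeta - 1 of [Phi]. The
    bound 2/3 comes from 3/5 <= a_i <= 7/5. *)
Lemma reduction n (B : 'M[R]_n.+1) (theta M : R) :
  B^T = B -> 0 < M -> opnorm B < M -> theta != 0 -> `|2 * theta| * M < 1 / 5 ->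
  exists y : 'I_n.+1 -> R, [/\ forall i, `|y i| <= 2 / 3, \sum_i y i = 0,
    forall k, (0 < k)%N -> Acoef B theta k = n.+1%:R^-1 * \sum_i (1 + y i) ^+ k &
    forall mu : probability (borel_mx R n.+1) R, is_haar mu ->
      expR (- (n.+1%:R / 2) * oriented_integral (Rtransform B) 0 (2 * theta))
        * spherical_integral mu theta B =
      Ex mu (fun U => expR (n.+1%:R / 2 * qform (fun i => y i / (1 + y i)) U))
        * expR (- (\sum_i ln (1 + y i)) / 2)].
Proof.
move=> Bsym M0 BM th0 sM; have sM' := ltW sM; set s := 2 * theta in sM sM' *.
have s0 : s != 0 by rewrite mulf_neq0.
have [Q [dr [OO BE]]] := real_spectral Bsym.
have d_perm := perm_eigenvalues OO BE; pose d := dr ord0.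
have d_le i : `|d i| <= M.
  rewrite ltW// (le_lt_trans _ BM)// opnorm_ge//.
  by rewrite (perm_mem d_perm); apply/map_f; rewrite mem_enum.
have [pos avg] := zeta_root d_perm d_le sM'.
have bds := zeta_bounds d_perm d_le sM'.
set z := zeta B s in pos avg bds.
have N0 : n.+1%:R != 0 :> R by rewrite pnatr_eq0.
pose y i := (z - s * d i)^-1 - 1.
have y1 i : 1 + y i = (z - s * d i)^-1 by rewrite /y addrC subrK.
exists y; split.
- move=> i; have /andP[a1 a2] := bds i; have p := pos i.
  have h1 : (z - s * d i)^-1 <= 5 / 3.
    have -> : 5 / 3 = (3 / 5)^-1 :> R by rewrite invf_div.
    by rewrite lef_pV2 ?posrE//; lra.
  have h2 : 5 / 7 <= (z - s * d i)^-1.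
    have -> : 5 / 7 = (7 / 5)^-1 :> R by rewrite invf_div.
    by rewrite lef_pV2 ?posrE//; lra.
  by rewrite /y ler_norml; apply/andP; lra.
- rewrite sumrB sumr_const card_ord; apply/eqP; rewrite subr_eq0; apply/eqP.
  by apply: (mulfI (invr_neq0 N0)); rewrite avg mulVf.
- move=> k k0; rewrite (AcoefE d_perm d_le th0 sM' k0).
  by congr (_ * _); apply: eq_bigr => i _; rewrite y1.
move=> mu haar; rewrite (spherical_integralE theta haar OO BE).
rewrite (oriented_integral_Rtransform d_perm M0 d_le s0 sM) /Phi -/z -/d.
have -> : Ex mu (fun U => expR (theta * n.+1%:R * qform d U)) =
    expR (n.+1%:R / 2 * (z - 1)) *
    Ex mu (fun U => expR (n.+1%:R / 2 * qform (fun i => y i / (1 + y i)) U)).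
  rewrite -ExZ; last first.
    by apply: bmeas_expR; apply: bmeasM; [exact: bmeas_cst|exact: bmeas_qform].
  apply: eq_Ex => U OU; rewrite -expRD; congr expR.
  have -> : (fun i => y i / (1 + y i)) = (fun i => s * d i + (1 - z) * 1).
    apply/funext => i; rewrite y1 /y invrK; have := pos i; move=> p.
    by field; rewrite gt_eqF.
  by rewrite qform_lin qform1// /s; field.
have -> : \sum_i ln (1 + y i) = - \sum_i ln (z - s * d i).
  by rewrite -sumrN; apply: eq_bigr => i _; rewrite y1 lnV ?posrE.
rewrite mulrA -expRD mulrC; congr (_ * expR _).
by field.
Qed.

End Reduction.

(** * From the A_k to the power means of the y_i *)

Section Coefficients.
Variables (R : realType) (n : nat).

(* A_0 = A_1 = 1; the entries of the row vector are A_2, ..., A_(2n+2). *)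
Definition A_of_vec (a : 'rV[R]_(n.*2.+1)) (i : nat) : R :=
  if i is j.+2 then (if (j < n.*2.+1)%N then a ord0 (inord j) else 0) else 1.

(** Binomial inversion, from y = (1 + y) - 1. *)
Definition psum_of_vec (a : 'rV[R]_(n.*2.+1)) (l : nat) : R :=
  \sum_(i < l.+1) (-1) ^+ (l - i) * A_of_vec a i *+ 'C(l, i).

Lemma expansion_coef_local (s s' : nat -> R) k :
  (forall i, (i <= n.*2.+2)%N -> s i = s' i) ->
  expansion_coef s n k = expansion_coef s' n k.
Proof.
move=> ss; have bE j : (j <= n)%N -> beta s j = beta s' j.
  move=> jn; apply: eq_Rintegral => t _; congr (_ * _).
  by apply: zcoef_local => [|i hi]; [lia|apply: ss; lia].
have tE : tail_poly n (beta s) = tail_poly n (beta s').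
  by rewrite /tail_poly; apply: eq_poly => j jn; rewrite bE.
by rewrite /expansion_coef /exp_poly tE (bE 0).
Qed.

Lemma psum_of_vecE m (B : 'M[R]_m.+1) (theta : R) (y : 'I_m.+1 -> R) :
  \sum_i y i = 0 ->
  (forall k, (0 < k)%N -> Acoef B theta k = m.+1%:R^-1 * \sum_i (1 + y i) ^+ k) ->
  forall l, (l <= n.*2.+2)%N -> psum_of_vec (Avec n B theta) l = psum y l.
Proof.
move=> y0 AE l ln.
have N0 : m.+1%:R != 0 :> R by rewrite pnatr_eq0.
have vE i : (i <= l)%N -> A_of_vec (Avec n B theta) i = m.+1%:R^-1 * \sum_j (1 + y j) ^+ i.
  case: i => [_|[_|i il]].
  - under eq_bigr do rewrite expr0.
    by rewrite sumr_const card_ord mulVf.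
  - under eq_bigr do rewrite expr1.
    by rewrite big_split /= y0 addr0 sumr_const card_ord mulVf.
  - have iln : (i < n.*2.+1)%N by lia.
    by rewrite /= iln mxE inordK// AE.
rewrite /psum_of_vec /psum.
transitivity (m.+1%:R^-1 * \sum_j \sum_(i < l.+1) (-1) ^+ (l - i) * (1 + y j) ^+ i *+ 'C(l, i)).
  rewrite exchange_big mulr_sumr; apply: eq_bigr => i _ /=.
  have il : (i <= l)%N by rewrite -ltnS.
  rewrite vE// -mulrnAl mulrCA; congr (_ * _).
  by rewrite mulr_sumr; apply: eq_bigr => j _; rewrite mulrnAl.
congr (_ * _); apply: eq_bigr => j _.
by rewrite -exprDn addrA addNr add0r.
Qed.

End Coefficients.

(* The sequence is indexed from 0: [B N] is the matrix of size N.+1. *)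
Theorem theorem2 (R : realType) (n : nat) :
  exists m : nat -> R -> R -> 'rV[R]_(n.*2.+1) -> R,
  forall (M : R) (B : forall N : nat, 'M[R]_N.+1)
    (mu : forall N : nat, probability (borel_mx R N.+1) R) (theta : R),
  0 < M ->
  (forall N : nat, (B N)^T = B N) ->
  (ereal_sup (range (fun N : nat => (opnorm (B N))%:E)) < M%:E)%E ->
  (forall N : nat, is_haar (mu N)) ->
  theta != 0 ->
  `|theta| < (4 * M ^+ 2 + 10 * M + 1)^-1 ->
  let v := fun N : nat => vpar (B N) theta in
  let A := fun (N k : nat) => Acoef (B N) theta k in
  let coef := fun (N k : nat) => m k theta (v N) (Avec n (B N) theta) in
  [/\ exists C : R, 0 < C /\
        forall N : nat,
          `| expR (- (N.+1%:R / 2)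
                   * oriented_integral (Rtransform (B N)) 0 (2 * theta))
             * spherical_integral (mu N) theta (B N)
             - \sum_(k < n.+1) coef N k / N.+1%:R ^+ k |
          <= C / N.+1%:R ^+ n.+1,
      forall N : nat, coef N 0%N = (Num.sqrt (A N 2%N))^-1
    & (0 < n)%N ->
      forall N : nat,
        coef N 1%N = (Num.sqrt (A N 2%N))^-1 *
          (3 / 2 * (A N 4%N / A N 2%N ^+ 2) - 5 / 3 * (A N 3%N ^+ 2 / A N 2%N ^+ 3)
           + 6^-1)].
Proof.
exists (fun k _ _ a => expansion_coef (psum_of_vec a) n k).
move=> M B mu theta M0 Bsym Bsup haar th0 thM v A coef.
have BM N : opnorm (B N) < M.
  rewrite -lte_fin; apply: le_lt_trans Bsup.
  by apply: ereal_sup_ubound; exists N.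
(* The denominator bounding theta exceeds 10 M. *)
have sM : `|2 * theta| * M < 1 / 5.
  have P0 : 0 < 4 * M ^+ 2 + 10 * M + 1.
    by rewrite addr_gt0// addr_gt0// mulr_gt0// exprn_gt0.
  move: thM; rewrite -[_^-1]mul1r ltr_pdivlMr// => thM.
  rewrite normrM ger0_norm//.
  have : 0 <= `|theta| * M ^+ 2 by rewrite mulr_ge0// sqr_ge0.
  have : 0 <= `|theta| by []; move: thM; move: (`|theta|) => t; rewrite expr2; nra.
have red N := reduction (Bsym N) M0 (BM N) th0 sM.
have coefE N (y : 'I_N.+1 -> R) k : \sum_i y i = 0 ->
    (forall k, (0 < k)%N -> Acoef (B N) theta k = N.+1%:R^-1 * \sum_i (1 + y i) ^+ k) ->
    coef N k = expansion_coef (psum y) n k.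
  by move=> y0 AE; apply: expansion_coef_local => i; exact: psum_of_vecE.
have psumA N (y : 'I_N.+1 -> R) : \sum_i y i = 0 ->
    (forall k, (0 < k)%N -> Acoef (B N) theta k = N.+1%:R^-1 * \sum_i (1 + y i) ^+ k) ->
    [/\ 0 <= psum y 2, 1 + psum y 2 = A N 2%N,
        1 + 3 * psum y 2 + psum y 3 = A N 3%N &
        1 + 6 * psum y 2 + 4 * psum y 3 + psum y 4 = A N 4%N].
  move=> y0 AE.
  have N0 : N.+1%:R != 0 :> R by rewrite pnatr_eq0.
  have c1 : 1 = N.+1%:R^-1 * \sum_(i < N.+1) 1 :> R.
    by rewrite sumr_const card_ord mulVf.
  split.
  - by rewrite /psum mulr_ge0// sumr_ge0// => i _; exact: sqr_ge0.
  - have E : \sum_i (1 + y i) ^+ 2 =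
        \sum_(i < N.+1) 1 + 2 * (\sum_i y i) + \sum_i y i ^+ 2.
      by rewrite mulr_sumr -!big_split; apply: eq_bigr => i _ /=; ring.
    by rewrite /A AE// E y0 mulr0 addr0 mulrDr -c1.
  - have E : \sum_i (1 + y i) ^+ 3 =
        \sum_(i < N.+1) 1 + 3 * (\sum_i y i) + 3 * (\sum_i y i ^+ 2) + \sum_i y i ^+ 3.
      by rewrite !mulr_sumr -!big_split; apply: eq_bigr => i _ /=; ring.
    by rewrite /A AE// E y0 mulr0 addr0 !mulrDr -c1 (mulrCA _ 3).
  - have E : \sum_i (1 + y i) ^+ 4 = \sum_(i < N.+1) 1 + 4 * (\sum_i y i)
        + 6 * (\sum_i y i ^+ 2) + 4 * (\sum_i y i ^+ 3) + \sum_i y i ^+ 4.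
      by rewrite !mulr_sumr -!big_split; apply: eq_bigr => i _ /=; ring.
    by rewrite /A AE// E y0 mulr0 addr0 !mulrDr -c1 (mulrCA _ 6) (mulrCA _ 4).
have expE (u : R) : 0 < u -> expR (- (ln u / 2)) = (Num.sqrt u)^-1.
  move=> u0; rewrite expRN; congr (_^-1).
  rewrite -[in RHS](lnK u0) [ln u in RHS]splitr expRD -expr2 sqrtr_sqr.
  by rewrite ger0_norm ?expR_ge0.
split.
- have [C hC] := core_expansion R n; exists (`|C| + 1); split.
    by rewrite ltr_wpDl.
  move=> N; have [y [yl y0 AE yI]] := red N.
  rewrite (yI (mu N) (haar N)).
  have -> : \sum_(k < n.+1) coef N k / N.+1%:R ^+ k =
      \sum_(k < n.+1) expansion_coef (psum y) n k / N.+1%:R ^+ k.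
    by apply: eq_bigr => k _; rewrite (coefE N y k y0 AE).
  apply: le_trans (hC N (mu N) y (haar N) yl y0) _.
  rewrite ler_pM2r ?invr_gt0 ?exprn_gt0//.
  by rewrite (le_trans (ler_norm C))// lerDl.
- move=> N; have [y [yl y0 AE _]] := red N.
  have [s2 <- _ _] := psumA N y y0 AE.
  rewrite (coefE N y _ y0 AE) /expansion_coef exp_poly_coef0 mulr1 beta0E//.
  by rewrite expE// ltr_wpDr.
- move=> n0 N; have [y [yl y0 AE _]] := red N.
  have [s2 <- <- <-] := psumA N y y0 AE.
  rewrite (coefE N y _ y0 AE) /expansion_coef exp_poly_coef1// beta0E// beta1E// opprK.
  rewrite expE; last by rewrite ltr_wpDr.
  by rewrite /log_coef1 /A2s /A3s /A4s !expr1n !mul1r !mulr1.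
Qed.
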